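(* Let $\gamma\in \mathrm{PSL}(n+1,\mathbb{H})$ be a projective transformation and let $\Gamma:=\langle\gamma\rangle\subset \mathrm{PSL}(n+1,\mathbb{H})$ be the cyclic subgroup generated by $\gamma$. Denote by $\mathrm{Eq}(\Gamma)\subset\mathbb{P}^n_{\mathbb{H}}$ the equicontinuity set of the family $\Gamma$. Then the following holds. (i) The element $\gamma$ is elliptic if and only if $\mathrm{Eq}(\Gamma)=\mathbb{P}^n_{\mathbb{H}}$. (ii) The element $\gamma$ is parabolic if and only if the complement $\mathbb{P}^n_{\mathbb{H}}\setminus \mathrm{Eq}(\Gamma)$ is a single projective subspace $L$. (iii) The element $\gamma$ is loxodromic if and only if it is diagonalizable and the complement $\mathbb{P}^n_{\mathbb{H}}\setminus \mathrm{Eq}(\Gamma)$ can be described as the union of two distinct proper projective subspaces $L_1, L_2$ of $\mathbb{P}^n_{\mathbb{H}}$. (iv) The element $\gamma$ is loxoparabolic if and only if it is not diagonalizable and the complement $\mathbb{P}^n_{\mathbb{H}}\setminus \mathrm{Eq}(\Gamma)$ can be described as the union of two distinct proper projective subspaces $L_1, L_2$ of $\mathbb{P}^n_{\mathbb{H}}$.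
   Context: $\mathbb{H}$ is the division ring of quaternions. $\mathbb{H}^{n+1}$ is a right $\mathbb{H}$-vector space and $\mathbb{P}^n_{\mathbb{H}}=(\mathbb{H}^{n+1}\setminus\{0\})/\sim$, where $z\sim w$ iff $z=w\alpha$ for some $\alpha\in\mathbb{H}\setminus\{0\}$; $\mathbb{P}$ is the quotient map. A subset $W\subseteq\mathbb{P}^n_{\mathbb{H}}$ is a $k$-dimensional projective subspace if there is a $(k+1)$-dimensional $\mathbb{H}$-linear subspace $\widetilde W\subseteq \mathbb{H}^{n+1}$ with $\mathbb{P}(\widetilde W\setminus\{0\})=W$. Writing a quaternionic matrix as $A=A_1+A_2 j$ with $A_1,A_2$ complex, put $\Phi(A)=\begin{bmatrix}A_1&A_2\\-\overline{A_2}&\overline{A_1}\end{bmatrix}$ and $\det_{\mathbb{H}}(A)=\det\Phi(A)$. $\mathrm{GL}(n+1,\mathbb{H})=\{g:\det_{\mathbb{H}}(g)\neq 0\}$, $\mathrm{SL}(n+1,\mathbb{H})=\{g:\det_{\mathbb{H}}(g)=1\}$ and $\mathrm{PSL}(n+1,\mathbb{H})=\mathrm{SL}(n+1,\mathbb{H})/\{\pm I\}$, acting on $\mathbb{P}^n_{\mathbb{H}}$ by $\gamma(\mathbb{P}(z))=\mathbb{P}(\gamma z)$. A (right) eigenvalue of a quaternionic matrix $A$ is $\lambda\in\mathbb{H}$ with $Av=v\lambda$ for some $v\ne0$; eigenvalues come in similarity classes $\{\mu^{-1}\lambda\mu:\mu\in\mathbb{H}\setminus\{0\}\}$, and the modulus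 is constant on a class. An element of $\mathrm{PSL}(n+1,\mathbb{H})$ is semisimple (diagonalizable) if a lift to $\mathrm{SL}(n+1,\mathbb{H})$ is conjugate in $\mathrm{GL}(n+1,\mathbb{H})$ to a diagonal matrix. An element $g\in\mathrm{PSL}(n+1,\mathbb{H})$ is: elliptic if it is semisimple and all its eigenvalue classes are represented by quaternions of unit modulus; parabolic if it is not semisimple and all its eigenvalues have unit modulus; loxodromic if it is semisimple but not all its eigenvalue classes are represented by unit modulus quaternions; loxoparabolic if it is not semisimple and at least one eigenvalue has non-unit modulus. A family of maps from a topological space into $\mathbb{P}^n_{\mathbb{H}}$ is normal if every sequence in it contains a subsequence that converges uniformly on compact subsets. For a subgroup $G$ of $\mathrm{PSL}(n+1,\mathbb{H})$, the region of equicontinuity (equicontinuity set) $\mathrm{Eq}(G)$ is the set of points $z\in\mathbb{P}^n_{\mathbb{H}}$ for which there exists an open neighborhood $U$ of $z$ such that the restricted family $\{g|_U: g\in G\}$ is normal.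
   Formalization: In (iii) and (iv), ''two distinct proper projective subspaces'' is taken to mean that neither contains the other; with mere L1≠L2 part (iv) fails, since a parabolic element whose complement is a line L2 also has complement L1∪L2 for any point L1 of L2. *)

(* Defs.v *)
From HB Require Import structures.
From mathcomp Require Import all_boot all_order all_algebra.
From mathcomp Require Import generic_quotient complex ring lra.
From mathcomp Require Import all_classical all_reals all_analysis.

Set Implicit Arguments.
Unset Strict Implicit.
Unset Printing Implicit Defensive.

Import Order.TTheory GRing.Theory Num.Theory.
Import numFieldNormedType.Exports.

Local Open Scope classical_set_scope.
Local Open Scope ring_scope.
Local Open Scope complex_scope.
Local Open Scope quotient_scope.

(* [Quat a b c d] is a + b i + c j + d k = (a + b i) + (c + d i) j. *)
Record quat (R : realType) := Quat { qre : R; qi : R; qj : R; qk : R }.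

Section Quaternions.
Variable R : realType.
Implicit Types p q : quat R.

Definition quat_coords q : R * R * R * R := (qre q, qi q, qj q, qk q).
Definition quat_of_coords (t : R * R * R * R) : quat R :=
  let: (a, b, c, d) := t in Quat a b c d.

Lemma quat_coordsK : cancel quat_coords quat_of_coords.
Proof. by case. Qed.

HB.instance Definition _ := Choice.copy (quat R) (can_type quat_coordsK).
HB.instance Definition _ := Topological.copy (quat R) (initial_topology quat_coords).

Lemma quatP p q :
  qre p = qre q -> qi p = qi q -> qj p = qj q -> qk p = qk q -> p = q.
Proof. by case: p => ????; case: q => ???? /= -> -> -> ->. Qed.

Definition addq p q :=
  Quat (qre p + qre q) (qi p + qi q) (qj p + qj q) (qk p + qk q).
Definition oppq q := Quat (- qre q) (- qi q) (- qj q) (- qk q).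
Definition mulq p q :=
  Quat (qre p * qre q - qi p * qi q - qj p * qj q - qk p * qk q)
       (qre p * qi q + qi p * qre q + qj p * qk q - qk p * qj q)
       (qre p * qj q - qi p * qk q + qj p * qre q + qk p * qi q)
       (qre p * qk q + qi p * qj q - qj p * qi q + qk p * qre q).
Definition zeroq : quat R := Quat 0 0 0 0.
Definition oneq : quat R := Quat 1 0 0 0.

Fact addqA : associative addq.
Proof. by move=> x y z; apply: quatP => /=; ring. Qed.
Fact addqC : commutative addq.
Proof. by move=> x y; apply: quatP => /=; ring. Qed.
Fact add0q : left_id zeroq addq.
Proof. by move=> x; apply: quatP => /=; ring. Qed.
Fact addNq : left_inverse zeroq oppq addq.
Proof. by move=> x; apply: quatP => /=; ring. Qed.

HB.instance Definition _ :=
  GRing.isZmodule.Build (quat R) addqA addqC add0q addNq.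

Fact mulqA : associative mulq.
Proof. by move=> x y z; apply: quatP => /=; ring. Qed.
Fact mul1q : left_id oneq mulq.
Proof. by move=> x; apply: quatP => /=; ring. Qed.
Fact mulq1 : right_id oneq mulq.
Proof. by move=> x; apply: quatP => /=; ring. Qed.
Fact mulqDl : left_distributive mulq addq.
Proof. by move=> x y z; apply: quatP => /=; ring. Qed.
Fact mulqDr : right_distributive mulq addq.
Proof. by move=> x y z; apply: quatP => /=; ring. Qed.
Fact oneq_neq0 : oneq != 0.
Proof. by apply/eqP => -[/eqP]; rewrite oner_eq0. Qed.

HB.instance Definition _ :=
  GRing.Zmodule_isNzRing.Build (quat R) mulqA mul1q mulq1 mulqDl mulqDr oneq_neq0.

Definition qnorm2 q : R := qre q ^+ 2 + qi q ^+ 2 + qj q ^+ 2 + qk q ^+ 2.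
Definition qmod q : R := Num.sqrt (qnorm2 q).

Definition invq q : quat R :=
  let: d := qnorm2 q in Quat (qre q / d) (- qi q / d) (- qj q / d) (- qk q / d).

Lemma qnorm2_eq0 q : (qnorm2 q == 0) = (q == 0).
Proof.
apply/idP/eqP => [|->]; last by rewrite /qnorm2 /= !expr0n /= !addr0.
rewrite /qnorm2 !paddr_eq0 ?addr_ge0 ?sqr_ge0// !sqrf_eq0.
by case/andP => /andP[/andP[/eqP ? /eqP ?] /eqP ?] /eqP ?; apply: quatP.
Qed.

Fact mulVq : {in [pred q : quat R | q != 0], left_inverse 1 invq *%R}.
Proof.
move=> q; rewrite inE -qnorm2_eq0 => q0.
by apply: quatP; rewrite /= /qnorm2 in q0 *; field.
Qed.
Fact mulqV : {in [pred q : quat R | q != 0], right_inverse 1 invq *%R}.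
Proof.
move=> q; rewrite inE -qnorm2_eq0 => q0.
by apply: quatP; rewrite /= /qnorm2 in q0 *; field.
Qed.
Fact unitqP p q : q * p = 1 /\ p * q = 1 -> p != 0.
Proof.
by case=> qp _; apply/eqP => p0; move: qp; rewrite p0 mulr0 => /esym/eqP;
  rewrite oner_eq0.
Qed.
Fact invq_out : {in [predC [pred q : quat R | q != 0]], invq =1 id}.
Proof.
move=> q; rewrite !inE negbK => /eqP ->.
by apply: quatP => /=; rewrite ?oppr0 mul0r.
Qed.

HB.instance Definition _ :=
  GRing.NzRing_hasMulInverse.Build (quat R) mulVq mulqV unitqP invq_out.

Lemma unitqE q : (q \is a GRing.unit) = (q != 0).
Proof. by []. Qed.

(* q = qC1 q + qC2 q * j *)
Definition qC1 q : R[i] := qre q +i* qi q.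
Definition qC2 q : R[i] := qj q +i* qk q.
Definition quat_of_C (a b : R[i]) : quat R :=
  let: a1 +i* a2 := a in let: b1 +i* b2 := b in Quat a1 a2 b1 b2.

Lemma qC1D : {morph qC1 : p q / p + q}. Proof. by []. Qed.
Lemma qC2D : {morph qC2 : p q / p + q}. Proof. by []. Qed.
Lemma qC1M p q : qC1 (p * q) = qC1 p * qC1 q - qC2 p * conjc (qC2 q).
Proof. by apply/eqP; rewrite eq_complex /=; apply/andP; split; apply/eqP; ring. Qed.
Lemma qC2M p q : qC2 (p * q) = qC1 p * qC2 q + qC2 p * conjc (qC1 q).
Proof. by apply/eqP; rewrite eq_complex /=; apply/andP; split; apply/eqP; ring. Qed.
Lemma quat_of_CK a b : qC1 (quat_of_C a b) = a /\ qC2 (quat_of_C a b) = b.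
Proof. by case: a => ??; case: b. Qed.
Lemma qC12K q : quat_of_C (qC1 q) (qC2 q) = q.
Proof. by case: q. Qed.

End Quaternions.

Section Phi.
Variables (R : realType) (m : nat).
Implicit Types A B : 'M[quat R]_m.

Local Notation conjm := (map_mx (@conjc R)).

Definition Phi A : 'M[R[i]]_(m + m) :=
  let: A1 := map_mx (@qC1 R) A in let: A2 := map_mx (@qC2 R) A in
  block_mx A1 A2 (- conjm A2) (conjm A1).

Definition detH A : R[i] := \det (Phi A).

Definition PhiInv (M : 'M[R[i]]_(m + m)) : 'M[quat R]_m :=
  \matrix_(i, j) quat_of_C (ulsubmx M i j) (ursubmx M i j).

(* The inverse of a quaternionic matrix with nonzero [detH]; it is computed in
   the complex matrices since [invmx] requires commutative coefficients. *)
Definition invmxH A : 'M[quat R]_m := PhiInv (invmx (Phi A)).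

Lemma PhiK : cancel Phi PhiInv.
Proof.
move=> A; apply/matrixP => i j; rewrite mxE /Phi block_mxKul block_mxKur !mxE.
exact: qC12K.
Qed.

Lemma qC1_mulmx A B : map_mx (@qC1 R) (A *m B) =
  map_mx (@qC1 R) A *m map_mx (@qC1 R) B
  - map_mx (@qC2 R) A *m conjm (map_mx (@qC2 R) B).
Proof.
apply/matrixP => i j; rewrite !mxE (big_morph _ (@qC1D R) (erefl _ : qC1 0 = 0)).
by rewrite -sumrB; apply: eq_bigr => k _; rewrite qC1M !mxE.
Qed.

Lemma qC2_mulmx A B : map_mx (@qC2 R) (A *m B) =
  map_mx (@qC1 R) A *m map_mx (@qC2 R) B
  + map_mx (@qC2 R) A *m conjm (map_mx (@qC1 R) B).
Proof.
apply/matrixP => i j; rewrite !mxE (big_morph _ (@qC2D R) (erefl _ : qC2 0 = 0)).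
by rewrite -big_split; apply: eq_bigr => k _; rewrite qC2M !mxE.
Qed.

Lemma conjmK p q (M : 'M[R[i]]_(p, q)) : conjm (conjm M) = M.
Proof. by apply/matrixP => i j; rewrite !mxE conjcK. Qed.

Lemma PhiM : {morph Phi : A B / (A *m B)%R >-> (A *m B)%R}.
Proof.
move=> A B; rewrite /Phi mulmx_block qC1_mulmx qC2_mulmx.
rewrite !(map_mxD, map_mxN, map_mxM, conjmK) /=.
congr block_mx; rewrite ?(mulmxN, mulNmx) ?opprD ?opprK // addrC //.
Qed.

Lemma Phi1 : Phi 1%:M = 1%:M.
Proof.
have E1 : map_mx (@qC1 R) (1%:M : 'M[quat R]_m) = 1%:M.
  by apply/matrixP => i j; rewrite !mxE; case: (i == j).
have E2 : map_mx (@qC2 R) (1%:M : 'M[quat R]_m) = 0.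
  by apply/matrixP => i j; rewrite !mxE; case: (i == j).
by rewrite /Phi E1 E2 map_mx0 map_mx1 oppr0 -scalar_mx_block.
Qed.

Lemma PhiN A : Phi (- A) = - Phi A.
Proof.
have E1 : map_mx (@qC1 R) (- A) = - map_mx (@qC1 R) A.
  by apply/matrixP => i j; rewrite !mxE.
have E2 : map_mx (@qC2 R) (- A) = - map_mx (@qC2 R) A.
  by apply/matrixP => i j; rewrite !mxE.
by rewrite /Phi E1 E2 !map_mxN opp_block_mx.
Qed.

Let J : 'M[R[i]]_(m + m) := block_mx 0 1%:M (- 1%:M) 0.

Let PhiJ A : J *m conjm (Phi A) = Phi A *m J.
Proof.
rewrite /Phi /J map_block_mx !mulmx_block map_mxN !conjmK.
rewrite !(mulmxN, mulNmx, mulmx1, mul1mx, mulmx0, mul0mx, addr0, add0r, opprK).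
by rewrite !oppr0 addr0 add0r.
Qed.

Let PhiInvK M : J *m conjm M = M *m J -> Phi (PhiInv M) = M.
Proof.
rewrite -[M]submxK; set a := ulsubmx M; set b := ursubmx M.
set c := dlsubmx M; set d := drsubmx M.
rewrite /J map_block_mx !mulmx_block.
rewrite !(mulmxN, mulNmx, mulmx1, mul1mx, mulmx0, mul0mx, addr0, add0r).
case/eq_block_mx => cb da _ _.
have E1 : map_mx (@qC1 R) (PhiInv (block_mx a b c d)) = a.
  apply/matrixP => i j; rewrite 2!mxE block_mxKul block_mxKur.
  by case: (quat_of_CK (a i j) (b i j)).
have E2 : map_mx (@qC2 R) (PhiInv (block_mx a b c d)) = b.
  apply/matrixP => i j; rewrite 2!mxE block_mxKul block_mxKur.
  by case: (quat_of_CK (a i j) (b i j)).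
rewrite /Phi E1 E2; congr block_mx; last by rewrite -da conjmK.
by rewrite -[b]opprK -cb map_mxN opprK conjmK.
Qed.

Lemma Phi_invmxH A : detH A != 0 -> Phi (invmxH A) = invmx (Phi A).
Proof.
rewrite /detH -unitfE -unitmxE => uA; apply: PhiInvK.
have cu : conjm (Phi A) \in unitmx by rewrite map_unitmx.
rewrite map_invmx; apply: (can_inj (mulmxK cu)); rewrite mulmxKV//.
by rewrite -mulmxA PhiJ mulmxA mulVmx// mul1mx.
Qed.

Lemma mulVmxH A : detH A != 0 -> invmxH A *m A = 1%:M.
Proof.
move=> dA; apply: (can_inj PhiK).
by rewrite PhiM Phi1 Phi_invmxH// mulVmx// unitmxE unitfE.
Qed.

Lemma mulmxVH A : detH A != 0 -> A *m invmxH A = 1%:M.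
Proof.
move=> dA; apply: (can_inj PhiK).
by rewrite PhiM Phi1 Phi_invmxH// mulmxV// unitmxE unitfE.
Qed.

Lemma detHM A B : detH (A *m B) = detH A * detH B.
Proof. by rewrite /detH PhiM det_mulmx. Qed.

Lemma detH1 : detH 1%:M = 1.
Proof. by rewrite /detH Phi1 det1. Qed.

Lemma detHV A : detH A != 0 -> detH (invmxH A) = (detH A)^-1.
Proof. by move=> dA; rewrite /detH Phi_invmxH// det_inv. Qed.

End Phi.

Section SpecialLinearGroups.
Variables (R : realType) (n : nat).

Record SL := MkSL { SL_mx :> 'M[quat R]_n.+1; _ : detH SL_mx == 1 }.
HB.instance Definition _ := [isSub for SL_mx].
HB.instance Definition _ := [Choice of SL by <:].
Implicit Types A B : SL.

Lemma SL_det A : detH (val A) = 1. Proof. exact/eqP/(valP A). Qed.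
Lemma SL_det_neq0 A : detH (val A) != 0.
Proof. by rewrite SL_det oner_neq0. Qed.

Fact SL_one_subproof : detH (1%:M : 'M[quat R]_n.+1) == 1.
Proof. by rewrite detH1. Qed.
Fact SL_mul_subproof A B : detH (val A *m val B) == 1.
Proof. by rewrite detHM !SL_det mulr1. Qed.
Fact SL_inv_subproof A : detH (invmxH (val A)) == 1.
Proof. by rewrite detHV ?SL_det_neq0// SL_det invr1. Qed.
Fact SL_opp_subproof A : detH (- val A) == 1.
Proof.
have -> : - val A = - 1%:M *m val A by rewrite mulNmx mul1mx.
rewrite detHM SL_det mulr1 /detH PhiN Phi1 -scaleN1r detZ det1 mulr1.
by rewrite exprD -exprMn mulrNN mulr1 expr1n.
Qed.

Definition SL_one : SL := MkSL SL_one_subproof.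
Definition SL_mul A B : SL := MkSL (SL_mul_subproof A B).
Definition SL_inv A : SL := MkSL (SL_inv_subproof A).
Definition SL_opp A : SL := MkSL (SL_opp_subproof A).

Fact SL_mulA : associative SL_mul.
Proof. by move=> A B C; apply/val_inj; rewrite /= mulmxA. Qed.
Fact SL_mul1 : left_id SL_one SL_mul.
Proof. by move=> A; apply/val_inj; rewrite /= mul1mx. Qed.
Fact SL_mulr1 : right_id SL_one SL_mul.
Proof. by move=> A; apply/val_inj; rewrite /= mulmx1. Qed.
Fact SL_mulV : left_inverse SL_one SL_inv SL_mul.
Proof. by move=> A; apply/val_inj; rewrite /= mulVmxH ?SL_det_neq0. Qed.
Fact SL_mulrV : right_inverse SL_one SL_inv SL_mul.
Proof. by move=> A; apply/val_inj; rewrite /= mulmxVH ?SL_det_neq0. Qed.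

HB.instance Definition _ :=
  isGroup.Build SL SL_mulA SL_mul1 SL_mulr1 SL_mulV SL_mulrV.

Definition pm_rel : rel SL := fun A B => (A == B) || (A == SL_opp B).

Lemma SL_oppK : involutive SL_opp.
Proof. by move=> A; apply/val_inj; rewrite /= opprK. Qed.

Fact pm_refl : reflexive pm_rel.
Proof. by move=> A; rewrite /pm_rel eqxx. Qed.
Fact pm_sym : symmetric pm_rel.
Proof.
move=> A B; rewrite /pm_rel [B == A]eq_sym; congr (_ || _).
by apply/eqP/eqP => ->; rewrite SL_oppK.
Qed.
Fact pm_trans : transitive pm_rel.
Proof.
move=> B A C /orP[/eqP->//|/eqP->] /orP[/eqP->|/eqP->]; rewrite /pm_rel.
  by rewrite eqxx orbT.
by rewrite SL_oppK eqxx.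
Qed.
Canonical pm_equiv := EquivRel pm_rel pm_refl pm_sym pm_trans.

Definition PSL := {eq_quot pm_rel}.
HB.instance Definition _ := Choice.on PSL.
HB.instance Definition _ := EqQuotient.on PSL.

Lemma PSL_piP A B : \pi_PSL A = \pi_PSL B <-> A = B \/ A = SL_opp B.
Proof.
split => [/(@eqmodP _ pm_equiv)/orP[]/eqP|AB]; [by left|by right|].
by apply/(@eqmodP _ pm_equiv)/orP; case: AB => ->; rewrite eqxx; [left|right].
Qed.

Lemma PSL_repr A : repr (\pi_PSL A) = A \/ repr (\pi_PSL A) = SL_opp A.
Proof. by apply/PSL_piP; rewrite reprK. Qed.

Definition PSL_one : PSL := \pi_PSL SL_one.
Definition PSL_mul (g h : PSL) : PSL := \pi_PSL (SL_mul (repr g) (repr h)).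
Definition PSL_inv (g : PSL) : PSL := \pi_PSL (SL_inv (repr g)).

Lemma PSL_mul_pi A B : PSL_mul (\pi_PSL A) (\pi_PSL B) = \pi_PSL (SL_mul A B).
Proof.
apply/PSL_piP; case: (PSL_repr A) => ->; case: (PSL_repr B) => ->;
  [left|right|right|left]; apply/val_inj; rewrite /= ?mulmxN ?mulNmx ?opprK//.
Qed.

Lemma PSL_inv_pi A : PSL_inv (\pi_PSL A) = \pi_PSL (SL_inv A).
Proof.
apply/PSL_piP; case: (PSL_repr A) => ->; [by left|right].
have E B : SL_mul (SL_opp A) B = SL_one -> B = SL_inv (SL_opp A).
  by move=> AB; rewrite -[LHS]SL_mul1 -(SL_mulV (SL_opp A)) -SL_mulA AB SL_mulr1.
symmetry; apply: E; apply/val_inj => /=.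
by rewrite mulmxN mulNmx opprK mulmxVH ?SL_det_neq0.
Qed.

Fact PSL_mulA : associative PSL_mul.
Proof.
elim/quotW=> A; elim/quotW=> B; elim/quotW=> C.
by rewrite (PSL_mul_pi B C) (PSL_mul_pi A B) !PSL_mul_pi SL_mulA.
Qed.
Fact PSL_mul1 : left_id PSL_one PSL_mul.
Proof. by elim/quotW=> A; rewrite PSL_mul_pi SL_mul1. Qed.
Fact PSL_mulr1 : right_id PSL_one PSL_mul.
Proof. by elim/quotW=> A; rewrite PSL_mul_pi SL_mulr1. Qed.
Fact PSL_mulV : left_inverse PSL_one PSL_inv PSL_mul.
Proof. by elim/quotW=> A; rewrite PSL_inv_pi PSL_mul_pi SL_mulV. Qed.
Fact PSL_mulrV : right_inverse PSL_one PSL_inv PSL_mul.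
Proof. by elim/quotW=> A; rewrite PSL_inv_pi PSL_mul_pi SL_mulrV. Qed.

HB.instance Definition _ :=
  isGroup.Build PSL PSL_mulA PSL_mul1 PSL_mulr1 PSL_mulV PSL_mulrV.

End SpecialLinearGroups.

Section ProjectiveSpace.
Variables (R : realType) (n : nat).

Definition rscale m (v : 'cV[quat R]_m) (a : quat R) : 'cV[quat R]_m :=
  v *m (a%:M : 'M[quat R]_1).

Lemma rscaleE m (v : 'cV[quat R]_m) a i : rscale v a i 0 = v i 0 * a.
Proof. by rewrite /rscale !mxE big_ord1 !mxE eqxx mulr1n. Qed.

Lemma rscaleA m (v : 'cV[quat R]_m) a b : rscale (rscale v a) b = rscale v (a * b).
Proof. by rewrite /rscale -mulmxA scalar_mxM. Qed.

Lemma rscale1 m (v : 'cV[quat R]_m) : rscale v 1 = v.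
Proof. by rewrite /rscale mulmx1. Qed.

(* Nonzero vectors, with the topology induced by that of [quat R]^(n+1). *)
Definition nonzero_vectors := [set z : 'cV[quat R]_n.+1 | z != 0].
Definition nzvec := set_type nonzero_vectors.
HB.instance Definition _ := Topological.on nzvec.

Lemma nzvec_neq0 (z : nzvec) : val z != 0. Proof. exact: set_mem (valP z). Qed.

Definition line_rel : rel nzvec := fun z w =>
  `[< exists2 a : quat R, a != 0 & val z = rscale (val w) a >].

Fact line_refl : reflexive line_rel.
Proof. by move=> z; apply/asboolP; exists 1; rewrite ?oner_neq0// rscale1. Qed.

Fact line_sym : symmetric line_rel.
Proof.
suff S z w : line_rel z w -> line_rel w z by move=> z w; apply/idP/idP; apply: S.
move=> /asboolP[a a0 zw]; apply/asboolP; exists a^-1.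
  by rewrite -unitqE unitrV unitqE.
by rewrite zw rscaleA divrr ?unitqE// rscale1.
Qed.

Fact line_trans : transitive line_rel.
Proof.
move=> w z x /asboolP[a a0 zw] /asboolP[b b0 wx]; apply/asboolP; exists (b * a).
  by rewrite -unitqE unitrMl unitqE.
by rewrite zw wx rscaleA.
Qed.

Canonical line_equiv := EquivRel line_rel line_refl line_sym line_trans.

Definition projspace := quotient_topology {eq_quot line_rel}.
HB.instance Definition _ := Topological.on projspace.
HB.instance Definition _ := Quotient.on projspace.

Lemma proj_piP (z w : nzvec) : \pi_projspace z = \pi_projspace w <->
  exists2 a : quat R, a != 0 & val z = rscale (val w) a.
Proof.
by split => [/(@eqmodP _ line_equiv)/asboolP|H];
  last exact/(@eqmodP _ line_equiv)/asboolP.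
Qed.

Fact SL_act_subproof (A : SL R n) (z : nzvec) :
  val A *m val z \in nonzero_vectors.
Proof.
apply/mem_set/eqP => Az0; have /eqP[] := nzvec_neq0 z.
by rewrite -[LHS]mul1mx -(mulVmxH (SL_det_neq0 A)) -mulmxA Az0 mulmx0.
Qed.

Definition SL_act (A : SL R n) (z : nzvec) : nzvec :=
  exist (fun z => z \in nonzero_vectors) _ (SL_act_subproof A z).

Definition PSL_act (g : PSL R n) (x : projspace) : projspace :=
  \pi_projspace (SL_act (repr g) (repr x)).

Lemma PSL_act_pi (A : SL R n) (z : nzvec) :
  PSL_act (\pi_(PSL R n) A) (\pi_projspace z) = \pi_projspace (SL_act A z).
Proof.
have [a a0 az] : exists2 a : quat R, a != 0 &
    val (repr (\pi_projspace z)) = rscale (val z) a.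
  by apply/proj_piP; rewrite reprK.
apply/proj_piP; case: (PSL_repr A) => /= ->; [exists a|exists (- a)] => //=.
- by rewrite az /rscale mulmxA.
- by rewrite oppr_eq0.
- by rewrite az /rscale raddfN mulmxN mulmxA !mulNmx.
Qed.

Definition right_subspace (V : set 'cV[quat R]_n.+1) : Prop :=
  [/\ V 0, forall u v, V u -> V v -> V (u + v)
    & forall v a, V v -> V (rscale v a)].

(* The columns of B form a basis of V; B *m c is the right-linear combination
   of these columns with coefficients c. *)
Definition right_basis k (B : 'M[quat R]_(n.+1, k)) (V : set 'cV[quat R]_n.+1) :=
  (forall c : 'cV_k, B *m c = 0 -> c = 0) /\
  (forall v, V v <-> exists c : 'cV_k, v = B *m c).

Definition proj_subspace_dim (k : nat) (W : set projspace) : Prop :=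
  exists V : set 'cV[quat R]_n.+1,
    [/\ right_subspace V,
        exists B : 'M[quat R]_(n.+1, k.+1), right_basis B V
      & W = [set \pi_projspace z | z in [set z : nzvec | V (val z)]]].

Definition proj_subspace (W : set projspace) : Prop :=
  exists k, proj_subspace_dim k W.

Definition proper_proj_subspace (W : set projspace) : Prop :=
  proj_subspace W /\ W <> setT.

(* Two subspaces one of which contains the other are not counted as two: every
   projective subspace of positive dimension is the union of itself and any one
   of its points. *)
Definition union_of_two_proper_subspaces (S : set projspace) : Prop :=
  exists L1 L2 : set projspace,
    [/\ proper_proj_subspace L1, proper_proj_subspace L2,
        L1 <> L2, ~ (L1 `<=` L2) /\ ~ (L2 `<=` L1) & S = L1 `|` L2].

End ProjectiveSpace.

Section Classification.
Variables (R : realType) (n : nat).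
Implicit Types (g : PSL R n) (A : SL R n) (l m : quat R).

Definition right_eigenvalue (A : 'M[quat R]_n.+1) l : Prop :=
  exists2 v : 'cV[quat R]_n.+1, v != 0 & A *m v = rscale v l.

Definition similar_quat l m : Prop :=
  exists2 u : quat R, u != 0 & m = u^-1 * l * u.

Definition is_lift A g : Prop := \pi_(PSL R n) A = g.

(* The two lifts of g have opposite eigenvalues, hence the same moduli. *)
Definition PSL_eigenvalue g l : Prop :=
  exists2 A, is_lift A g & right_eigenvalue (val A) l.

Definition semisimple g : Prop :=
  exists2 A, is_lift A g &
    exists P D : 'M[quat R]_n.+1,
      [/\ detH P != 0, is_diag_mx D & val A = P *m D *m invmxH P].

Definition unit_eigenclasses g : Prop :=
  forall l, PSL_eigenvalue g l -> exists2 m, similar_quat l m & qmod m = 1.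

Definition elliptic g : Prop := semisimple g /\ unit_eigenclasses g.

Definition parabolic g : Prop :=
  ~ semisimple g /\ (forall l, PSL_eigenvalue g l -> qmod l = 1).

Definition loxodromic g : Prop := semisimple g /\ ~ unit_eigenclasses g.

Definition loxoparabolic g : Prop :=
  ~ semisimple g /\ (exists2 l, PSL_eigenvalue g l & qmod l <> 1).

End Classification.

Section Equicontinuity.
Variables (R : realType) (n : nat).
Local Notation PP := (projspace R n).

(* PP is compact Hausdorff, so the neighbourhoods of the diagonal form its
   unique compatible uniform structure. *)
Definition cvg_unif_on (X : topologicalType) (K : set X)
    (f : nat -> X -> PP) (h : X -> PP) : Prop :=
  forall W : set (PP * PP), open W -> (forall p, W (p, p)) ->
    \forall k \near \oo, forall x, K x -> W (f k x, h x).

Definition normal_family (X : topologicalType) (F : set (X -> PP)) : Prop :=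
  forall f : nat -> X -> PP, (forall k, F (f k)) ->
    exists (s : nat -> nat) (h : X -> PP),
      {homo s : i j / (i < j)%N} /\
      (forall K : set X, compact K -> cvg_unif_on K (f \o s) h).

Definition equicontinuity_set (G : set (PSL R n)) : set PP :=
  [set z | exists U : set PP, [/\ open U, U z &
     @normal_family (set_type U) [set PSL_act g \o set_val | g in G]]].

Definition cyclic_subgroup (g : PSL R n) : set (PSL R n) :=
  [set h | exists m : nat, h = (g ^+ m)%g \/ h = (g ^- m)%g].

End Equicontinuity.

(* Main.v *)
(* Let A be a lift of gamma.  Let r be the largest modulus of an eigenvalue of
   Phi A, and d + 1 the largest size of a Jordan block for the eigenvalues of
   modulus r.  The matrices A^m / (C(m, d) r^m) stay bounded as m tends to
   infinity, and all their limit points T have the same kernel K+: decompose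
   along the generalized eigenspaces, on which A^m has a binomial expansion.
   Let K- be the analogous subspace for A^-1.

   If t_k A_k tends to T <> 0 for some real scalars t_k, then A_k converges
   uniformly on the compact subsets of the complement of P(ker T), but on no
   neighbourhood of a point of P(ker T).  Hence the complement of Eq is the
   union of P(K+) and P(K-).

   If all eigenvalues have modulus 1, then K+ = K-, and this subspace is zero
   iff d = 0 iff A is diagonalizable.  Otherwise det A = 1 forces two different
   moduli; the generalized eigenspaces of largest modulus lie in K-, those of
   smallest modulus in K+, and neither of K+ and K- contains the other.  The three
   shapes of the complement (empty, a subspace, the union of two incomparable
   proper subspaces) exclude each other. *)

From HB Require Import structures.
Require Import Defs.
From mathcomp Require Import all_boot all_order all_algebra.
From mathcomp Require Import generic_quotient complex ring lra.
From mathcomp Require Import all_classical all_reals all_analysis.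

Set Implicit Arguments.
Unset Strict Implicit.
Unset Printing Implicit Defensive.

Import Order.TTheory GRing.Theory Num.Theory.
Import numFieldNormedType.Exports.

Local Open Scope classical_set_scope.
Local Open Scope ring_scope.
Local Open Scope complex_scope.
Local Open Scope quotient_scope.

(** * Linear algebra over the quaternions *)

Section QuaternionicLinearAlgebra.
Variable R : realType.
Local Notation C := R[i].
Local Notation H := (quat R).
Local Notation conjm := (map_mx (@conjc R)).

(** Determinants and characteristic polynomials need commutative coefficients, so the spectral
    theory is carried out on [Phi A], and [q2c] transports vectors. Complex eigenvectors return as
    right eigenvectors, but those of the complex space of dimension 2(n+1) are dependent over the
    quaternions; bases are therefore extracted as maximal right-free families. No Jordan form is
    constructed: projectors obtained from Bezout identities are enough, and [A] and its inverse
    share them. The normalized powers need not converge. On an eigenspace of modulus r the leading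
    scalar keeps the modulus r^-d while its argument may rotate for ever. Since the projectors
    separate the eigenvalues, rotation cannot change which vectors a limit point kills; only this
    kernel is ever computed, never the limit itself. At a point of the kernel, normality would allow
    an arbitrary limit map, not even a continuous one. The contradiction must hence come from
    comparing the maps of the sequence with one another on a small compact disc, through a real
    function on projective space that tests whether a coordinate vanishes. *)

Definition quatC (c : C) : H := quat_of_C c 0.

Lemma qC1_mulmxE m p k (A : 'M[H]_(m, p)) (B : 'M[H]_(p, k)) :
  map_mx (@qC1 R) (A *m B) = map_mx (@qC1 R) A *m map_mx (@qC1 R) B
    - map_mx (@qC2 R) A *m conjm (map_mx (@qC2 R) B).
Proof.
apply/matrixP => i j; rewrite !mxE (big_morph _ (@qC1D R) (erefl _ : qC1 0 = 0)).
by rewrite -sumrB; apply: eq_bigr => l _; rewrite qC1M !mxE.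
Qed.

Lemma qC2_mulmxE m p k (A : 'M[H]_(m, p)) (B : 'M[H]_(p, k)) :
  map_mx (@qC2 R) (A *m B) = map_mx (@qC1 R) A *m map_mx (@qC2 R) B
    + map_mx (@qC2 R) A *m conjm (map_mx (@qC1 R) B).
Proof.
apply/matrixP => i j; rewrite !mxE (big_morph _ (@qC2D R) (erefl _ : qC2 0 = 0)).
by rewrite -big_split; apply: eq_bigr => l _; rewrite qC2M !mxE.
Qed.

Lemma conjc_negK (c : C) : - conjc (- conjc c) = c.
Proof. by case: c => a b; apply/eqP; rewrite eq_complex /= !opprK !eqxx. Qed.

Section ComplexCoordinates.
Variable N : nat.

(* The first column of the 2N x 2 matrix that [Phi] would associate with [x]. *)
Definition q2c (x : 'cV[H]_N) : 'cV[C]_(N + N) :=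
  col_mx (map_mx (@qC1 R) x) (- conjm (map_mx (@qC2 R) x)).

Definition c2q (w : 'cV[C]_(N + N)) : 'cV[H]_N :=
  \col_i quat_of_C (usubmx w i 0) (- conjc (dsubmx w i 0)).

Lemma q2cK : cancel q2c c2q.
Proof.
move=> x; apply/matrixP => i j; rewrite ord1 mxE col_mxKu col_mxKd !mxE.
by rewrite conjc_negK qC12K.
Qed.

Lemma c2qK : cancel c2q q2c.
Proof.
move=> w; rewrite -[RHS]vsubmxK /q2c; congr col_mx;
  apply/matrixP => i j; rewrite ord1 [in LHS]mxE.
  by rewrite mxE (proj1 (quat_of_CK _ _)).
by rewrite !mxE (proj2 (quat_of_CK _ _)) conjc_negK.
Qed.

Lemma q2c_mul (A : 'M[H]_N) x : q2c (A *m x) = Phi A *m q2c x.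
Proof.
rewrite /q2c /Phi mul_block_col qC1_mulmxE qC2_mulmxE.
rewrite !(map_mxD, map_mxN, map_mxM, conjmK) /=; congr col_mx.
  by rewrite mulmxN.
by rewrite mulNmx mulmxN opprD addrC.
Qed.

Lemma q2c0 : q2c 0 = 0.
Proof. by apply: (can_inj c2qK); rewrite q2cK; apply/matrixP => i j; rewrite !mxE
  raddf0 oppr0; apply: quatP. Qed.

Lemma q2cD : {morph q2c : x y / x + y}.
Proof.
move=> x y; rewrite /q2c.
have E1 : map_mx (@qC1 R) (x + y) = map_mx (@qC1 R) x + map_mx (@qC1 R) y.
  by apply/matrixP => i j; rewrite !mxE.
have E2 : map_mx (@qC2 R) (x + y) = map_mx (@qC2 R) x + map_mx (@qC2 R) y.
  by apply/matrixP => i j; rewrite !mxE.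
by rewrite E1 E2 map_mxD opprD add_col_mx.
Qed.

(** Right multiplication by a complex number commutes with taking the first column of the 2N x 2
    matrix of [x]; this is why complex eigenvectors of [Phi A] correspond to right eigenvectors of
    [A]. *)
Lemma q2c_scale x c : q2c (rscale x (quatC c)) = c *: q2c x.
Proof.
rewrite /q2c scale_col_mx; congr col_mx; apply/matrixP => i j;
  rewrite ord1 !mxE big_ord1 !mxE eqxx mulr1n.
  rewrite qC1M /quatC; case: (quat_of_CK c 0) => -> ->.
  by rewrite raddf0 mulr0 subr0 mulrC.
rewrite qC2M /quatC; case: (quat_of_CK c 0) => -> ->.
by rewrite mulr0 add0r rmorphM /= conjcK mulrC mulrN.
Qed.

Lemma c2q0 : c2q 0 = 0. Proof. by rewrite -q2c0 q2cK. Qed.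

Lemma q2c_eq0 x : (q2c x == 0) = (x == 0).
Proof. by rewrite -q2c0 (can_eq q2cK). Qed.

Lemma c2q_eq0 w : (c2q w == 0) = (w == 0).
Proof. by rewrite -c2q0 (can_eq c2qK). Qed.

Lemma c2qD : {morph c2q : x y / x + y}.
Proof. by move=> x y; apply: (can_inj q2cK); rewrite q2cD !c2qK. Qed.

Lemma c2q_scale w c : c2q (c *: w) = rscale (c2q w) (quatC c).
Proof. by apply: (can_inj q2cK); rewrite q2c_scale !c2qK. Qed.

Lemma c2q_mul (A : 'M[H]_N) w : c2q (Phi A *m w) = A *m c2q w.
Proof. by apply: (can_inj q2cK); rewrite q2c_mul !c2qK. Qed.

End ComplexCoordinates.

Definition right_free N k (B : 'M[H]_(N, k)) := forall c : 'cV[H]_k, B *m c = 0 -> c = 0.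

(** A complex kernel vector of [Phi A] pulls back under [c2q] to a quaternionic kernel vector of
    [A]. The transpose is there because [det0P] yields a row vector. *)
Lemma right_free_detH N (A : 'M[H]_N) : right_free A -> detH A != 0.
Proof.
move=> freeA; rewrite /detH -det_tr; apply/negP => /det0P[v v0 /(congr1 trmx)].
rewrite trmx_mul trmxK trmx0 => Av0; case/negP: v0.
have /freeA : A *m c2q v^T = 0 by rewrite -c2q_mul Av0 c2q0.
by move/eqP; rewrite c2q_eq0 -trmx0 => /eqP/trmx_inj ->.
Qed.

Lemma right_free_leq N k (B : 'M[H]_(N, k)) : right_free B -> (k <= N)%N.
Proof.
move=> freeB; rewrite leqNgt; apply/negP => ltNk.
(* [B] padded with zero rows to a square matrix. It stays injective, hence invertible, although its
   row of index [N] vanishes. *)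
pose A : 'M[H]_k := \matrix_(i, j)
  if insub (i : nat) : option 'I_N is Some i' then B i' j else 0.
have /mulmxVH AV : detH A != 0.
  apply: right_free_detH => c Ac; apply: freeB; apply/matrixP => i j.
  have <- : (A *m c) (widen_ord (ltnW ltNk) i) j = (B *m c) i j.
    rewrite !mxE; apply: eq_bigr => l _; rewrite !mxE insubT //= => p.
    by congr (B _ _ * _); apply: val_inj.
  by rewrite Ac !mxE.
pose l := Ordinal ltNk.
have /matrixP/(_ l l)/eqP := AV; rewrite !mxE big1 ?eqxx => [|i _].
  by rewrite eq_sym oner_eq0.
by rewrite !mxE insubF ?mul0r //= ltnn.
Qed.

Lemma right_free_row_mx N k (B : 'M[H]_(N, k)) (v : 'cV[H]_N) : right_free B ->
  (forall c, v <> B *m c) -> right_free (row_mx B v).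
Proof.
move=> freeB vB c; rewrite -[c]vsubmxK mul_row_col.
set c1 := usubmx c; set c2 := dsubmx c => Bc.
have [c20|c20] := eqVneq (c2 0 0) 0.
  have c2E : c2 = 0 by apply/matrixP => i j; rewrite !ord1 c20 mxE.
  by move: Bc; rewrite c2E mulmx0 addr0 => /freeB ->; rewrite col_mx0.
have c2E : c2 = (c2 0 0)%:M by rewrite [LHS]mx11_scalar.
(* The relation [B *m c1 + v *m c2 = 0] is solved for [v] by dividing on the right by the nonzero
   scalar of [c2]. *)
case: (vB (- (c1 *m ((c2 0 0)^-1)%:M))); rewrite mulmxN mulmxA.
have -> : B *m c1 = - (v *m c2) by apply/eqP; rewrite -addr_eq0 Bc.
by rewrite mulNmx opprK -mulmxA {1}c2E -scalar_mxM divrr ?unitqE // mulmx1.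
Qed.

(** A longest free family with columns in [S] exists because lengths are bounded by [N], and an
    element of [S] outside its span would extend it. [S] is arbitrary so that it can be a subspace
    as well as a set of eigenvectors. *)
Lemma max_right_free N (S : set 'cV[H]_N) : exists k (B : 'M[H]_(N, k)),
  [/\ right_free B, forall j, S (col j B) & forall v, S v -> exists c, v = B *m c].
Proof.
pose P k := `[< exists B : 'M[H]_(N, k), right_free B /\ forall j, S (col j B) >].
have P0 : exists k, P k.
  exists 0%N; apply/asboolP; exists 0; split=> [c _|[]//].
  by rewrite [c]flatmx0.
have PN k : P k -> (k <= N)%N.
  by move=> /asboolP[B [/right_free_leq]].
case: (ex_maxnP P0 PN) => k /asboolP[B [freeB SB]] maxk.
exists k, B; split=> // v Sv; apply: contrapT => nBv.
suff /maxk : P (k + 1)%N by rewrite addn1 ltnn.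
apply/asboolP; exists (row_mx B v); split.
  by apply: right_free_row_mx => // c vB; apply: nBv; exists c.
move=> j; have -> : col j (row_mx B v) =
    if fintype.split j is inl j' then col j' B else v.
  apply/matrixP => i l; rewrite !mxE; case: (fintype.split j) => j'; rewrite ?mxE //.
  by rewrite !ord1.
by case: (fintype.split j).
Qed.

Lemma right_subspace_basis n (V : set 'cV[H]_n.+1) : right_subspace V ->
  exists k (B : 'M[H]_(n.+1, k)), right_basis B V.
Proof.
case=> V0 VD VZ; have [k [B [freeB VB spanB]]] := max_right_free V.
exists k, B; split=> // v; split=> [/spanB//|[c ->]].
have -> : B *m c = \sum_j rscale (col j B) (c j 0).
  apply/matrixP => i l; rewrite ord1 !mxE summxE; apply: eq_bigr => j _.
  by rewrite rscaleE mxE.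
by elim/big_ind: _ => // j _; apply: VZ.
Qed.

(** The eigenvectors at hand come from a complex decomposition and satisfy quaternionic relations. A
    maximal right-free family of them still spans, and it serves as the columns of [P]. *)
Lemma eigenvectors_diagonalize N (A : 'M[H]_N) :
  (forall v, exists s : seq 'cV[H]_N, v = \sum_(x <- s) x /\
     forall x, x \in s -> exists l, A *m x = rscale x l) ->
  exists P D : 'M[H]_N, [/\ detH P != 0, is_diag_mx D & A = P *m D *m invmxH P].
Proof.
move=> spanA.
have [k [B [freeB SB spanB]]] :=
  max_right_free [set x | exists l, A *m x = rscale x l].
have spanB' (v : 'cV[H]_N) : exists c, v = B *m c.
  have [s [-> sA]] := spanA v; elim: s sA => [_|x s IH sA].
    by exists 0; rewrite big_nil mulmx0.
  have [|c cE] := IH; first by move=> y ys; apply: sA; rewrite inE ys orbT.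
  have [|c' c'E] := spanB x; first by apply: sA; rewrite inE eqxx.
  by exists (c' + c); rewrite big_cons cE c'E mulmxDr.
have [X BX] : exists X : 'M[H]_(k, N), B *m X = 1%:M.
  have /choice[f fE] := fun j : 'I_N => spanB' (col j 1%:M).
  exists (\matrix_(i, j) f j i 0); apply/matrixP => i j.
  have /matrixP/(_ i 0) := fE j; rewrite [LHS]mxE => ->.
  by rewrite !mxE; apply: eq_bigr => l _; rewrite mxE.
(* The right inverse [X] of [B] is itself right-free, which bounds [N] by [k]. *)
have kN : k = N.
  apply/eqP; rewrite eqn_leq (right_free_leq freeB) /=.
  apply: (@right_free_leq _ _ X) => c Xc.
  by rewrite -[c]mul1mx -BX -mulmxA Xc mulmx0.
subst k; have dB := right_free_detH freeB; have /choice[l lE] := SB.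
pose D : 'M[H]_N := \matrix_(i, j) if i == j then l j else 0.
exists B, D; split=> //.
  by apply/is_diag_mxP => i j; rewrite mxE -val_eqE => /negPf ->.
suff <- : A *m B = B *m D by rewrite -mulmxA mulmxVH // mulmx1.
apply/matrixP => i j; have /matrixP/(_ i 0) := lE j.
rewrite rscaleE !mxE => lij.
transitivity (B i j * l j); first by rewrite -lij; apply: eq_bigr => m _; rewrite mxE.
rewrite (bigD1 j) //= big1 => [|m mj]; first by rewrite addr0 mxE eqxx.
by rewrite mxE (negPf mj) mulr0.
Qed.

End QuaternionicLinearAlgebra.

(** * Matrix norms and limits *)

Section MatrixNorm.
Variable R : realType.

Definition ring_norm (S : nzRingType) (N : S -> R) : Prop :=
  [/\ forall x, 0 <= N x, forall x, N x = 0 <-> x = 0, forall x, N (- x) = N x,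
      forall x y, N (x + y) <= N x + N y & forall x y, N (x * y) <= N x * N y].

(** The entrywise l1 norm inherits submultiplicativity from [N]; with [N] abstract, one theory
    serves both complex and quaternionic matrices. *)
Definition mxn (S : nzRingType) (N : S -> R) m n (A : 'M[S]_(m, n)) : R :=
  \sum_i \sum_j N (A i j).

Section Theory.
Context {S : nzRingType} {N : S -> R} (nN : ring_norm N).

Lemma mxn_ge0 m n (A : 'M[S]_(m, n)) : 0 <= mxn N A.
Proof. by case: nN => N0 _ _ _ _; do 2!(apply: sumr_ge0 => ? _). Qed.

Lemma le_mxn m n (A : 'M[S]_(m, n)) i j : N (A i j) <= mxn N A.
Proof.
case: nN => N0 _ _ _ _; rewrite /mxn (bigD1 i) //= (bigD1 j) //= -addrA lerDl.
by rewrite addr_ge0 ?sumr_ge0 // => k _; rewrite sumr_ge0.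
Qed.

Lemma mxn_eq0 m n (A : 'M[S]_(m, n)) : mxn N A = 0 <-> A = 0.
Proof.
case: nN => N0 N00 _ _ _; split=> [A0|->].
  apply/matrixP => i j; rewrite mxE; apply/N00/eqP.
  by rewrite eq_le N0 -A0 le_mxn.
by do 2!(rewrite /mxn big1 // => ? _); rewrite mxE; apply/N00.
Qed.

Lemma mxnN m n (A : 'M[S]_(m, n)) : mxn N (- A) = mxn N A.
Proof.
by case: nN => _ _ NN _ _; do 2!(apply: eq_bigr => ? _); rewrite mxE NN.
Qed.

Lemma mxnD m n (A B : 'M[S]_(m, n)) : mxn N (A + B) <= mxn N A + mxn N B.
Proof.
case: nN => _ _ _ ND _; rewrite /mxn -big_split; apply: ler_sum => i _.
by rewrite -big_split; apply: ler_sum => j _; rewrite mxE.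
Qed.

Lemma mxnB m n (A B : 'M[S]_(m, n)) : mxn N (A - B) <= mxn N A + mxn N B.
Proof. by rewrite -[in leRHS](mxnN B) mxnD. Qed.

Lemma mxn_sum m n (I : Type) (r : seq I) (F : I -> 'M[S]_(m, n)) :
  mxn N (\sum_(i <- r) F i) <= \sum_(i <- r) mxn N (F i).
Proof.
elim: r => [|i r IH]; first by rewrite !big_nil (proj2 (mxn_eq0 _)).
by rewrite !big_cons; apply: le_trans (mxnD _ _) _; rewrite lerD2l.
Qed.

Lemma mxnM m n p (A : 'M[S]_(m, n)) (B : 'M[S]_(n, p)) :
  mxn N (A *m B) <= mxn N A * mxn N B.
Proof.
case: nN => N0 N00 _ ND NM; rewrite /mxn mulr_suml; apply: ler_sum => i _.
rewrite mulr_suml.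
apply: (@le_trans _ _ (\sum_j \sum_k N (A i k) * N (B k j))).
  apply: ler_sum => j _; rewrite mxE.
  elim/big_ind2: _ => // [|x y z w xy zw]; first by rewrite (proj2 (N00 _)).
  by apply: le_trans (ND _ _) _; rewrite lerD.
rewrite exchange_big; apply: ler_sum => k _; rewrite -mulr_sumr.
apply: ler_wpM2l => //; rewrite [leRHS](bigD1 k) //= lerDl.
by apply: sumr_ge0 => l _; apply: sumr_ge0.
Qed.

(* [X] tends to [L] along [F]: the norm is real valued even when [S] is not a
   normed space over [R]. *)
Definition mx_lim I (F : set_system I) m n (X : I -> 'M[S]_(m, n)) L :=
  mxn N (X i - L) @[i --> F] --> (0 : R).

Lemma mx_lim0P I (F : set_system I) {FF : Filter F} m n (X : I -> 'M[S]_(m, n))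
  (u : I -> R) : (\forall i \near F, mxn N (X i) <= u i) -> u i @[i --> F] --> (0 : R) ->
  mx_lim F X 0.
Proof.
move=> Xu u0; apply: (@squeeze_cvgr _ _ _ _ (fun=> 0) u) => //; last exact: cvg_cst.
by near=> i; rewrite subr0 mxn_ge0 /=; near: i.
Unshelve. all: by end_near. Qed.

Lemma mx_lim_cst I (F : set_system I) {FF : Filter F} m n (L : 'M[S]_(m, n)) :
  mx_lim F (fun=> L) L.
Proof. by rewrite /mx_lim subrr (proj2 (mxn_eq0 _)) //; exact: cvg_cst. Qed.

Lemma mx_lim_lt I (F : set_system I) {FF : Filter F} m n (X : I -> 'M[S]_(m, n)) L :
  mx_lim F X L -> forall e, 0 < e -> \forall i \near F, mxn N (X i - L) < e.
Proof.
move=> XL e e0; near=> i; rewrite -[ltLHS]ger0_norm ?mxn_ge0 //; near: i.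
exact: (proj1 (cvgr0Pnorm_lt _) XL e e0).
Unshelve. all: by end_near. Qed.

Lemma mx_lim_comp I J (F : set_system I) (G : set_system J) (f : J -> I) m n
  (X : I -> 'M[S]_(m, n)) L : f @ G --> F -> mx_lim F X L -> mx_lim G (X \o f) L.
Proof. by move=> fF; apply: cvg_trans; exact: (cvg_app (fun i => mxn N (X i - L)) fF). Qed.

Lemma mx_limD I (F : set_system I) {FF : Filter F} m n (X Y : I -> 'M[S]_(m, n)) K L :
  mx_lim F X K -> mx_lim F Y L -> mx_lim F (fun i => X i + Y i) (K + L).
Proof.
move=> XK YL.
apply: (@squeeze_cvgr _ _ _ _ (fun=> 0) (fun i => mxn N (X i - K) + mxn N (Y i - L))).
- by near=> i; rewrite mxn_ge0 /= opprD addrACA mxnD.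
- exact: cvg_cst.
- by rewrite -[0](addr0 0); apply: cvgD.
Unshelve. all: by end_near. Qed.

Lemma mx_limM I (F : set_system I) {FF : Filter F} m n p
  (X : I -> 'M[S]_(m, n)) (Y : I -> 'M[S]_(n, p)) K L :
  mx_lim F X K -> mx_lim F Y L -> mx_lim F (fun i => X i *m Y i) (K *m L).
Proof.
move=> XK YL.
pose x i := mxn N (X i - K); pose y i := mxn N (Y i - L).
apply: (@squeeze_cvgr _ _ _ _ (fun=> 0)
  (fun i => x i * y i + x i * mxn N L + mxn N K * y i)).
- near=> i; rewrite mxn_ge0 /=.
  have -> : X i *m Y i - K *m L =
      (X i - K) *m (Y i - L) + (X i - K) *m L + K *m (Y i - L).
    by rewrite -mulmxDr subrK mulmxBl mulmxBr addrA subrK.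
  apply: le_trans (mxnD _ _) _; apply: lerD; last exact: mxnM.
  by apply: le_trans (mxnD _ _) _; apply: lerD; exact: mxnM.
- exact: cvg_cst.
- have -> : (0 : R) = 0 * 0 + 0 * mxn N L + mxn N K * 0 by rewrite !mul0r mulr0 !addr0.
  by apply: cvgD; [apply: cvgD|]; apply: cvgM => //; apply: cvg_cst.
Unshelve. all: by end_near. Qed.

Lemma mx_lim_unique I (F : set_system I) {FF : ProperFilter F} m n
  (X : I -> 'M[S]_(m, n)) K L : mx_lim F X K -> mx_lim F X L -> K = L.
Proof.
move=> XK XL; apply/eqP; rewrite -subr_eq0; apply/eqP/mxn_eq0.
have d0 : mxn N (X i - L) + mxn N (X i - K) @[i --> F] --> (0 : R).
  by rewrite -[0](addr0 0); apply: cvgD.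
apply/eqP; rewrite eq_le mxn_ge0 andbT; apply: (cvgr_to_ge d0).
near=> i; have -> : K - L = (X i - L) - (X i - K) by rewrite opprB [RHS]addrC addrA subrK.
exact: mxnB.
Unshelve. all: by end_near. Qed.

End Theory.

Arguments mx_lim {S} N {I} F {m n} X L.

Local Notation normc := ComplexField.Normc.normc.

Lemma normc_ring_norm : ring_norm (@normc R).
Proof.
split=> [|x|x|x y|x y]; rewrite ?normcN ?le_normcD ?ComplexField.Normc.normcM //.
  by case=> a b; exact: sqrtr_ge0.
by split=> [/ComplexField.Normc.eq0_normc//|->]; rewrite ComplexField.Normc.normc0.
Qed.

(** Preferred to [qmod] because the norms of [A] and [Phi A] then differ by the exact factor 2
    ([mxn_Phi]). *)
Definition qn (q : quat R) : R := normc (qC1 q) + normc (qC2 q).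

Lemma normc_conj (c : R[i]) : normc (conjc c) = normc c.
Proof. by case: c => a b /=; rewrite sqrrN. Qed.

Lemma qn_ring_norm : ring_norm qn.
Proof.
have [n0 n00 nN nD nM] := normc_ring_norm.
rewrite /qn; split=> [x|x|x|x y|x y]; first by rewrite addr_ge0.
- split=> [/eqP|->]; last by rewrite !(proj2 (n00 _)) ?addr0.
  rewrite paddr_eq0 // => /andP[/eqP/n00 + /eqP/n00].
  by case: x => a b c d [-> ->] [-> ->].
- have -> : qC1 (- x) = - qC1 x by [].
  by have -> : qC2 (- x) = - qC2 x by []; rewrite !nN.
- by rewrite qC1D qC2D addrACA; apply: lerD.
- rewrite qC1M qC2M mulrDl !mulrDr.
  apply: le_trans (lerD (nD _ _) (nD _ _)) _.
  rewrite nN !ComplexField.Normc.normcM !normc_conj.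
  by rewrite le_eqVlt; apply/orP; left; apply/eqP; ring.
Qed.

Lemma normc_le (a b : R) : normc (a +i* b) <= `|a| + `|b|.
Proof.
have -> : a +i* b = a +i* 0 + 0 +i* b.
  by apply/eqP; rewrite eq_complex /= addr0 add0r !eqxx.
by apply: le_trans (le_normcD _ _) _; rewrite /= expr0n /= addr0 add0r !sqrtr_sqr.
Qed.

Lemma le_normc (a b : R) : `|a| <= normc (a +i* b) /\ `|b| <= normc (a +i* b).
Proof.
by split; rewrite /= -sqrtr_sqr ler_wsqrtr // ?lerDl ?lerDr sqr_ge0.
Qed.

Lemma qn_le (q : quat R) : qn q <= `|qre q| + `|qi q| + (`|qj q| + `|qk q|).
Proof. by case: q => a b c d; apply: lerD; exact: normc_le. Qed.

Lemma le_qn (q : quat R) :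
  [/\ `|qre q| <= qn q, `|qi q| <= qn q, `|qj q| <= qn q & `|qk q| <= qn q].
Proof.
have [n0 _ _ _ _] := normc_ring_norm.
case: q => a b c d; have [? ?] := le_normc a b; have [? ?] := le_normc c d.
by rewrite /qn; split; solve [exact: ler_wpDr (n0 _) _|exact: ler_wpDl (n0 _) _].
Qed.

Lemma quat_cvgP I (F : set_system I) {FF : Filter F} (f : I -> quat R) (q : quat R) :
  qre (f i) @[i --> F] --> qre q -> qi (f i) @[i --> F] --> qi q ->
  qj (f i) @[i --> F] --> qj q -> qk (f i) @[i --> F] --> qk q -> f @ F --> q.
Proof.
move=> f1 f2 f3 f4 A [_ [[B oB <-] Bq sBA]].
have cf : (fun i => (qre (f i), qi (f i), qj (f i), qk (f i))) @ F -->
    (qre q, qi q, qj q, qk q).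
  exact: cvg_pair (cvg_pair (cvg_pair f1 f2) f3) f4.
have cfB : F [set i | B (quat_coords (f i))].
  exact: cf B (open_nbhs_nbhs (conj oB Bq)).
exact: (@filterS _ F FF _ _ (fun i => sBA (f i)) cfB).
Qed.

Lemma quat_coords_continuous : continuous (@quat_coords R).
Proof. exact: initial_continuous. Qed.

Lemma qre_continuous : continuous (@qre R).
Proof.
move=> q; apply: (@cvg_comp _ _ _ (@quat_coords R) (fun t => t.1.1.1)).
  exact: quat_coords_continuous.
by apply: cvg_comp; [apply: cvg_comp|]; exact: cvg_fst.
Qed.

Lemma qi_continuous : continuous (@qi R).
Proof.
move=> q; apply: (@cvg_comp _ _ _ (@quat_coords R) (fun t => t.1.1.2)).
  exact: quat_coords_continuous.
by apply: cvg_comp; [apply: cvg_comp; exact: cvg_fst|exact: cvg_snd].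
Qed.

Lemma qj_continuous : continuous (@qj R).
Proof.
move=> q; apply: (@cvg_comp _ _ _ (@quat_coords R) (fun t => t.1.2)).
  exact: quat_coords_continuous.
by apply: cvg_comp; [exact: cvg_fst|exact: cvg_snd].
Qed.

Lemma qk_continuous : continuous (@qk R).
Proof.
move=> q; apply: (@cvg_comp _ _ _ (@quat_coords R) (fun t => t.2)).
  exact: quat_coords_continuous.
exact: cvg_snd.
Qed.

Lemma qn_sub_cvg0 (q : quat R) : qn (p - q) @[p --> q] --> (0 : R).
Proof.
have qn0 p : 0 <= qn p by case: qn_ring_norm.
apply: (@squeeze_cvgr _ (nbhs q) (nbhs_filter q) _ (fun=> 0) (fun p =>
  `|qre p - qre q| + `|qi p - qi q| + (`|qj p - qj q| + `|qk p - qk q|))).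
- by near=> p; rewrite qn0 /=; exact: qn_le.
- exact: cvg_cst.
- have c0 (g : quat R -> R) : {for q, continuous g} -> `|g p - g q| @[p --> q] --> (0 : R).
    move=> cg; have : `|g p - g q| @[p --> q] --> `|g q - g q|.
      exact: (@cvg_norm _ _ _ (nbhs q) (nbhs_filter q) _ _
        (@cvgB _ _ _ (nbhs q) (nbhs_filter q) _ _ _ _ cg (cvg_cst _))).
    by rewrite subrr normr0.
  have -> : (0 : R) = 0 + 0 + (0 + 0) by rewrite !addr0.
  apply: cvgD; apply: cvgD; apply: c0; [exact: qre_continuous|exact: qi_continuous|
    exact: qj_continuous|exact: qk_continuous].
Unshelve. all: by end_near. Qed.

Lemma mx_lim_coord I (F : set_system I) {FF : Filter F} m n
    (X : I -> 'M[quat R]_(m, n)) L i j (g : quat R -> R) : mx_lim qn F X L ->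
  (forall q, `|g q| <= qn q) -> {morph g : p q / p - q} ->
  g (X x i j) @[x --> F] --> g (L i j).
Proof.
move=> XL gqn gB; apply/cvgrPdist_lt => e e0.
near=> x; rewrite distrC -gB; apply: le_lt_trans (gqn _) _.
apply: (@le_lt_trans _ _ (mxn qn (X x - L))); last first.
  by near: x; exact: (mx_lim_lt qn_ring_norm XL e0).
by apply: le_trans (le_mxn qn_ring_norm (X x - L) i j); rewrite !mxE; exact: lexx.
Unshelve. all: by end_near. Qed.

Lemma entrywise_cvg I (F : set_system I) {FF : Filter F} m n
  (X : I -> 'M[quat R]_(m, n)) (L : 'M[quat R]_(m, n)) :
  (forall i j, X x i j @[x --> F] --> L i j) -> X @ F --> L.
Proof.
move=> XL A [P LP sPA].
have FP : \forall x \near F, forall i j, P i j (X x i j).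
  apply: filter_forall => i; apply: filter_forall => j.
  have LPij : nbhs (L i j) (P i j) := LP i j.
  exact: (XL i j (P i j) LPij).
exact: (@filterS _ F FF _ _ (fun x => sPA (X x))).
Qed.

(** Together with [cvg_mx_lim] this identifies limits in norm with limits in the matrix topology,
    from which projective space gets its own. *)
Lemma mx_lim_cvg I (F : set_system I) {FF : Filter F} m n
  (X : I -> 'M[quat R]_(m, n)) L : mx_lim qn F X L -> X @ F --> L.
Proof.
move=> XL; apply: entrywise_cvg => i j.
apply: quat_cvgP; apply: mx_lim_coord XL _ _ => // q; by case: (le_qn q).
Qed.

Lemma sum_cvg0 I (F : set_system I) {FF : Filter F} (J : eqType) (r : seq J)
  (f : J -> I -> R) : (forall j, j \in r -> f j i @[i --> F] --> (0 : R)) ->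
  \sum_(j <- r) f j i @[i --> F] --> (0 : R).
Proof.
elim: r => [|j r IH] f0.
  by under eq_cvg do rewrite big_nil; exact: cvg_cst.
under eq_cvg do rewrite big_cons.
have IH' : \sum_(j <- r) f j i @[i --> F] --> (0 : R).
  by apply: IH => k kr; apply: f0; rewrite inE kr orbT.
by have := cvgD (f0 j (mem_head _ _)) IH'; rewrite addr0; apply.
Qed.

Lemma mx_lim_id m n (L : 'M[quat R]_(m, n)) : mx_lim qn (nbhs L) id L.
Proof.
have qn0 p : 0 <= qn p by case: qn_ring_norm.
rewrite /mx_lim /mxn.
apply: (@sum_cvg0 _ _ _ _ _ (fun i X => \sum_(j < n) qn ((id X - L) i j))) => i _.
apply: (@sum_cvg0 _ _ _ _ _ (fun j X => qn ((id X - L) i j))) => j _.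
have := @qn_sub_cvg0 (L i j).
have -> : (fun X : 'M[quat R]_(m, n) => qn ((X - L) i j)) =
   (fun p => qn (p - L i j)) \o (fun X : 'M[quat R]_(m, n) => X i j).
  by apply/funext => X; rewrite /= !mxE.
apply: cvg_comp => A LA.
exists (fun i' j' => if (i' == i) && (j' == j) then A else setT).
  by move=> i' j'; case: ifP => [/andP[/eqP-> /eqP->]//|_]; exact: filterT.
by move=> X /(_ i j); rewrite !eqxx.
Qed.

Lemma cvg_mx_lim I (F : set_system I) {FF : Filter F} m n
  (X : I -> 'M[quat R]_(m, n)) L : X @ F --> L -> mx_lim qn F X L.
Proof. by move=> XL; exact: (mx_lim_comp XL (@mx_lim_id _ _ L)). Qed.

Lemma homo_leq (f : nat -> nat) : {homo f : i j / (i < j)%N} -> forall k, (k <= f k)%N.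
Proof. by move=> fi; elim=> // k IH; apply: leq_ltn_trans IH (fi _ _ _). Qed.

Lemma homo_cvg_oo (f : nat -> nat) : {homo f : i j / (i < j)%N} -> f @ \oo --> \oo.
Proof.
move=> fi A [N _ NA]; exists N => // k Nk; apply: NA => /=.
exact: leq_trans Nk (homo_leq fi k).
Qed.

Lemma increasing_homo (f : nat -> nat) :
  increasing_seq f -> {homo f : i j / (i < j)%N}.
Proof. by move=> fi i j ij; rewrite ltnNge -leEnat fi -ltnNge. Qed.

Lemma bolzano_weierstrass_family (T : eqType) (s : seq T) (u : T -> nat -> R) :
  (forall t, exists M, forall k, `|u t k| <= M) ->
  exists2 f : nat -> nat, increasing_seq f & forall t, t \in s -> cvgn (u t \o f).
Proof.
move=> bu; elim: s => [|t s [f fi fs]]; first by exists id.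
have [|g gi gt] := @bolzano_weierstrass R (u t \o f).
  have [M uM] := bu t; exists M; split; first exact: num_real.
  by move=> x Mx k _; apply: le_trans (ltW Mx); exact: uM.
exists (f \o g) => [x y|t']; first by rewrite /= fi; exact: gi.
rewrite inE => /orP[/eqP->|/fs]; first exact: gt.
move=> /cvg_ex[l ul]; apply/cvg_ex; exists l.
by apply: (@cvg_comp _ _ _ g (u t' \o f)) ul; apply: homo_cvg_oo; exact: increasing_homo.
Qed.

Lemma mx_bolzano_weierstrass m n (X : nat -> 'M[quat R]_(m, n)) M :
  (\forall k \near \oo, mxn qn (X k) <= M) ->
  exists f L, {homo f : i j / (i < j)%N} /\ mx_lim qn \oo (X \o f) L.
Proof.
case=> k0 _ XM.
pose coord (b : bool * bool) : quat R -> R :=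
  match b with (false, false) => @qre R | (false, true) => @qi R
             | (true, false) => @qj R | (true, true) => @qk R end.
(* The bound on [X] holds only from [k0] on; the shift makes it hold at every index. *)
pose u (t : 'I_m * 'I_n * (bool * bool)) k := coord t.2 (X (k + k0)%N t.1.1 t.1.2).
have [t|f /increasing_homo fi cu] := bolzano_weierstrass_family (enum predT) (u := u).
  exists M => k; apply: le_trans (XM (k + k0)%N (leq_addl _ _)).
  apply: le_trans (le_mxn qn_ring_norm (X (k + k0)%N) t.1.1 t.1.2).
  by case: t => [[i j] [[] []]]; case: (le_qn (X (k + k0)%N i j)).
pose L : 'M[quat R]_(m, n) := \matrix_(i, j)
  Quat (limn (u (i, j, (false, false)) \o f)) (limn (u (i, j, (false, true)) \o f))
       (limn (u (i, j, (true, false)) \o f)) (limn (u (i, j, (true, true)) \o f)).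
exists (fun k => f k + k0)%N, L; split=> [i j ij|].
  by rewrite ltn_add2r fi.
apply: cvg_mx_lim; apply: entrywise_cvg => i j.
rewrite /L mxE; apply: quat_cvgP => /=.
- by have := cu (i, j, (false, false)); apply; rewrite mem_enum.
- by have := cu (i, j, (false, true)); apply; rewrite mem_enum.
- by have := cu (i, j, (true, false)); apply; rewrite mem_enum.
- by have := cu (i, j, (true, true)); apply; rewrite mem_enum.
Qed.

End MatrixNorm.

Arguments mx_lim {R S} N {I} F {m n} X L.
Arguments qn {R} q.

(** * Generalized eigenspaces *)

Section SpectralDecomposition.
Variable F : closedFieldType.
Variable N : nat.
Implicit Types (M X : 'M[F]_N.+1) (s : seq F) (E : F -> 'M[F]_N.+1) (lam : F -> F).

(* The [E l], for [l] in [s], are the projectors on the generalized eigenspaces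
   of [X], with eigenvalues [lam l].  Taking [lam] to be the identity or the
   inverse lets [X] and [X^-1] share their projectors. *)
Definition spectral X s lam E K : Prop :=
  [/\ uniq s, \sum_(l <- s) E l = 1, forall l, l \in s -> GRing.comm X (E l),
      forall l, l \in s -> (X - (lam l)%:M) ^+ K * E l = 0
    & forall l m, l \in s -> m \in s -> l != m -> E l * E m = 0].

Lemma horner_mx_XsubC_exp M (l : F) K :
  horner_mx M (('X - l%:P) ^+ K) = (M - l%:M) ^+ K.
Proof. by rewrite rmorphXn rmorphB /= horner_mx_X horner_mx_C. Qed.

Lemma coprimep_XsubC_exp (l m : F) K : l != m ->
  coprimep (('X - l%:P) ^+ K) (('X - m%:P) ^+ K).
Proof.
move=> lm; apply: coprimep_expl; apply: coprimep_expr.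
by rewrite coprimep_XsubC root_XsubC eq_sym.
Qed.

(** Peel off one factor [P] from the product of the others, [Q]: with [u P + v Q = 1], the part
    [v Q A] is killed by [P] and [u P A] by [Q]. The induction needs a general [A]; the
    decomposition of the identity is the case [A = 1]. *)
Lemma split_by_coprime_factors M K s (A : 'M[F]_N.+1) : uniq s -> GRing.comm M A ->
  horner_mx M (\prod_(l <- s) ('X - l%:P) ^+ K) * A = 0 ->
  exists E, [/\ forall l, l \in s -> GRing.comm M (E l),
    forall l, l \in s -> (M - l%:M) ^+ K * E l = 0 & \sum_(l <- s) E l = A].
Proof.
elim: s A => [|l s IH] A.
  rewrite big_nil rmorph1 mul1r => _ _ A0; exists (fun=> 0); split=> //.
  by rewrite big_nil A0.
case/andP=> ls us MA; rewrite big_cons.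
set P := ('X - l%:P) ^+ K; set Q := \prod_(m <- s) _ => PQA.
have /Bezout_eq1_coprimepP[[u v] /= uv] : coprimep P Q.
  rewrite /Q; elim: (s) ls => [|m s' IH']; first by rewrite big_nil coprimep1.
  rewrite inE negb_or => /andP[lm ls']; rewrite big_cons coprimepMr IH' // andbT.
  exact: coprimep_XsubC_exp.
pose h p := horner_mx M p.
have Mh p : GRing.comm M (h p) by exact: comm_mx_horner.
have [||E [ME EK sE]] := IH (h (u * P) * A) us.
- by apply: commrM.
- rewrite -/(h _) mulrA -rmorphM /=.
  have -> : Q * (u * P) = u * (P * Q) by ring.
  by rewrite rmorphM /= -mulrA PQA mulr0.
exists (fun m => if m == l then h (v * Q) * A else E m); split=> [m|m|].
- rewrite inE; case: eqP => [_ _|_ /= /ME//]; exact: commrM.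
- rewrite inE; case: eqP => [-> _|_ /= /EK//].
  rewrite -horner_mx_XsubC_exp -/P -/(h P) mulrA -rmorphM /=.
  have -> : P * (v * Q) = v * (P * Q) by ring.
  by rewrite rmorphM /= -mulrA PQA mulr0.
- rewrite big_cons eqxx (eq_big_seq E) => [|m ms]; last first.
    by case: eqP => // ml; rewrite -ml ms in ls.
  by rewrite sE -mulrDl -rmorphD /= [v * Q + _]addrC uv rmorph1 mul1r.
Qed.

(** Insert the Bezout identity of the two coprime powers in front of [A * B]: one power kills [A],
    the other commutes past [A] and kills [B]. *)
Lemma orthogonal_of_coprime M K (l m : F) (A B : 'M[F]_N.+1) : l != m ->
  GRing.comm M A -> (M - l%:M) ^+ K * A = 0 -> (M - m%:M) ^+ K * B = 0 -> A * B = 0.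
Proof.
move=> lm MA lA mB.
have /Bezout_eq1_coprimepP[[u v] /= uv] := coprimep_XsubC_exp K lm.
have MhA p : GRing.comm (horner_mx M p) A by exact: comm_horner_mx.
rewrite -[A]mul1r -(rmorph1 (horner_mx M)) -uv rmorphD !rmorphM /=.
rewrite !horner_mx_XsubC_exp mulrDl mulrDl -!mulrA.
rewrite [_ * (A * B)]mulrA lA mul0r mulr0 add0r.
have -> : (M - m%:M) ^+ K * (A * B) = A * ((M - m%:M) ^+ K * B).
  by rewrite -horner_mx_XsubC_exp mulrA MhA mulrA.
by rewrite mB !mulr0.
Qed.

Lemma spectral_idem X s lam E K l : spectral X s lam E K -> l \in s -> E l * E l = E l.
Proof.
case=> us sE _ _ EE ls; rewrite -{3}[E l]mulr1 -sE mulr_sumr (bigD1_seq l) //=.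
rewrite big1_seq ?addr0 // => k /andP[kl ks]; apply: EE => //; by rewrite eq_sym.
Qed.

(** [M] acts on each component [E m *m w] as the scalar [l], so nilpotency of [M - m] there gives
    [(l - m) ^+ K] times this component equal to 0; only the component [m = l] survives. *)
Lemma spectral_eigenvector M s E K l (w : 'cV[F]_N.+1) : spectral M s id E K ->
  w != 0 -> M *m w = l *: w -> l \in s /\ E l *m w = w.
Proof.
case=> us sE ME EK _ w0 Mw.
have Ew m : m \in s -> m != l -> E m *m w = 0.
  move=> ms ml.
  have H k : (M - m%:M) ^+ k *m (E m *m w) = (l - m) ^+ k *: (E m *m w).
    elim: k => [|k IH]; first by rewrite !expr0 mul1mx scale1r.
    rewrite exprSr -mulmxA mulmxBl mulmxA [M *m E m](ME m ms) -[E m * M *m w]mulmxA.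
    rewrite Mw mul_scalar_mx -scalemxAr -scalerBl -scalemxAr IH scalerA.
    by rewrite -exprS.
  have := H K; rewrite mulmxA [_ *m E m](EK m ms) mul0mx => /esym/eqP.
  rewrite scaler_eq0 expf_eq0 subr_eq0 [l == m]eq_sym (negPf ml) andbF /=.
  by move/eqP.
have wE : w = \sum_(m <- s) E m *m w by rewrite -mulmx_suml sE mul1mx.
case: (boolP (l \in s)) => ls.
  split=> //; rewrite [RHS]wE (bigD1_seq l) //= big1_seq ?addr0 // => m.
  by case/andP=> ml ms; apply: Ew.
case/eqP: w0; rewrite wE big1_seq // => m /andP[_ ms]; apply: Ew => //.
by apply: contraNneq ls => <-.
Qed.

Lemma char_poly_eigenvector M l : root (char_poly M) l ->
  exists2 w : 'cV[F]_N.+1, w != 0 & M *m w = l *: w.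
Proof.
rewrite /root -horner_evalE /char_poly -det_map_mx => /eqP.
have -> : map_mx (horner_eval l) (char_poly_mx M) = l%:M - M.
  apply/matrixP => i j; rewrite !mxE /horner_eval !hornerE.
  by case: (i == j); rewrite ?mulr1n ?mulr0n !hornerE.
rewrite -det_tr => /eqP/det0P[v v0 /(congr1 trmx)].
rewrite trmx_mul trmxK trmx0 => vM; exists v^T.
  by rewrite -trmx0 (inj_eq trmx_inj).
by apply/esym/eqP; rewrite -subr_eq0 -mul_scalar_mx -mulmxBl vM.
Qed.

Lemma spectral_exists M : exists r s E K,
  [/\ spectral M s id E K, \det M = \prod_(l <- r) l, r =i s &
      forall l, l \in s -> exists2 w : 'cV[F]_N.+1, w != 0 & M *m w = l *: w].
Proof.
have [r] := closed_field_poly_normal (char_poly M).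
rewrite (monicP (char_poly_monic M)) scale1r => rE.
exists r, (undup r); have us := undup_uniq r.
have [|E [ME EK sE]] :=
    @split_by_coprime_factors M (size r) (undup r) 1 us (commr1 M).
  rewrite mulr1; have CH := Cayley_Hamilton M.
  (* [size r] bounds every multiplicity, so raising all factors to this common exponent yields a
     multiple of the characteristic polynomial. *)
  rewrite (_ : \prod_(l <- _) _ =
      (\prod_(l <- undup r) ('X - l%:P) ^+ (size r - count_mem l r)) * char_poly M).
    by rewrite rmorphM /= CH mulr0.
  rewrite rE -(prodr_undup_exp_count r xpredT) -big_split /=.
  by apply: eq_bigr => l _; rewrite -exprD subnK // count_size.
exists E, (size r); split.
- split=> // l m ls ms lm; exact: orthogonal_of_coprime lm (ME l ls) (EK l ls) (EK m ms).
- have := char_poly_det M; rewrite -horner_coef0 rE horner_prod.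
  have -> : \prod_(l <- r) ('X - l%:P).[0] = (-1) ^+ size r * \prod_(l <- r) l.
    elim: (r) => [|l r' IH]; first by rewrite !big_nil mulr1.
    by rewrite !big_cons IH !hornerE /= exprS; ring.
  have -> : size r = N.+1.
    by apply/succn_inj; rewrite -(size_char_poly M) rE size_prod_XsubC.
  have n0 : (-1 : F) ^+ N.+1 != 0 by rewrite expf_neq0 // oppr_eq0 oner_eq0.
  by move/(mulfI n0) => <-.
- by move=> l; rewrite mem_undup.
- move=> l; rewrite mem_undup => lr; apply: char_poly_eigenvector.
  by rewrite rE root_prod_XsubC.
Qed.
End SpectralDecomposition.

(** * Powers of a matrix on a generalized eigenspace *)

Section SpectralPowers.
Variable F : closedFieldType.
Variable N : nat.
Implicit Types (M X A : 'M[F]_N.+1) (s : seq F) (E : F -> 'M[F]_N.+1).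

(** Binomial expansion of [(a + (X - a)) ^+ m], whose terms from [K] on vanish on [A]. The number of
    terms does not depend on [m], which makes limits in [m] termwise. *)
Lemma power_expand X (a : F) A K m : (X - a%:M) ^+ K * A = 0 -> (K <= m.+1)%N ->
  X ^+ m * A = \sum_(j < K) ('C(m, j)%:R * a ^+ (m - j)) *: ((X - a%:M) ^+ j * A).
Proof.
move=> XA Km.
have T j : (a%:M : 'M[F]_N.+1) ^+ (m - j) * (X - a%:M) ^+ j *+ 'C(m, j) * A =
    ('C(m, j)%:R * a ^+ (m - j)) *: ((X - a%:M) ^+ j * A).
  rewrite -(rmorphXn (@scalar_mx F N.+1)) /= mulrnAl -mulrA -scalerA scaler_nat.
  by rewrite -mulmxE mul_scalar_mx.
rewrite (big_ord_widen _ (fun j => ('C(m, j)%:R * a ^+ (m - j)) *: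
  ((X - a%:M) ^+ j * A)) Km) -[in LHS](subrK a%:M X) addrC exprDn_comm; last first.
  by rewrite /GRing.comm -!mulmxE; by rewrite scalar_mxC.
rewrite mulr_suml [RHS]big_mkcond /=; apply: eq_bigr => j _; rewrite T.
case: ltnP => // Kj; rewrite -(subnKC Kj) addnC exprD -mulrA XA mulr0 scaler0.
by [].
Qed.

(** From [M' - l^-1 = - l^-1 * M' * (M - l)] with commuting factors. Hence [M] and its inverse have
    the same generalized eigenspaces, with the same orders of nilpotency. *)
Lemma inverse_shift M M' (l : F) j : M * M' = 1 -> M' * M = 1 -> l != 0 ->
  (M' - l^-1%:M) ^+ j = (- l^-1) ^+ j *: (M' ^+ j * (M - l%:M) ^+ j).
Proof.
move=> MM' M'M l0.
have -> : M' - l^-1%:M = (- l^-1) *: (M' * (M - l%:M)).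
  rewrite mulrBr M'M -mulmxE mul_mx_scalar scalerBr scalerA mulNr mulVf //.
  by rewrite scaleN1r opprK addrC scaleNr scalemx1.
rewrite exprZn exprMn_comm //; apply: commrB; first by rewrite /GRing.comm MM'.
by rewrite /GRing.comm -!mulmxE; by rewrite scalar_mxC.
Qed.

Lemma spectral_inverse M M' s E K : M * M' = 1 -> M' * M = 1 ->
  (forall l, l \in s -> l != 0) -> spectral M s id E K ->
  spectral M' s (fun l => l^-1) E K.
Proof.
move=> MM' M'M s0 [us sE ME EK EE]; split=> // l ls.
  rewrite /GRing.comm -[E l * M']mul1r -M'M -mulrA [M * _]mulrA ME //.
  by rewrite -!mulrA MM' mulr1.
by rewrite (inverse_shift K MM' M'M (s0 l ls)) -scalerAl -mulrA EK // mulr0 scaler0.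
Qed.

Lemma inverse_shift_eq0 M M' (l : F) j p (w : 'M[F]_(N.+1, p)) :
  M * M' = 1 -> M' * M = 1 -> l != 0 ->
  (M' - l^-1%:M) ^+ j *m w = 0 <-> (M - l%:M) ^+ j *m w = 0.
Proof.
move=> MM' M'M l0; rewrite (inverse_shift j MM' M'M l0) -scalemxAl.
split=> [/eqP|]; last by rewrite -mulmxE -mulmxA => ->; rewrite mulmx0 scaler0.
rewrite scaler_eq0 expf_eq0 oppr_eq0 invr_eq0 (negPf l0) andbF /= => /eqP H.
have M'j : M ^+ j * M' ^+ j = 1 by rewrite -exprMn_comm ?MM' ?expr1n // /GRing.comm MM'.
have := congr1 (mulmx (M ^+ j)) H.
by rewrite mulmx0 mulmxA mulmxE mulrA M'j mul1r.
Qed.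

End SpectralPowers.

(** * Growth of binomial coefficients *)

Section BinomialLimits.
Variable R : realType.

(** A bound of ['C(m, j) / 'C(m, d)] by [d! / (m - d + 1)], a multiple of a shifted [harmonic]:
    ['C(m, d) * d!] is a falling factorial, which gains the factor [m - d] when [d] increases by
    one. *)
Lemma bin_ratio_leq j d m : (j < d <= m)%N ->
  ('C(m, j) * (m - d).+1 <= 'C(m, d) * d`!)%N.
Proof.
case/andP=> jd; elim: d jd => // d IH; rewrite ltnS leq_eqVlt.
have E : ('C(m, d.+1) * d.+1`! = 'C(m, d) * (m - d) * d`!)%N.
  by rewrite factS mulnA [('C(_, _) * d.+1)%N]mulnC mul_bin_left [((m - d) * _)%N]mulnC.
move=> jd dm; rewrite E subnSK //; case/orP: jd => [/eqP->|jd].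
  by rewrite leq_pmulr // fact_gt0.
apply: (@leq_trans ('C(m, j) * (m - d).+1 * (m - d))%N).
  by rewrite leq_mul2r leq_pmulr ?orbT.
by rewrite [leqRHS]mulnAC leq_mul2r IH ?orbT // ltnW.
Qed.

Lemma harmonic_sub_cvg0 (c : R) d : c * harmonic (m - d)%N @[m --> \oo] --> (0 : R).
Proof.
rewrite -(mulr0 c); apply: cvgM; first exact: cvg_cst.
apply: (@cvg_comp _ _ _ (fun m => m - d)%N (@harmonic R)); last exact: cvg_harmonic.
move=> A [M _ MA]; exists (M + d)%N => // m /= Mm; apply: MA => /=.
by rewrite leq_subRL ?(leq_trans (leq_addl _ _) Mm) // addnC.
Qed.

Lemma bin_ratio_cvg0 j d : (j < d)%N ->
  'C(m, j)%:R / 'C(m, d)%:R @[m --> \oo] --> (0 : R).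
Proof.
move=> jd.
apply: (@squeeze_cvgr _ _ _ _ (fun=> 0) (fun m => d`!%:R * harmonic (m - d)%N)).
- near=> m; have dm : (d <= m)%N by near: m; exact: nbhs_infty_ge.
  rewrite divr_ge0 ?ler0n //= /harmonic ler_pdivrMr ?ltr0n ?bin_gt0 //.
  rewrite mulrAC ler_pdivlMr ?ltr0n // -!natrM ler_nat.
  by rewrite [(d`! * _)%N]mulnC bin_ratio_leq // jd dm.
- exact: cvg_cst.
- exact: harmonic_sub_cvg0.
Unshelve. all: by end_near. Qed.

Lemma bin_mul_expr_le (x : R) j m : 0 <= x -> 'C(m, j)%:R * x ^+ j <= (1 + x) ^+ m.
Proof.
move=> x0; have [jm|mj] := leqP j m; last first.
  by rewrite bin_small // mul0r exprn_ge0 // addr_ge0.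
rewrite exprDn (bigD1 (Ordinal (jm : (j < m.+1)%N))) //= expr1n mul1r mulr_natl lerDl.
by apply: sumr_ge0 => i _; rewrite expr1n mul1r mulrn_wge0 // exprn_ge0.
Qed.

Lemma bin_geometric_cvg0 (q : R) j : 0 < q -> q < 1 ->
  'C(m, j)%:R * q ^+ m @[m --> \oo] --> (0 : R).
Proof.
(* As [(1 + x) * q = 1], one term of the expansion of [(1 + x) ^+ m] gives
   ['C(m, j.+1) * x ^+ j.+1 * q ^+ m <= 1]. Passing from [j.+1] to [j] brings the decaying factor
   [j.+1 / (m - j)]. *)
move=> q0 q1; pose x := q^-1 - 1.
have x0 : 0 < x by rewrite subr_gt0 invf_gt1.
apply: (@squeeze_cvgr _ _ _ _ (fun=> 0)
  (fun m => (j.+1%:R / x ^+ j.+1) * harmonic (m - j.+1)%N)).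
- near=> m; have jm : (j < m)%N by near: m; exact: nbhs_infty_gt.
  rewrite mulr_ge0 ?ler0n ?(exprn_ge0 _ (ltW q0)) //= /harmonic.
  rewrite ler_pdivlMr ?ltr0n // subnSK // ler_pdivlMr ?exprn_gt0 //.
  have -> : 'C(m, j)%:R * q ^+ m * (m - j)%:R * x ^+ j.+1 =
      j.+1%:R * (q ^+ m * ('C(m, j.+1)%:R * x ^+ j.+1)) :> R.
    have := congr1 (fun k => k%:R : R) (mul_bin_left m j); rewrite !natrM => E.
    move: (q ^+ m) (x ^+ j.+1) E => a b E.
    by transitivity (((m - j)%:R * 'C(m, j)%:R) * (a * b)); [ring|rewrite -E; ring].
  apply: ler_piMr; first exact: ler0n.
  apply: le_trans (ler_wpM2l _ (bin_mul_expr_le _ _ (ltW x0))) _.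
    exact: exprn_ge0 (ltW q0).
  by rewrite /x addrC subrK -exprMn divff ?gt_eqF // expr1n.
- exact: cvg_cst.
- exact: harmonic_sub_cvg0.
Unshelve. all: by end_near. Qed.

End BinomialLimits.

(** * Leading term of the normalized powers *)

Section PowerAsymptotics.
Variable R : realType.
Local Notation C := R[i].
Local Notation normc := (@ComplexField.Normc.normc R).
Local Notation normcM := ComplexField.Normc.normcM.

Lemma normcX (c : C) m : normc (c ^+ m) = normc c ^+ m.
Proof.
by elim: m => [|m IH]; rewrite ?expr0 ?ComplexField.Normc.normc1 // !exprS normcM IH.
Qed.

Lemma normc_real (x : R) : normc x%:C = `|x|.
Proof. by rewrite /= expr0n /= addr0 sqrtr_sqr. Qed.

Lemma normc_natr m : normc m%:R = m%:R.
Proof.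
have -> : (m%:R : C) = (m%:R)%:C by rewrite rmorph_nat.
by rewrite normc_real ger0_norm ?ler0n.
Qed.

Lemma normc_ge0 (c : C) : 0 <= normc c.
Proof. by case: (normc_ring_norm R). Qed.

Lemma mxn_scale m n (c : C) (A : 'M[C]_(m, n)) :
  mxn normc (c *: A) = normc c * mxn normc A.
Proof.
rewrite /mxn mulr_sumr; apply: eq_bigr => i _; rewrite mulr_sumr.
by apply: eq_bigr => j _; rewrite mxE normcM.
Qed.

Lemma comb_lim0 m n K (Y : 'I_K -> 'M[C]_(m, n)) (c : nat -> 'I_K -> C) :
  (forall j, normc (c k j) @[k --> \oo] --> (0 : R)) ->
  mx_lim normc \oo (fun k => \sum_j c k j *: Y j) 0.
Proof.
move=> c0; apply: (mx_lim0P (normc_ring_norm R)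
    (u := fun k => \sum_j normc (c k j) * mxn normc (Y j))).
  near=> k; apply: le_trans (mxn_sum (normc_ring_norm R) _ _) _.
  by apply: ler_sum => j _; rewrite mxn_scale.
apply: (@sum_cvg0 _ _ _ _ _ _ (fun j k => normc (c k j) * mxn normc (Y j))) => j _.
by rewrite -(mul0r (mxn normc (Y j))); apply: cvgM => //; exact: cvg_cst.
Unshelve. all: by end_near. Qed.

Variable N : nat.
Variables (X : 'M[C]_N.+1) (s : seq C) (lam : C -> C) (E : C -> 'M[C]_N.+1) (K : nat).
Variables (r : R) (d : nat).

Definition growth m : R := r ^+ m * 'C(m, d)%:R.

(* [r] is the spectral radius and [d + 1] the largest size of a Jordan block
   for an eigenvalue of modulus [r]. *)
Definition dominant : Prop :=
  [/\ 0 < r, forall l, l \in s -> normc (lam l) <= r,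
     forall l, l \in s -> normc (lam l) = r -> (X - (lam l)%:M) ^+ d.+1 * E l = 0
   & exists l, [/\ l \in s, normc (lam l) = r & (X - (lam l)%:M) ^+ d * E l <> 0]].

(** The term [j = d] of [power_expand] after division by [growth], where ['C(m, d)] cancels. For
    [d <= m] its scalar has constant modulus [r ^- d]; its argument may depend on [m]. *)
Definition leading l m : 'M[C]_N.+1 := if normc (lam l) == r then
  ((lam l) ^+ (m - d) / (r ^+ m)%:C) *: ((X - (lam l)%:M) ^+ d * E l) else 0.

Hypothesis sp : spectral X s lam E K.
Hypothesis dom : dominant.

Lemma growth_gt0 m : (d <= m)%N -> 0 < growth m.
Proof.
by case: dom => r0 _ _ _ dm; rewrite mulr_gt0 ?exprn_gt0 // ltr0n bin_gt0.
Qed.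

(** Terms with [j > d] vanish by [dominant]. Those with [j < d] have size
    [r ^- j * 'C(m, j) / 'C(m, d)], which tends to 0. *)
Lemma power_leading_top l : l \in s -> normc (lam l) = r ->
  mx_lim normc \oo (fun m => (growth m)^-1%:C *: (X ^+ m * E l) - leading l m) 0.
Proof.
case: dom => r0 _ top _; case: sp => _ _ _ _ _ ls lr.
pose c m (j : 'I_d) : C := (growth m)^-1%:C * ('C(m, j)%:R * (lam l) ^+ (m - j)).
have := @comb_lim0 N.+1 N.+1 d (fun j => (X - (lam l)%:M) ^+ j * E l) c.
have c0 j : normc (c m j) @[m --> \oo] --> (0 : R).
  have : (r ^+ j)^-1 * ('C(m, j)%:R / 'C(m, d)%:R) @[m --> \oo] --> (0 : R).
    rewrite -(mulr0 (r ^+ j)^-1); apply: cvgM; first exact: cvg_cst.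
    exact: bin_ratio_cvg0.
  apply: cvg_trans; apply: near_eq_cvg; near=> m.
  have dm : (d <= m)%N by near: m; exact: nbhs_infty_ge.
  have jm : (j <= m)%N by apply: leq_trans dm; exact: ltnW.
  rewrite /c !normcM normcX normc_natr normc_real lr gtr0_norm ?invr_gt0 ?growth_gt0 //.
  have -> : growth m = r ^+ (m - j) * r ^+ j * 'C(m, d)%:R by rewrite -exprD subnK.
  have n0 : r != 0 by rewrite gt_eqF.
  have n1 : 'C(m, d)%:R != 0 :> R by rewrite pnatr_eq0 -lt0n bin_gt0.
  have := expf_neq0 (m - j)%N n0; have := expf_neq0 j n0.
  move: (r ^+ (m - j)) (r ^+ j) ('C(m, d)%:R) n1 => a b e e0 b0 a0; field.
  by rewrite a0 b0 e0.
move=> /(_ c0); rewrite /mx_lim; apply: cvg_trans; apply: near_eq_cvg; near=> m.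
have dm : (d <= m)%N by near: m; exact: nbhs_infty_ge.
congr (mxn _ (_ - _)).
rewrite (power_expand (top l ls lr)) // big_ord_recr /= scalerDr scaler_sumr.
have -> : leading l m = (growth m)^-1%:C *: (('C(m, d)%:R * lam l ^+ (m - d)) *:
    ((X - (lam l)%:M) ^+ d * E l)).
  rewrite /leading lr eqxx scalerA; congr (_ *: _).
  rewrite /growth fmorphV rmorphM /= rmorph_nat.
  have n1 : 'C(m, d)%:R != 0 :> C by rewrite pnatr_eq0 -lt0n bin_gt0.
  have n0 : (r ^+ m)%:C != 0 by rewrite fmorph_eq0 expf_neq0 ?gt_eqF.
  move: ((r ^+ m)%:C) n0 => a a0.
  by field; rewrite n1 a0.
by rewrite addrK; apply: eq_bigr => j _; rewrite scalerA.
Unshelve. all: by end_near. Qed.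

Lemma power_leading_lower l : l \in s -> normc (lam l) < r ->
  mx_lim normc \oo (fun m => (growth m)^-1%:C *: (X ^+ m * E l) - leading l m) 0.
Proof.
case: dom => r0 _ _ _; case: sp => _ _ _ EK _ ls lr.
pose c m (j : 'I_K) : C := (growth m)^-1%:C * ('C(m, j)%:R * (lam l) ^+ (m - j)).
have := @comb_lim0 N.+1 N.+1 K (fun j => (X - (lam l)%:M) ^+ j * E l) c.
(* A positive bound replaces [normc (lam l)], which may be 0, since the estimate divides by
   [b ^+ j]. *)
have [b [b0 lb br]] : exists b, [/\ 0 < b, normc (lam l) <= b & b < r].
  exists ((normc (lam l) + r) / 2); have := normc_ge0 (lam l).
  by move: (normc _) lr => a; split; lra.
have q0 : 0 < b / r by rewrite divr_gt0.
have q1 : b / r < 1 by rewrite ltr_pdivrMr // mul1r.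
have c0 j : normc (c m j) @[m --> \oo] --> (0 : R).
  apply: (@squeeze_cvgr _ _ _ _ (fun=> 0)
    (fun m => (b ^+ j)^-1 * ('C(m, j)%:R * (b / r) ^+ m))).
  - near=> m; rewrite normc_ge0 /=.
    have dm : (d <= m)%N by near: m; exact: nbhs_infty_ge.
    have jm : (j <= m)%N by near: m; exact: nbhs_infty_ge.
    rewrite /c !normcM normcX normc_natr normc_real gtr0_norm ?invr_gt0 ?growth_gt0 //.
    apply: (@le_trans _ _ ((r ^+ m)^-1 * ('C(m, j)%:R * b ^+ (m - j)))).
      apply: ler_pM.
      + by rewrite invr_ge0 ltW // growth_gt0.
      + by rewrite mulr_ge0 ?ler0n // exprn_ge0 // normc_ge0.
      + rewrite lef_pV2 ?posrE ?growth_gt0 ?exprn_gt0 // /growth ler_peMr //.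
          by rewrite exprn_ge0 // ltW.
        by rewrite ler1n bin_gt0.
      + by apply: ler_wpM2l; rewrite ?ler0n // lerXn2r ?nnegrE ?normc_ge0 // ltW.
    rewrite expr_div_n; have -> : b ^+ m = b ^+ (m - j) * b ^+ j by rewrite -exprD subnK.
    have := expf_neq0 j (lt0r_neq0 b0); have := expf_neq0 m (lt0r_neq0 r0).
    move: (r ^+ m) (b ^+ j) (b ^+ (m - j)) => x y z x0 y0.
    by rewrite le_eqVlt; apply/orP; left; apply/eqP; field; rewrite x0 y0.
  - exact: cvg_cst.
  - rewrite -(mulr0 (b ^+ j)^-1); apply: cvgM; first exact: cvg_cst.
    exact: bin_geometric_cvg0.
move=> /(_ c0); rewrite /mx_lim; apply: cvg_trans; apply: near_eq_cvg; near=> m.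
have Km : (K <= m.+1)%N by apply: leqW; near: m; exact: nbhs_infty_ge.
congr (mxn _ (_ - _)).
rewrite /leading lt_eqF // subr0 (power_expand (EK l ls)) // scaler_sumr.
by apply: eq_bigr => j _; rewrite scalerA.
Unshelve. all: by end_near. Qed.

Lemma power_asymptotics :
  mx_lim normc \oo (fun m => (growth m)^-1%:C *: X ^+ m - \sum_(l <- s) leading l m) 0.
Proof.
have [_ sE _ _ _] := sp; have [_ lr _ _] := dom.
pose D l m := (growth m)^-1%:C *: (X ^+ m * E l) - leading l m.
have D0 l : l \in s -> mx_lim normc \oo (D l) 0.
  move=> ls; have := lr l ls; rewrite le_eqVlt => /orP[/eqP|].
    exact: power_leading_top.
  exact: power_leading_lower.
apply: (mx_lim0P (normc_ring_norm R) (u := fun m => \sum_(l <- s) mxn normc (D l m - 0))).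
  near=> m; have -> : (growth m)^-1%:C *: X ^+ m - \sum_(l <- s) leading l m =
      \sum_(l <- s) (D l m - 0).
    under [RHS]eq_bigr do rewrite subr0.
    by rewrite sumrB -scaler_sumr -mulr_sumr sE mulr1.
  exact: (mxn_sum (normc_ring_norm R)).
exact: (@sum_cvg0 _ _ _ _ _ _ (fun l m => mxn normc (D l m - 0))).
Unshelve. all: by end_near. Qed.

End PowerAsymptotics.

(** * Limit points of normalized quaternionic powers *)

Section QuaternionicPowers.
Variable R : realType.
Local Notation C := R[i].
Local Notation H := (quat R).
Local Notation normc := (@ComplexField.Normc.normc R).
Local Notation normcM := ComplexField.Normc.normcM.

Section PhiNorm.
Variable n : nat.
Implicit Types A B : 'M[H]_n.

Lemma PhiB A B : Phi (A - B) = Phi A - Phi B.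
Proof.
rewrite -PhiN /Phi; set A1 := map_mx (@qC1 R) A; set A2 := map_mx (@qC2 R) A.
set B1 := map_mx _ (- B); set B2 := map_mx _ (- B).
have -> : map_mx (@qC1 R) (A - B) = A1 + B1 by apply/matrixP => i j; rewrite !mxE.
have -> : map_mx (@qC2 R) (A - B) = A2 + B2 by apply/matrixP => i j; rewrite !mxE.
by rewrite !map_mxD opprD add_block_mx.
Qed.

Lemma mxn_Phi A : mxn normc (Phi A) = 2 * mxn qn A.
Proof.
have normcN x : normc (- x) = normc x by case: (normc_ring_norm R) => _ _ ->.
rewrite /mxn big_split_ord /= mulr_natl mulr2n; congr (_ + _);
  apply: eq_bigr => i _; rewrite big_split_ord /= -big_split /=;
  apply: eq_bigr => j _.
  by rewrite block_mxEul block_mxEur !mxE.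
by rewrite block_mxEdl block_mxEdr !mxE normcN !normc_conj addrC.
Qed.

Lemma mx_lim_Phi I (F : set_system I) {FF : Filter F} (X : I -> 'M[H]_n) L :
  mx_lim qn F X L -> mx_lim normc F (fun i => Phi (X i)) (Phi L).
Proof.
move=> XL; rewrite /mx_lim.
under eq_cvg do rewrite -PhiB mxn_Phi.
have := cvgM (cvg_cst (2 : R)) XL; rewrite mulr0; exact.
Qed.

(** Real scalars are central, so this multiplies [A *m x] on the right by a scalar and does not move
    its projective point ([act_realscale]). *)
Definition realscale p q (t : R) (A : 'M[H]_(p, q)) : 'M[H]_(p, q) :=
  A *m (quatC t%:C)%:M.

Lemma Phi_realscale (t : R) A : Phi (realscale t A) = t%:C *: Phi A.
Proof.
rewrite /realscale PhiM -mul_mx_scalar; congr (_ *m _).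
rewrite /Phi (scalar_mx_block _ _ t%:C).
congr block_mx; apply/matrixP => i j; rewrite !mxE; case: (i == j);
  rewrite ?mulr1n ?mulr0n //=; by apply/eqP; rewrite eq_complex /= ?oppr0 ?eqxx.
Qed.

End PhiNorm.

(** [(n + n.+1).+1] is [n.+1 + n.+1] up to conversion, in the successor form under which square
    matrices form a ring. *)
Lemma PhiX n (A : 'M[H]_n.+1) m : Phi (A ^+ m) = (Phi A : 'M[C]_((n + n.+1).+1)) ^+ m.
Proof.
elim: m => [|m IH]; first by rewrite !expr0 Phi1.
by rewrite !exprS -mulmxE PhiM IH.
Qed.

Section Subsequences.
Variables (n : nat) (A : 'M[H]_n.+1).
Let M : 'M[C]_((n + n.+1).+1) := Phi A.
Variables (s : seq C) (lam : C -> C) (E : C -> 'M[C]_((n + n.+1).+1)) (K : nat).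
Variables (r : R) (d : nat).
Hypothesis sp : spectral M s lam E K.
Hypothesis dom : dominant M s lam E r d.

(* The vectors [v] with [A ^+ m *m v = o(growth r d m)]; see [limit_kernel]. *)
Definition slow_vectors : set 'cV[H]_n.+1 := [set v : 'cV[H]_n.+1 | forall l, l \in s ->
  normc (lam l) = r -> ((M - (lam l)%:M) ^+ d * E l) *m q2c v = 0].

Definition normalized m : 'M[H]_n.+1 := realscale (growth r d m)^-1 (A ^+ m).

Let mxn_leading l m : l \in s -> (d <= m)%N -> normc (lam l) = r ->
  normc (lam l ^+ (m - d) / (r ^+ m)%:C) = (r ^+ d)^-1.
Proof.
move=> ls dm lr; have [r0 _ _ _] := dom.
have rn0 k : r ^+ k != 0 by rewrite expf_neq0 ?gt_eqF.
rewrite -rmorphV ?unitfE // normcM normcX lr normc_real ger0_norm ?invr_ge0; last first.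
  by rewrite exprn_ge0 // ltW.
have -> : r ^+ m = r ^+ (m - d) * r ^+ d by rewrite -exprD subnK.
by rewrite invfM mulrA divff // mul1r.
Qed.

(** The projector isolates the summand of one eigenvalue, so that a vector killed by the whole sum
    in the limit cannot owe this to cancellation between eigenvalues. *)
Lemma leading_projection l m : l \in s ->
  leading M lam E r d l m = E l * \sum_(k <- s) leading M lam E r d k m.
Proof.
have [us sE EM EK EE] := sp; move=> ls.
have EElead k : k \in s ->
    E l * leading M lam E r d k m = if k == l then leading M lam E r d l m else 0.
  move=> ks; have EX : E l * (M - (lam k)%:M) ^+ d = (M - (lam k)%:M) ^+ d * E l.
    by apply: commrX; apply: commrB; [exact/commr_sym/EM|exact: scalar_mxC].
  rewrite /leading; have [kl|kl] := eqVneq k l; last first.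
    case: ifP => _; last by rewrite mulr0.
    by rewrite -scalerAr mulrA EX -mulrA EE 1?eq_sym // mulr0 scaler0.
  rewrite kl in EX *; case: ifP => _; last by rewrite mulr0.
  by rewrite -scalerAr mulrA EX -mulrA (spectral_idem sp ls).
rewrite mulr_sumr (bigD1_seq l) //= EElead // eqxx big1_seq ?addr0 // => k.
by case/andP=> kl ks; rewrite EElead // (negPf kl).
Qed.

Lemma normalized_bounded : exists B, \forall m \near \oo, mxn qn (normalized m) <= B.
Proof.
pose Y l := (M - (lam l)%:M) ^+ d * E l.
(* 1 absorbs the error of [power_asymptotics]; the sum bounds the leading terms, whose scalars have
   modulus [r ^- d]. *)
exists (1 + \sum_(l <- s) (r ^+ d)^-1 * mxn normc (Y l)).
have [r0 _ _ _] := dom.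
near=> m.
have dm : (d <= m)%N by near: m; exact: nbhs_infty_ge.
have small : mxn normc ((growth r d m)^-1%:C *: M ^+ m
    - \sum_(l <- s) leading M lam E r d l m - 0) < 1.
  near: m.
  exact: (mx_lim_lt (normc_ring_norm R) (power_asymptotics sp dom) ltr01).
apply: (@le_trans _ _ (mxn normc (Phi (normalized m)))).
  rewrite mxn_Phi; apply: ler_peMl; last by rewrite ler1n.
  exact: (mxn_ge0 (qn_ring_norm R)).
rewrite Phi_realscale PhiX.
set X := _ *: _; set L := \sum_(l <- s) leading M lam E r d l m.
have -> : X = (X - L - 0) + L by rewrite subr0 subrK.
apply: le_trans (mxnD (normc_ring_norm R) _ _) _; apply: lerD.
  exact: ltW.
apply: le_trans (mxn_sum (normc_ring_norm R) _ _) _.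
rewrite !big_seq; apply: ler_sum => l ls; rewrite /leading; case: eqP => lr.
  by rewrite mxn_scale mxn_leading.
rewrite (proj2 (mxn_eq0 (normc_ring_norm R) _)) // mulr_ge0 //.
  by rewrite invr_ge0 exprn_ge0 // ltW.
exact: (mxn_ge0 (normc_ring_norm R)).
Unshelve. all: by end_near. Qed.

(** [T *m v] is the limit of the leading sums applied to [v]. If it is 0, applying [E l] leaves
    summands whose norm is eventually constant, namely [r ^- d] times that of the vector in
    [slow_vectors]; this constant is therefore 0. Conversely, every leading sum kills a slow
    vector. *)
Lemma limit_kernel (p : nat -> nat) T : p @ \oo --> \oo ->
  mx_lim qn \oo (normalized \o p) T -> forall v, T *m v = 0 <-> slow_vectors v.
Proof.
move=> poo XT v; have [_ sE EM EK EE] := sp; have [r0 _ _ _] := dom.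
pose L m := \sum_(l <- s) leading M lam E r d l m.
have nN := normc_ring_norm R.
have LT : mx_lim normc \oo (fun k => L (p k) *m q2c v) (q2c (T *m v)).
  have P1 : mx_lim normc \oo (fun k => Phi (normalized (p k))) (Phi T).
    exact: mx_lim_Phi.
  (* The factor [- 1%:M] negates the error, so that adding it to P1 leaves [L (p k)] alone. *)
  have P2 : mx_lim normc \oo (fun k => ((growth r d (p k))^-1%:C *: M ^+ p k - L (p k))
      *m - 1%:M) 0.
    rewrite -(mul0mx _ (- 1%:M : 'M[C]_((n + n.+1).+1))).
    apply: mx_limM; [exact: nN| |exact: mx_lim_cst].
    exact: mx_lim_comp poo (power_asymptotics sp dom).
  have P3 : mx_lim normc \oo (fun k => L (p k)) (Phi T).
    have P4 : mx_lim normc \oo (fun k => Phi (normalized (p k)) +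
        ((growth r d (p k))^-1%:C *: M ^+ p k - L (p k)) *m - 1%:M) (Phi T + 0).
      exact: mx_limD.
    move: P4; rewrite addr0; apply: cvg_trans; apply: near_eq_cvg; near=> k => /=.
    congr (mxn _ (_ - _)).
    by rewrite Phi_realscale PhiX mulmxN mulmx1 opprB addrC subrK.
  by rewrite q2c_mul; apply: mx_limM => //; exact: mx_lim_cst.
split=> [Tv0 l ls lr|vK].
  move: LT; rewrite Tv0 q2c0 => LT.
  have ELT : mx_lim normc \oo (fun k => E l *m (L (p k) *m q2c v)) (E l *m 0).
    by apply: mx_limM => //; exact: mx_lim_cst.
  rewrite mulmx0 in ELT.
  apply/(mxn_eq0 nN).
  have c0 : (r ^+ d)^-1 != 0 by rewrite invr_eq0 expf_neq0 ?gt_eqF.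
  apply: (mulfI c0); rewrite mulr0.
  set c := _ * _.
  have cc : (fun _ : nat => c) @ \oo --> c by exact: cvg_cst.
  apply: (norm_cvg_unique cc); move: ELT; rewrite /mx_lim; apply: cvg_trans.
  apply: near_eq_cvg; near=> k.
  have dk : (d <= p k)%N by near: k; exact: (poo _ (nbhs_infty_ge d)).
  have -> : E l *m (L (p k) *m q2c v) = leading M lam E r d l (p k) *m q2c v.
    by rewrite mulmxA (leading_projection (p k) ls).
  rewrite subr0 /leading lr eqxx.
  by rewrite -scalemxAl mxn_scale mxn_leading.
apply/eqP; rewrite -q2c_eq0; apply/eqP.
apply: (mx_lim_unique nN LT).
have L0 m : L m *m q2c v = 0.
  rewrite /L mulmx_suml big1_seq // => l /andP[_ ls]; rewrite /leading.
  by case: eqP => [lr|_]; rewrite ?mul0mx // -scalemxAl vK // scaler0.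
under [X in mx_lim _ _ X]eq_fun do rewrite L0.
exact: mx_lim_cst.
Unshelve. all: by end_near. Qed.

(** With [limit_kernel], this says that no limit [T] is zero. *)
Lemma slow_vectors_proper : exists v, ~ slow_vectors v.
Proof.
have [_ _ _ [l [ls lr El0]]] := dom.
apply: contrapT => allK; apply: El0; apply/matrixP => i j.
have /(_ l ls lr) : slow_vectors (@c2q R n.+1 (delta_mx j 0)).
  by apply: contrapT => nK; apply: allK; eexists; exact: nK.
rewrite c2qK -colE => /matrixP/(_ i 0).
by rewrite !mxE.
Qed.

Lemma normalized_subsequence (p : nat -> nat) : p @ \oo --> \oo ->
  exists f T, [/\ {homo f : i j / (i < j)%N},
    mx_lim qn \oo (normalized \o (p \o f)) T & forall v, T *m v = 0 <-> slow_vectors v].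
Proof.
move=> poo; have [B NB] := normalized_bounded.
have [|f [T [fh fT]]] := mx_bolzano_weierstrass (X := normalized \o p) (M := B).
  case: NB => m0 _ NB.
  have [k0 _ pk] : \forall k \near \oo, (m0 <= p k)%N := poo _ (nbhs_infty_ge m0).
  exists k0; first exact: I.
  by move=> k kk0; exact: NB _ (pk _ kk0).
exists f, T; split=> //; apply: limit_kernel fT.
by apply: cvg_comp poo; exact: homo_cvg_oo.
Qed.

End Subsequences.
End QuaternionicPowers.

(** * Convergence in projective space *)

Section ProjectiveTopology.
Variables (R : realType) (n : nat).
Local Notation H := (quat R).
Local Notation vec := ('cV[H]_n.+1).
Local Notation PP := (projspace R n).
Implicit Types (z : nzvec R n) (v x : vec).

Definition nonzero_vec x (x0 : x != 0) : nzvec R n :=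
  exist (fun y => y \in nonzero_vectors (n := n)) x (mem_set x0).

Definition projpt x (x0 : x != 0) : PP := \pi_(projspace R n) (nonzero_vec x0).

Lemma pi_proj z : \pi_(projspace R n) z = projpt (nzvec_neq0 z).
Proof. by rewrite /projpt; congr (\pi_(projspace R n) _); apply: val_inj. Qed.

Lemma nbhs_nonzero_vec z (O : set (nzvec R n)) : nbhs z O ->
  exists2 V : set vec, nbhs (val z) V & forall y, V (val y) -> O y.
Proof.
move=> [_ [[V oV <-] Vz VO]]; exists V; first exact: open_nbhs_nbhs.
by move=> y Vy; apply: VO.
Qed.

Lemma cvg_nonzero_vec I (F : set_system I) {FF : Filter F} (f : I -> nzvec R n) z :
  (val \o f) @ F --> val z -> f @ F --> z.
Proof.
move=> fz O /nbhs_nonzero_vec[V Vz VO].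
have FV : F [set i | V (val (f i))] := fz V Vz.
exact: (@filterS _ F FF _ _ (fun i => VO (f i)) FV).
Qed.

Lemma val_nonzero_continuous : continuous (fun z : nzvec R n => val z : vec).
Proof. exact: initial_continuous. Qed.

Lemma rscale_neq0 x (a : H) : x != 0 -> a != 0 -> rscale x a != 0.
Proof.
move=> x0 a0; apply: contraNneq x0 => xa0; apply/eqP.
rewrite -[x]rscale1 -(@divrr _ a) ?unitqE // -rscaleA xa0.
by rewrite /rscale mul0mx.
Qed.

(** The quotient map is open: the saturation of an open set is the union of its preimages under the
    continuous scalings [sc a]. *)
Lemma proj_nbhs z (P : set PP) :
  nbhs z (fun y => P (\pi_(projspace R n) y)) -> nbhs (\pi_(projspace R n) z) P.
Proof.
rewrite {1}nbhsE; case=> O [oO Oz] OP.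
rewrite nbhsE; exists [set \pi_(projspace R n) y | y in O]; last first.
  by move=> _ [y Oy <-]; exact: OP.
split; last by exists z.
rewrite /open /= /quotient_open.
pose sc (a : {a : H | a != 0}) (y : nzvec R n) : nzvec R n :=
  nonzero_vec (rscale_neq0 (nzvec_neq0 y) (svalP a)).
have -> : \pi_(projspace R n) @^-1` [set \pi_(projspace R n) y | y in O] =
    \bigcup_a (sc a @^-1` O).
  apply/seteqP; split=> [y [w Ow /proj_piP[a a0 wy]]|y [a _ Oy]].
    exists (exist (fun a => a != 0) a a0) => //.
    change (O (sc (exist (fun a => a != 0) a a0) y)).
    have -> // : sc (exist (fun a => a != 0) a a0) y = w.
    by apply: val_inj; rewrite wy.
  exists (sc a y) => //; apply/proj_piP; exists (sval a) => //; exact: (svalP a).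
apply: bigcup_open => a _; move: O oO {Oz OP}; apply/continuousP => y.
apply: (@cvg_nonzero_vec _ _ (nbhs_filter y)).
have sca : mx_lim qn (nbhs y) (fun w : nzvec R n => val w *m (sval a)%:M)
    (val y *m (sval a)%:M).
  apply: mx_limM; [exact: qn_ring_norm| |exact: (mx_lim_cst (qn_ring_norm R))].
  by apply: cvg_mx_lim; exact: val_nonzero_continuous.
exact: (@mx_lim_cvg _ _ _ (nbhs_filter y) _ _ _ _ sca).
Qed.

Lemma realscale_mul t (A : 'M[H]_n.+1) x :
  realscale t A *m x = rscale (A *m x) (quatC t%:C).
Proof.
rewrite /realscale /rscale -!mulmxA; congr (_ *m _).
apply/matrixP => i j; rewrite mul_scalar_mx !mxE big_ord1 !mxE ord1 eqxx mulr1n.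
by apply: quatP => /=; ring.
Qed.

Lemma quatC_real_neq0 (t : R) : t != 0 -> quatC t%:C != 0.
Proof. by move=> t0; apply: contraNneq t0 => -[->]. Qed.

Lemma act_realscale (A : SL R n) (t : R) z (nz : realscale t (val A) *m val z != 0) :
  t != 0 -> PSL_act (\pi_(PSL R n) A) (\pi_(projspace R n) z) = projpt nz.
Proof.
move=> t0; rewrite PSL_act_pi; apply/esym/proj_piP.
exists (quatC t%:C); first exact: quatC_real_neq0.
exact: realscale_mul.
Qed.

Lemma realscale_mul_neq0 (A : SL R n) (t : R) z :
  t != 0 -> realscale t (val A) *m val z != 0.
Proof.
move=> t0; rewrite realscale_mul; apply: rscale_neq0; last exact: quatC_real_neq0.
exact: nzvec_neq0 (SL_act A z).
Qed.

Section UniformConvergence.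
Variables (A : nat -> SL R n) (t : nat -> R) (T : 'M[H]_n.+1) (U : set PP).
Hypothesis t_neq0 : \forall k \near \oo, t k != 0.
Hypothesis At : mx_lim qn \oo (fun k => realscale (t k) (val (A k))) T.

Let f k (u : U) : PP := PSL_act (\pi_(PSL R n) (A k)) (set_val u).

(** The limit is taken jointly in the point and the index, which is what uniformity near [z]
    requires. *)
Lemma near_proj_limit z (Tz : T *m val z != 0) (O : set PP) : nbhs (projpt Tz) O ->
  \forall y \near z & k \near \oo, forall nz : realscale (t k) (val (A k)) *m val y != 0,
    O (projpt nz).
Proof.
move=> OTz; have := pi_continuous OTz => /nbhs_nonzero_vec[V VTz VO].
pose G : set_system (nzvec R n * nat) := filter_prod (nbhs z) \oo.
have GF : Filter G by exact: filter_prod_filter.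
have AG : mx_lim qn G (fun p => realscale (t p.2) (val (A p.2))) T.
  by apply: (@mx_lim_comp _ _ _ _ _ \oo G snd) At; exact: cvg_snd.
have zG : mx_lim qn G (fun p => val p.1 : vec) (val z).
  apply: (@cvg_mx_lim _ _ _ GF).
  apply: (@cvg_comp _ _ _ fst (fun y : nzvec R n => val y) _ (nbhs z)).
    exact: cvg_fst.
  exact: val_nonzero_continuous.
have AzG := @mx_limM _ _ _ (qn_ring_norm R) _ _ GF _ _ _ _ _ _ _ AG zG.
have := @mx_lim_cvg _ _ _ GF _ _ _ _ AzG.
move=> /(_ V VTz) GV; apply: (@filterS _ G GF _ _ _ GV) => p Vp nz.
exact: (VO (nonzero_vec nz)).
Qed.

Lemma near_proj_cst z (Tz : T *m val z != 0) (O : set PP) : nbhs (projpt Tz) O ->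
  \forall y \near z, forall nz : T *m val y != 0, O (projpt nz).
Proof.
move=> OTz; have := pi_continuous OTz => /nbhs_nonzero_vec[V VTz VO].
have zz : mx_lim qn (nbhs z) (fun y : nzvec R n => val y : vec) (val z).
  by apply: (@cvg_mx_lim _ _ _ (nbhs_filter z)); exact: val_nonzero_continuous.
have Tz' : mx_lim qn (nbhs z) (fun y : nzvec R n => T *m val y) (T *m val z).
  apply: mx_limM; [exact: qn_ring_norm| |exact: zz].
  exact: (mx_lim_cst (qn_ring_norm R)).
have := @mx_lim_cvg _ _ _ (nbhs_filter z) _ _ _ _ Tz'.
move=> /(_ V VTz) FV; apply: (@filterS _ _ (nbhs_filter z) _ _ _ FV) => y Vy nz.
exact: (VO (nonzero_vec nz)).
Qed.

(** The limit map is the one induced by [T]. In the near-covering form of compactness, it suffices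
    to have, around each point, a neighbourhood and a tail of indices that work together; the joint
    limit supplies them. *)
Lemma cvg_unif_off_kernel : (forall z, U (\pi_(projspace R n) z) -> T *m val z != 0) ->
  exists h, forall K : set U, compact K -> cvg_unif_on K f h.
Proof.
move=> TU.
have Trepr (u : U) : T *m val (repr (set_val u)) != 0.
  by apply: TU; rewrite reprK; exact: set_mem (valP u).
pose h u : PP := projpt (Trepr u); exists h => K cK W oW Wd.
have := proj1 (compact_near_coveringP K) cK nat \oo (fun k u => W (f k u, h u)) _.
apply=> u0 _.
have hz z (u : U) (zu : \pi_(projspace R n) z = set_val u) :
    forall nz : T *m val z != 0, h u = projpt nz.
  move=> nz; apply/esym/proj_piP.
  have [a a0 az] : exists2 a : H, a != 0 & val z = rscale (val (repr (set_val u))) a.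
    by apply/proj_piP; rewrite reprK.
  by exists a => //=; rewrite az /rscale mulmxA.
have [[Q1 Q2] /= [Q1h Q2h] OW] : nbhs (h u0, h u0) W.
  by apply: open_nbhs_nbhs; split=> //; exact: Wd.
pose z0 := repr (set_val u0).
have [[Z1 K1] /= [Z1z K1k] ZK] := near_proj_limit Q1h.
have Z2z := near_proj_cst Q2h.
(* One good representative per point is enough, as neither [f] nor [h] depends on the choice;
   [proj_nbhs] turns the condition on representatives into a neighbourhood below. *)
pose Z : set PP := fun p => exists z, [/\ \pi_(projspace R n) z = p,
    Z1 z & forall nz : T *m val z != 0, Q2 (projpt nz)].
have Z12 : nbhs (set_val u0) Z.
  rewrite -[set_val u0]reprK; apply: proj_nbhs.
  by near=> y; exists y; split=> //; near: y.
have U12 : nbhs u0 (set_val @^-1` Z) := initial_continuous Z12.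
exists (set_val @^-1` Z, K1 `&` [set k | t k != 0]) => /=.
  by split; [exact: U12|apply: filterI].
move=> [u k] /= [[z [zu Z1z' Q2z]] [K1k' tk]]; apply: OW; split=> /=.
  rewrite /f -zu (act_realscale (realscale_mul_neq0 (A k) z tk)) //.
  exact: (ZK (z, k)).
have nz : T *m val z != 0 by apply: TU; rewrite zu; exact: set_mem (valP u).
by rewrite (hz z u zu nz).
Unshelve. all: by end_near. Qed.

End UniformConvergence.
End ProjectiveTopology.

(** * Coordinate functions on projective space *)

Section QuaternionNorm.
Variable R : realType.
Local Notation H := (quat R).
Implicit Types p q : H.

Lemma qnorm2M p q : qnorm2 (p * q) = qnorm2 p * qnorm2 q.
Proof. by rewrite /qnorm2 /=; ring. Qed.

Lemma qnorm2_ge0 q : 0 <= qnorm2 q.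
Proof. by rewrite /qnorm2 !addr_ge0 ?sqr_ge0. Qed.

Lemma qnorm2V q : q != 0 -> qnorm2 q^-1 = (qnorm2 q)^-1.
Proof.
move=> q0; have q20 : qnorm2 q != 0 by rewrite qnorm2_eq0.
apply: (mulfI q20); rewrite -qnorm2M divrr ?unitqE // divff //.
by rewrite /qnorm2 /= expr1n expr0n /= !addr0.
Qed.

Lemma qnorm2N q : qnorm2 (- q) = qnorm2 q.
Proof. by rewrite /qnorm2 /= !sqrrN. Qed.

Lemma coord_sqr_le q : [/\ qre q ^+ 2 <= qnorm2 q, qi q ^+ 2 <= qnorm2 q,
  qj q ^+ 2 <= qnorm2 q & qk q ^+ 2 <= qnorm2 q].
Proof.
have := sqr_ge0 (qre q); have := sqr_ge0 (qi q).
have := sqr_ge0 (qj q); have := sqr_ge0 (qk q).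
by rewrite /qnorm2; move: (_ ^+ 2) (_ ^+ 2) (_ ^+ 2) (_ ^+ 2) => a b c d *;
  split; lra.
Qed.

Lemma mx_lim_qnorm2 I (F : set_system I) {FF : Filter F} m n
    (X : I -> 'M[H]_(m, n)) L i j : mx_lim qn F X L ->
  qnorm2 (X x i j) @[x --> F] --> qnorm2 (L i j).
Proof.
move=> XL.
have c (g : H -> R) : (forall q, `|g q| <= qn q) -> {morph g : p q / p - q} ->
    g (X x i j) ^+ 2 @[x --> F] --> g (L i j) ^+ 2.
  move=> gn gB.
  have gX : g (X x i j) @[x --> F] --> g (L i j) by exact: mx_lim_coord XL gn gB.
  exact: (@cvgM _ _ F FF _ _ _ _ gX gX).
by rewrite /qnorm2; apply: cvgD; [apply: cvgD; [apply: cvgD|]|];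
  apply: c => // q; case: (le_qn q).
Qed.

Section Ratio.
Variable n : nat.
Local Notation vec := ('cV[H]_n.+1).
Implicit Types x : vec.

Definition vnorm2 x : R := \sum_j qnorm2 (x j 0).

Lemma vnorm2_gt0 x : x != 0 -> 0 < vnorm2 x.
Proof.
move=> x0; rewrite lt0r sumr_ge0 ?andbT => [|j _]; last exact: qnorm2_ge0.
apply: contra x0; rewrite psumr_eq0 => [/allP x0|j _]; last exact: qnorm2_ge0.
apply/eqP/matrixP => j k; rewrite ord1 mxE; apply/eqP.
by rewrite -qnorm2_eq0; apply: x0; rewrite mem_index_enum.
Qed.

Lemma mx_lim_vnorm2 I (F : set_system I) {FF : Filter F} (X : I -> vec) L :
  mx_lim qn F X L -> vnorm2 (X x) @[x --> F] --> vnorm2 L.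
Proof.
move=> XL; rewrite /vnorm2; elim: (index_enum _) => [|j r IH].
  by rewrite big_nil; under eq_cvg do rewrite big_nil; exact: cvg_cst.
rewrite big_cons; under eq_cvg do rewrite big_cons.
by apply: cvgD => //; exact: mx_lim_qnorm2.
Qed.

Variable i : 'I_n.+1.

(** Invariant under right scaling, so it descends to a continuous real function on projective space
    that tells whether the [i]-th homogeneous coordinate vanishes. *)
Definition coord_ratio x : R := qnorm2 (x i 0) / vnorm2 x.

Lemma coord_ratio_scale x a : a != 0 -> coord_ratio (rscale x a) = coord_ratio x.
Proof.
move=> a0; have qa0 : qnorm2 a != 0 by rewrite qnorm2_eq0.
have -> : coord_ratio (rscale x a) = (qnorm2 (x i 0) * qnorm2 a) / (vnorm2 x * qnorm2 a).
  rewrite /coord_ratio rscaleE qnorm2M; congr (_ / _).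
  by rewrite /vnorm2 mulr_suml; apply: eq_bigr => j _; rewrite rscaleE qnorm2M.
by rewrite -mulf_div divff // mulr1.
Qed.

Lemma mx_lim_coord_ratio I (F : set_system I) {FF : Filter F} (X : I -> vec) L :
  mx_lim qn F X L -> L != 0 -> coord_ratio (X x) @[x --> F] --> coord_ratio L.
Proof.
move=> XL L0; apply: cvgM; first exact: mx_lim_qnorm2.
by apply: cvgV; [rewrite gt_eqF // vnorm2_gt0|exact: mx_lim_vnorm2].
Qed.

Definition proj_ratio (p : projspace R n) : R := coord_ratio (val (repr p)).

Lemma proj_ratio_proj x (x0 : x != 0) : proj_ratio (projpt x0) = coord_ratio x.
Proof.
have [a a0 E] : exists2 a : H, a != 0 &
    val (repr (projpt x0)) = rscale (val (nonzero_vec x0)) a.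
  by apply/proj_piP; rewrite reprK.
by rewrite /proj_ratio E coord_ratio_scale.
Qed.

Lemma proj_ratio_continuous : continuous proj_ratio.
Proof.
apply/quotient_continuous => z.
have -> : proj_ratio \o \pi_(projspace R n) = coord_ratio \o val.
  by apply/funext => y /=; rewrite pi_proj proj_ratio_proj.
apply: (@mx_lim_coord_ratio _ _ (nbhs_filter z)); last exact: nzvec_neq0.
by apply: (@cvg_mx_lim _ _ _ (nbhs_filter z)); exact: val_nonzero_continuous.
Qed.

End Ratio.
End QuaternionNorm.

(** * Failure of normality at points of the kernel *)

Section NonEquicontinuity.
Variables (R : realType) (n : nat).
Local Notation H := (quat R).
Local Notation vec := ('cV[H]_n.+1).
Local Notation PP := (projspace R n).

(** Normality quantifies over compact sets of the type [U], whereas discs are parametrized in [PP];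
    this passes from one to the other. *)
Lemma compact_lift (X : topologicalType) (K : set X) (psi : X -> PP) (U : set PP) :
  continuous psi -> (forall c, K c -> U (psi c)) -> compact K ->
  compact [set u : U | exists2 c, K c & psi c = set_val u].
Proof.
move=> cpsi KU /compact_near_coveringP cK; apply/compact_near_coveringP.
move=> I F P FF Pnear.
pose P' (i : I) c := forall u : U, psi c = set_val u -> P i u.
have cov c : K c -> \forall c' \near c & i \near F, P' i c'.
  move=> Kc; pose u0 : U := exist (fun p => p \in U) (psi c) (mem_set (KU c Kc)).
  have [|[A B] /= [Au0 FB] AB] := Pnear u0; first by exists c.
  case: Au0 => _ [[V oV <-] Vu0 VA].
  exists (psi @^-1` V, B) => /=.
    by split=> //; apply: cpsi; apply: open_nbhs_nbhs; split.
  move=> [c' i] /= [Vc' Bi] u cu; apply: (AB (u, i)); split=> //=.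
  by apply: VA; rewrite /preimage /= -cu.
apply: (@filterS _ F FF _ _ _ (cK I F P' FF cov)) => i H' u [c Kc cu].
exact: H' c Kc u cu.
Qed.

Definition quat_box (e : R) : set H :=
  [set q | [/\ `|qre q| <= e, `|qi q| <= e, `|qj q| <= e & `|qk q| <= e]].

Lemma compact_quat_box e : compact (quat_box e).
Proof.
have -> : quat_box e = @quat_of_coords R @`
    (`[- e, e] `*` `[- e, e] `*` `[- e, e] `*` `[- e, e]).
  apply/seteqP; split=> [q [h1 h2 h3 h4]|_ [[[[a b] c] d] /= + <-]].
    exists (quat_coords q); last exact: quat_coordsK.
    by rewrite /= !in_itv /= -!ler_norml.
  by rewrite !in_itv /= -!ler_norml => -[[[? ?] ?] ?].
apply: continuous_compact.
  apply: continuous_subspaceT => x.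
  have E (g : H -> R) (g' : R * R * R * R -> R) :
      (forall y, g (quat_of_coords y) = g' y) -> g' @ x --> g' x ->
      g (quat_of_coords y) @[y --> x] --> g (quat_of_coords x).
    by move=> gg'; have <- : (fun y => g (quat_of_coords y)) = g' by apply/funext.
  apply: (@quat_cvgP _ _ _ (nbhs_filter x)).
  - apply: (E _ (fun y => y.1.1.1)) => [[[[]]]//|].
    by apply: cvg_comp; [apply: cvg_comp|]; exact: cvg_fst.
  - apply: (E _ (fun y => y.1.1.2)) => [[[[]]]//|].
    by apply: cvg_comp; [apply: cvg_comp; exact: cvg_fst|exact: cvg_snd].
  - apply: (E _ (fun y => y.1.2)) => [[[[]]]//|].
    by apply: cvg_comp; [exact: cvg_fst|exact: cvg_snd].
  - apply: (E _ (fun y => y.2)) => [[[[]]]//|].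
    exact: cvg_snd.
by do 3!(apply: compact_setX; last exact: segment_compact); exact: segment_compact.
Qed.

Lemma quat_box_nbhs (S : set H) : nbhs (0 : H) S -> exists2 e, 0 < e & quat_box e `<=` S.
Proof.
move=> [_ [[B oB <-] B0 BS]].
have /nbhs_ballP[e /= e0 eB] : nbhs (quat_coords (0 : H)) B by apply: open_nbhs_nbhs.
exists (e / 2); first by rewrite divr_gt0.
move=> q [h1 h2 h3 h4]; apply: BS; apply: eB.
have e2 : e / 2 < e by rewrite ltr_pdivrMr // mulr2n mulrDr mulr1 ltrDl.
by split; [split; [split|]|]; rewrite /= /ball /= sub0r normrN; apply: le_lt_trans e2.
Qed.

Lemma mx_lim_scalar I (F : set_system I) {FF : Filter F} (c : I -> H) (c0 : H) :
  c @ F --> c0 -> mx_lim qn F (fun i => (c i)%:M : 'M[H]_1) c0%:M.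
Proof.
move=> cc; apply: cvg_mx_lim; apply: entrywise_cvg => i j.
rewrite !ord1; have -> : (c0%:M : 'M[H]_1) 0 0 = c0 by rewrite mxE eqxx mulr1n.
by under eq_cvg do rewrite mxE eqxx mulr1n.
Qed.

(** Three errors below [k / 6] separate [a] from [k], and they add up to less than [k / 2]. *)
Lemma half_lt_of_close (a b g k : R) : 0 < k ->
  `|a - g| < k / 6 -> `|b - g| < k / 6 -> `|k - b| < k / 6 -> k / 2 < a.
Proof. by rewrite !ltr_distl => ? /andP[? ?] /andP[? ?] /andP[? ?]; lra. Qed.

Section KernelPoint.
Variables (A : nat -> SL R n) (t : nat -> R) (T : 'M[H]_n.+1) (U : set PP).
Hypothesis t_neq0 : \forall k \near \oo, t k != 0.
Hypothesis At : mx_lim qn \oo (fun k => realscale (t k) (val (A k))) T.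
Hypothesis oU : open U.

Let f k (u : U) : PP := PSL_act (\pi_(PSL R n) (A k)) (set_val u).
Let B k := realscale (t k) (val (A k)).

Variables (z : nzvec R n) (v : vec).
Hypothesis Uz : U (\pi_(projspace R n) z).
Hypothesis Tz0 : T *m val z = 0.
Hypothesis Tv0 : T *m v != 0.

Let zv_neq0 c : val z + rscale v c != 0.
Proof.
apply/eqP => zv0; have Tvc : rscale (T *m v) c = 0.
  by have := congr1 (mulmx T) zv0; rewrite mulmxDr Tz0 add0r mulmx0 /rscale mulmxA.
have c0 : c = 0.
  by apply/eqP; apply: contraT => c0; have := rscale_neq0 Tv0 c0; rewrite Tvc eqxx.
have := nzvec_neq0 z; move: zv0; rewrite c0 /rscale raddf0 mulmx0 addr0 => ->.
by rewrite eqxx.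
Qed.

Let zv c := nonzero_vec (zv_neq0 c).
(** Points of the projective line through [z] and [v]: [T] kills the vector at the centre [c = 0]
    and sends all the others to multiples of [T *m v]. *)
Let psi c : PP := \pi_(projspace R n) (zv c).

Let psi_continuous : continuous psi.
Proof.
move=> c; apply: (@cvg_comp _ _ _ zv (fun y => \pi_(projspace R n) y) _ (nbhs (zv c)));
  last exact: pi_continuous.
apply: (@cvg_nonzero_vec _ _ _ _ (nbhs_filter c)).
have cc : mx_lim qn (nbhs c) (fun c' => val z + v *m c'%:M) (val z + v *m c%:M).
  apply: (mx_limD (qn_ring_norm R)); first exact: (mx_lim_cst (qn_ring_norm R)).
  apply: (mx_limM (qn_ring_norm R)); first exact: (mx_lim_cst (qn_ring_norm R)).
  by apply: mx_lim_scalar; exact: cvg_id.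
exact: (@mx_lim_cvg _ _ _ (nbhs_filter c) _ _ _ _ cc).
Qed.

Let psi0 : psi 0 = \pi_(projspace R n) z.
Proof.
congr (\pi_(projspace R n) _); apply: val_inj => /=.
by rewrite /rscale raddf0 mulmx0 addr0.
Qed.

Let box_in_U : exists2 e, 0 < e & forall c, quat_box e c -> U (psi c).
Proof.
apply: quat_box_nbhs; apply: psi_continuous; rewrite psi0.
by apply: open_nbhs_nbhs; split.
Qed.

Variable i : 'I_n.+1.
Hypothesis Tvi : (T *m v) i 0 != 0.

Let F k c := coord_ratio i (B k *m (val z + rscale v c)).
Let kappa := coord_ratio i (T *m v).

Let kappa_gt0 : 0 < kappa.
Proof.
rewrite divr_gt0 ?vnorm2_gt0 // lt0r qnorm2_ge0 andbT qnorm2_eq0; exact: Tvi.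
Qed.

Let F_limit c : c != 0 -> F k c @[k --> \oo] --> kappa.
Proof.
move=> c0; have <- : coord_ratio i (T *m (val z + rscale v c)) = kappa.
  by rewrite mulmxDr Tz0 add0r /rscale mulmxA coord_ratio_scale.
apply: mx_lim_coord_ratio.
  apply: (mx_limM (qn_ring_norm R)); [exact: At|exact: (mx_lim_cst (qn_ring_norm R))].
by rewrite mulmxDr Tz0 add0r /rscale mulmxA; exact: rscale_neq0.
Qed.

Let F_act k c (u : U) : t k != 0 -> psi c = set_val u ->
  proj_ratio i (f k u) = F k c.
Proof.
move=> tk cu; rewrite /f -cu (act_realscale (realscale_mul_neq0 (A k) (zv c) tk)) //.
exact: proj_ratio_proj.
Qed.

(** Nothing is known about [h], but off the centre each [F k c] tends to [kappa], so [h] has ratio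
    close to [kappa] there; uniformity carries this back to one index [k] for all [c] at once. *)
Let uniform_lower_bound h : (forall K : set U, compact K -> cvg_unif_on K f h) ->
  exists2 e, 0 < e & \forall k \near \oo, forall c, quat_box e c -> c != 0 ->
    kappa / 2 < F k c.
Proof.
move=> uh; have [e e0 eU] := box_in_U; exists e => //.
have cK := compact_lift psi_continuous eU (compact_quat_box (e := e)).
pose W : set (PP * PP) :=
  [set p | `|proj_ratio i p.1 - proj_ratio i p.2| < kappa / 6].
have oW : open W.
  have cW : continuous (fun p : PP * PP => `|proj_ratio i p.1 - proj_ratio i p.2|).
    move=> p; apply: cvg_norm; apply: cvgB.
      by apply: cvg_comp; [exact: cvg_fst|exact: proj_ratio_continuous].
    by apply: cvg_comp; [exact: cvg_snd|exact: proj_ratio_continuous].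
  exact: (open_comp (fun p _ => cW p) (@open_lt R (kappa / 6))).
have Wd p : W (p, p) by rewrite /W /= subrr normr0 divr_gt0.
have := uh _ cK W oW Wd => unif.
near=> k => c ec c0.
have tk : t k != 0 by near: k.
pose u : U := exist (fun p => p \in U) (psi c) (mem_set (eU c ec)).
have Ku : [set u : U | exists2 c, quat_box e c & psi c = set_val u] u by exists c.
have Wk : W (f k u, h u) by move: (u) Ku; near: k.
(* [k'] may depend on [c], since it only serves to locate [h u]; the index [k] was fixed before
   [c]. *)
have [k' [Wk' tk' Fk']] : exists k', [/\ W (f k' u, h u), t k' != 0 &
    `|kappa - F k' c| < kappa / 6].
  have k60 : 0 < kappa / 6 by rewrite divr_gt0.
  have /cvgrPdist_lt/(_ _ k60) Fk := F_limit c0.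
  near \oo => k'; exists k'; split; last by near: k'.
    by move: (u) Ku; near: k'.
  by near: k'.
have Wkc : `|F k c - proj_ratio i (h u)| < kappa / 6 by rewrite -(F_act tk (u := u)).
have Wk'c : `|F k' c - proj_ratio i (h u)| < kappa / 6 by rewrite -(F_act tk' (u := u)).
exact: half_lt_of_close kappa_gt0 Wkc Wk'c Fk'.
Unshelve. all: by end_near. Qed.

Let F_entry k c : (B k *m (val z + rscale v c)) i 0 =
  (B k *m val z) i 0 + (B k *m v) i 0 * c.
Proof. by rewrite mulmxDr mxE /rscale mulmxA -/(rscale _ _) rscaleE. Qed.

Let F_eq0 k c : (B k *m val z) i 0 + (B k *m v) i 0 * c = 0 -> F k c = 0.
Proof.
move=> E; rewrite /F /coord_ratio F_entry E.
by rewrite (eqP (_ : qnorm2 0 == 0)) ?mul0r // qnorm2_eq0.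
Qed.

Let F_real_limit k e : t k != 0 -> (B k *m val z) i 0 = 0 ->
  F k (quatC (e * harmonic j)%:C) @[j --> \oo] --> (0 : R).
Proof.
move=> tk Bz0; have <- : coord_ratio i (B k *m (val z + v *m 0%:M)) = 0.
  by rewrite -/(rscale v 0); apply: F_eq0; rewrite Bz0 mulr0 addr0.
apply: mx_lim_coord_ratio; last first.
  by rewrite raddf0 mulmx0 addr0; exact: realscale_mul_neq0.
apply: (mx_limM (qn_ring_norm R)); first exact: (mx_lim_cst (qn_ring_norm R)).
apply: (mx_limD (qn_ring_norm R)); first exact: (mx_lim_cst (qn_ring_norm R)).
apply: (mx_limM (qn_ring_norm R)); first exact: (mx_lim_cst (qn_ring_norm R)).
apply: mx_lim_scalar; apply: quat_cvgP => /=; try exact: cvg_cst.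
by have := harmonic_sub_cvg0 e 0; under eq_cvg do rewrite subn0.
Qed.

(* For fixed [c != 0] the points [A k (z + v c)] tend to [T v], whose [i]-th
   coordinate is nonzero; but that coordinate vanishes at
   [c = - ((A k v)_i)^-1 (A k z)_i], which tends to 0. *)
Lemma kernel_point_not_uniform h :
  (forall K : set U, compact K -> cvg_unif_on K f h) -> False.
Proof.
move=> uh; have [e e0 low] := uniform_lower_bound uh.
pose a k := (B k *m val z) i 0; pose b k := (B k *m v) i 0.
pose beta := qnorm2 ((T *m v) i 0).
have beta0 : 0 < beta by rewrite lt0r qnorm2_ge0 andbT qnorm2_eq0.
have lim_b : qnorm2 (b k) @[k --> \oo] --> beta.
  apply: mx_lim_qnorm2.
  by apply: (mx_limM (qn_ring_norm R)); [exact: At|exact: (mx_lim_cst (qn_ring_norm R))].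
have lim_a : qnorm2 (a k) @[k --> \oo] --> (0 : R).
  have <- : qnorm2 ((T *m val z) i 0) = 0.
    by apply/eqP; rewrite qnorm2_eq0 Tz0 mxE.
  apply: mx_lim_qnorm2.
  by apply: (mx_limM (qn_ring_norm R)); [exact: At|exact: (mx_lim_cst (qn_ring_norm R))].
have b2 : 0 < beta / 2 by rewrite divr_gt0.
(* Chosen so that [qnorm2 (a k) / qnorm2 (b k)] falls below [e ^+ 2], which puts the zero [c] in the
   box. *)
have a2 : 0 < e ^+ 2 * (beta / 2) by rewrite mulr_gt0 // exprn_gt0.
move/cvgrPdist_lt/(_ _ b2): lim_b => near_b.
move/cvgrPdist_lt/(_ _ a2): lim_a => near_a.
have [k [lowk tk bk ak]] : exists k, [/\ forall c, quat_box e c -> c != 0 ->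
    kappa / 2 < F k c, t k != 0, `|beta - qnorm2 (b k)| < beta / 2
    & `|0 - qnorm2 (a k)| < e ^+ 2 * (beta / 2)].
  by near \oo => k; exists k; split; near: k.
have bk2 : beta / 2 < qnorm2 (b k).
  by move: bk; rewrite ltr_distlC; move: (qnorm2 _) => x /andP[]; lra.
have ak2 : qnorm2 (a k) < e ^+ 2 * (beta / 2).
  by move: ak; rewrite sub0r normrN ger0_norm // qnorm2_ge0.
have bn0 : b k != 0 by rewrite -qnorm2_eq0 gt_eqF // (lt_trans b2).
pose c := - ((b k)^-1 * a k).
have qc : qnorm2 c <= e ^+ 2.
  rewrite /c qnorm2N qnorm2M qnorm2V // mulrC ler_pdivrMr ?(lt_trans b2) //.
  apply: ltW; apply: lt_trans ak2 _; by rewrite ltr_pM2l // exprn_gt0.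
have box : quat_box e c.
  have [h1 h2 h3 h4] := coord_sqr_le c.
  have sq x : x ^+ 2 <= qnorm2 c -> `|x| <= e.
    move=> xc; rewrite -(ler_pXn2r (ltn0Sn 1)) ?nnegrE ?(ltW e0) //.
    by rewrite real_normK ?num_real //; exact: le_trans qc.
  by split; exact: sq.
(* The lower bound excludes [c = 0]. If the zero lies exactly there, small nonzero real values of
   [c] tending to 0 contradict the bound by continuity. *)
have [c0|c0] := eqVneq c 0; last first.
  have := lowk c box c0; rewrite F_eq0; last first.
    by rewrite -/(a k) -/(b k) /c mulrN mulrA divrr ?unitqE // mul1r subrr.
  by rewrite ltNge ltW // divr_gt0.
have ak0 : a k = 0.
  rewrite -[a k]mul1r -(@divrr _ (b k)) ?unitqE // -mulrA -[_ * a k]opprK.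
  by rewrite -/c c0 oppr0 mulr0.
suff H' : kappa / 2 <= 0 by move: H'; rewrite leNgt divr_gt0.
apply: (cvgr_to_ge (F_real_limit e tk ak0)).
near=> j; apply: ltW; apply: lowk.
  split; rewrite /= ?normr0 ?(ltW e0) // ger0_norm; last first.
    by rewrite mulr_ge0 ?(ltW e0) // harmonic_ge0.
  by apply: ler_piMr; rewrite ?(ltW e0) // /harmonic invf_le1 ?ler1n ?ltr0n.
apply: quatC_real_neq0; rewrite mulf_neq0 ?gt_eqF //; exact: harmonic_gt0.
Unshelve. all: by end_near. Qed.

End KernelPoint.
End NonEquicontinuity.

(** * The complement of the equicontinuity set *)

Lemma subsequence_of_infinite (P : nat -> Prop) :
  (forall N, exists k, (N <= k)%N /\ P k) ->
  exists s, {homo s : i j / (i < j)%N} /\ forall k, P (s k).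
Proof.
move=> /choice[f fP]; pose s := fix s k := if k is k'.+1 then f (s k').+1 else f 0%N.
exists s; split=> [|[|k]]; [|by case: (fP 0%N)|by case: (fP (s k).+1)].
apply: homo_ltn => [i j k|k]; first exact: ltn_trans.
by case: (fP (s k).+1).
Qed.

(** [b] is the sign and [m] the exponent of a power of gamma. Either one power recurs infinitely
    often, and a constant subsequence converges trivially, or each occurs finitely often; then one
    sign recurs and its exponents tend to infinity. *)
Lemma constant_or_divergent_subsequence (b : nat -> bool) (m : nat -> nat) :
  exists s, {homo s : i j / (i < j)%N} /\
    ((exists c, forall k, (b (s k), m (s k)) = c) \/
     (exists c, (forall k, b (s k) = c) /\ m \o s @ \oo --> \oo)).
Proof.
have [[c infc]|finc] := pselect (exists c, forall N, exists k, (N <= k)%N /\ (b k, m k) = c).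
  by have [s [sh sc]] := subsequence_of_infinite infc; exists s; split=> //; left; exists c.
have fin c : exists N, forall k, (N <= k)%N -> (b k, m k) <> c.
  apply: contrapT => nfin; apply: finc; exists c => N.
  apply: contrapT => nk; apply: nfin; exists N => k Nk kc.
  by apply: nk; exists k.
have [c infc] : exists c, forall N, exists k, (N <= k)%N /\ b k = c.
  apply: contrapT => nb.
  have nbc c : exists N, forall k, (N <= k)%N -> b k <> c.
    apply: contrapT => nN; apply: nb; exists c => N.
    by apply: contrapT => nk; apply: nN; exists N => k Nk kc; apply: nk; exists k.
  have [N1 H1] := nbc true; have [N2 H2] := nbc false.
  have := H1 (maxn N1 N2) (leq_maxl _ _); have := H2 (maxn N1 N2) (leq_maxr _ _).
  by case: (b _).
have [s [sh sc]] := subsequence_of_infinite infc.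
exists s; split=> //; right; exists c; split=> //.
have large M : exists N, forall k, (N <= k)%N -> (M <= m (s k))%N.
  elim: M => [|M [N HN]]; first by exists 0%N.
  have [N' HN'] := fin (c, M); exists (maxn N N') => k; rewrite geq_max => /andP[Nk N'k].
  rewrite ltn_neqAle HN // andbT; apply/eqP => Mm.
  by apply: (HN' (s k)); [exact: leq_trans N'k (homo_leq sh k)|rewrite sc -Mm].
move=> Q [M _ MQ]; have [N HN] := large M.
exists N; first exact: I.
by move=> k Nk; apply: MQ; exact: HN.
Qed.

Section EquicontinuityComplement.
Variables (R : realType) (n : nat).
Local Notation H := (quat R).
Local Notation vec := ('cV[H]_n.+1).
Local Notation PP := (projspace R n).

Definition proj_set (V : set vec) : set PP :=
  [set \pi_(projspace R n) z | z in [set z : nzvec R n | V (val z)]].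

Lemma proj_setP (V : set vec) (z : nzvec R n) : right_subspace V ->
  proj_set V (\pi_(projspace R n) z) <-> V (val z).
Proof.
case=> _ _ VZ; split=> [[w Vw /proj_piP[a a0 wz]]|Vz]; last by exists z.
have -> : val z = rscale (val w) a^-1.
  by rewrite wz rscaleA divrr ?unitqE // rscale1.
exact: VZ.
Qed.

Lemma kernel_right_subspace (T : 'M[H]_n.+1) : right_subspace [set v : vec | T *m v = 0].
Proof.
split=> [|u v|v a] /=; first by rewrite mulmx0.
  by rewrite mulmxDr => -> ->; rewrite addr0.
by rewrite /rscale mulmxA => ->; rewrite mul0mx.
Qed.

Lemma open_off_kernel (T : 'M[H]_n.+1) :
  open (~` proj_set [set v : vec | T *m v = 0]).
Proof.
rewrite /open /= /quotient_open openE => z /= Tz.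
have Tz0 : T *m val z != 0.
  by apply/eqP => Tz0; apply: Tz; apply/proj_setP => //; exact: kernel_right_subspace.
have zz : mx_lim qn (nbhs z) (fun y : nzvec R n => val y : vec) (val z).
  by apply: (@cvg_mx_lim _ _ _ (nbhs_filter z)); exact: val_nonzero_continuous.
have Tz' : mx_lim qn (nbhs z) (fun y : nzvec R n => T *m val y) (T *m val z).
  apply: mx_limM; [exact: qn_ring_norm| |exact: zz].
  exact: (mx_lim_cst (qn_ring_norm R)).
have pos : 0 < mxn qn (T *m val z).
  rewrite lt0r (mxn_ge0 (qn_ring_norm R)) andbT; apply: contra Tz0 => /eqP.
  by move/(mxn_eq0 (qn_ring_norm R)) => ->.
have near_z := @mx_lim_lt _ _ _ (qn_ring_norm R) _ _ (nbhs_filter z) _ _ _ _ Tz' _ pos.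
rewrite /interior; apply: (@filterS _ _ (nbhs_filter z) _ _ _ near_z) => y lty.
move/(proj1 (proj_setP _ (kernel_right_subspace T))) => /= Ty.
by move: lty; rewrite Ty sub0r (mxnN (qn_ring_norm R)) ltxx.
Qed.

Lemma SL_expE (A : SL R n) m : val (A ^+ m)%g = val A ^+ m.
Proof. by elim: m => // m IH; rewrite expgS exprS -mulmxE -IH. Qed.

Lemma PSL_expE (A : SL R n) m :
  (\pi_(PSL R n) A ^+ m)%g = \pi_(PSL R n) (A ^+ m)%g.
Proof. by elim: m => // m IH; rewrite !expgS IH; exact: PSL_mul_pi. Qed.

Lemma cyclic_subgroupP (A : SL R n) g : cyclic_subgroup (\pi_(PSL R n) A) g <->
  exists b m, g = \pi_(PSL R n) ((if b then A else A^-1) ^+ m)%g.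
Proof.
have E m : (\pi_(PSL R n) A ^- m)%g = \pi_(PSL R n) (A^-1 ^+ m)%g.
  rewrite -expVgn -PSL_expE; congr (_ ^+ _)%g; exact: PSL_inv_pi.
split=> [[m [->|->]]|[b [m ->]]].
- by exists true, m; rewrite PSL_expE.
- by exists false, m; rewrite E.
- by exists m; case: b; [left; rewrite PSL_expE|right; rewrite E].
Qed.

Section Cyclic.
Variable A : SL R n.
Let B (b : bool) : SL R n := if b then A else (A^-1)%g.
Variables (s : seq R[i]) (lam : bool -> R[i] -> R[i]).
Variables (E : R[i] -> 'M[R[i]]_((n + n.+1).+1)) (K : nat) (r : bool -> R) (d : bool -> nat).
Hypothesis sp : forall b, spectral (Phi (val (B b))) s (lam b) E K.
Hypothesis dom : forall b, dominant (Phi (val (B b))) s (lam b) E (r b) (d b).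

Let slow b := slow_vectors (val (B b)) s (lam b) E (r b) (d b).

(** [slow b] is defined by complex equations; as the kernel of a quaternionic limit it is visibly a
    right subspace, and its projectivization is closed. *)
Lemma slow_vectors_kernel b : exists T : 'M[H]_n.+1, slow b = [set v : vec | T *m v = 0].
Proof.
have [f [T [_ _ kerT]]] := normalized_subsequence (sp b) (dom b) (@cvg_id _ \oo).
by exists T; apply/seteqP; split=> v /kerT.
Qed.

Lemma slow_right_subspace b : right_subspace (slow b).
Proof. by have [T ->] := slow_vectors_kernel b; exact: kernel_right_subspace. Qed.

Let Gamma := cyclic_subgroup (\pi_(PSL R n) A).

Let powers_near_neq0 b (p : nat -> nat) : p @ \oo --> \oo ->
  \forall k \near \oo, (growth (r b) (d b) (p k))^-1 != 0.
Proof.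
move=> poo; have dp : \forall k \near \oo, (d b <= p k)%N := poo _ (nbhs_infty_ge (d b)).
by near=> k; rewrite invr_eq0 gt_eqF // (growth_gt0 (dom b)) //; near: k.
Unshelve. all: by end_near. Qed.

Lemma off_slow_equicontinuous p : (forall b, ~ proj_set (slow b) p) ->
  equicontinuity_set Gamma p.
Proof.
move=> np; exists (~` proj_set (slow true) `&` ~` proj_set (slow false)).
split; first by apply: openI; [have [T ->] := slow_vectors_kernel true|
  have [T ->] := slow_vectors_kernel false]; exact: open_off_kernel.
  by split; exact: np.
set U := _ `&` _ => f fG.
have oU : open U.
  by apply: openI; [have [T ->] := slow_vectors_kernel true|
    have [T ->] := slow_vectors_kernel false]; exact: open_off_kernel.
have /choice[b /choice[m fE]] : forall k, exists b m,
    f k = PSL_act (\pi_(PSL R n) (B b ^+ m)%g) \o set_val.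
  by move=> k; have [g /cyclic_subgroupP[b [m ->]] <-] := fG k; exists b, m.
have [s' [sh [[[c m0] cst]|[c [bc moo]]]]] := constant_or_divergent_subsequence b m.
  exists s', (PSL_act (\pi_(PSL R n) (B c ^+ m0)%g) \o set_val); split=> //.
  move=> Q cQ W oW Wd; near=> k => x Qx /=.
  by rewrite fE; have [-> ->] := cst k; exact: Wd.
have [f' [T [fh fT kerT]]] := normalized_subsequence (sp c) (dom c) moo.
pose q k := m (s' (f' k)).
have qoo : q @ \oo --> \oo by apply: cvg_comp moo; exact: homo_cvg_oo.
have TU z : U (\pi_(projspace R n) z) -> T *m val z != 0.
  move=> Uz; apply/eqP => /kerT Kz.
  have : proj_set (slow c) (\pi_(projspace R n) z) by exists z.
  by case: (c) Uz => -[].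
have At : mx_lim qn \oo
    (fun k => realscale (growth (r c) (d c) (q k))^-1 (val (B c ^+ q k)%g)) T.
  by under eq_fun do rewrite SL_expE.
have [h uh] := cvg_unif_off_kernel (powers_near_neq0 c qoo) At TU.
exists (s' \o f'), h; split=> [i j ij|Q cQ W oW Wd]; first by apply: sh; exact: fh.
have := uh Q cQ W oW Wd; congr (\forall k \near \oo, _); apply/funext => k.
by rewrite /= fE bc.
Unshelve. all: by end_near. Qed.

(** Powers of one sign suffice. Whatever subsequence normality selects, a further one has a
    normalized limit with kernel [slow b], and it inherits the uniform convergence that
    [kernel_point_not_uniform] refutes. *)
Lemma slow_not_equicontinuous b p : proj_set (slow b) p -> ~ equicontinuity_set Gamma p.
Proof.
move=> [z slz <-] [U [oU Uz normU]].
pose f k : U -> PP := PSL_act (\pi_(PSL R n) (B b ^+ k)%g) \o set_val.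
have [|s' [h [sh uh]]] := normU f.
  by move=> k; eexists; last reflexivity; apply/cyclic_subgroupP; exists b, k.
have soo := homo_cvg_oo sh.
have [f' [T [fh fT kerT]]] := normalized_subsequence (sp b) (dom b) soo.
pose q k := s' (f' k).
have qoo : q @ \oo --> \oo by apply: cvg_comp soo; exact: homo_cvg_oo.
have At : mx_lim qn \oo
    (fun k => realscale (growth (r b) (d b) (q k))^-1 (val (B b ^+ q k)%g)) T.
  by under eq_fun do rewrite SL_expE.
have [v /kerT Tv0] := slow_vectors_proper (dom b).
have /cV0Pn[i Tvi] : T *m v != 0 by apply/eqP.
have Tz0 : T *m val z = 0 by apply/kerT.
apply: (kernel_point_not_uniform (powers_near_neq0 b qoo) At oU Uz Tz0 _ Tvi (h := h)).
  by apply/eqP.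
move=> Q cQ W oW Wd.
exact: (homo_cvg_oo fh) _ (uh Q cQ W oW Wd).
Qed.

Lemma equicontinuity_complement :
  ~` equicontinuity_set Gamma = proj_set (slow true) `|` proj_set (slow false).
Proof.
apply/seteqP; split=> [p np|p [pK|pK]].
- apply: contrapT => nK; apply: np; apply: off_slow_equicontinuous => b pK.
  by apply: nK; case: b pK; [left|right].
- exact: slow_not_equicontinuous pK.
- exact: slow_not_equicontinuous pK.
Qed.

End Cyclic.
End EquicontinuityComplement.

(** * Classification *)

Section DominantData.
Variables (R : realType) (N : nat).
Local Notation C := R[i].
Local Notation normc := (@ComplexField.Normc.normc R).
Implicit Types (X : 'M[C]_N.+1) (s : seq C) (E : C -> 'M[C]_N.+1) (lam : C -> C).

Lemma seq_max_norm s lam : s != [::] ->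
  exists2 l0, l0 \in s & forall l, l \in s -> normc (lam l) <= normc (lam l0).
Proof.
elim: s => // a s IH _; have [->|/IH[l0 l0s maxl]] := eqVneq s [::].
  by exists a; rewrite ?inE // => l; rewrite inE => /eqP->.
have [al|la] := leP (normc (lam a)) (normc (lam l0)).
  exists l0; first by rewrite inE l0s orbT.
  by move=> l; rewrite inE => /orP[/eqP->//|/maxl].
exists a; first by rewrite inE eqxx.
move=> l; rewrite inE => /orP[/eqP->//|/maxl h]; exact: le_trans h (ltW la).
Qed.

Lemma dominant_exists X s lam E K : spectral X s lam E K -> s != [::] ->
  (forall l, l \in s -> E l != 0) -> (forall l, l \in s -> lam l != 0) ->
  exists r d, dominant X s lam E r d.
Proof.
move=> sp s0 E0 lam0; have [us sE EM EK EE] := sp.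
have [l0 l0s maxl] := seq_max_norm lam s0.
pose r := normc (lam l0).
pose P d := `[< exists l, [/\ l \in s, normc (lam l) = r &
  (X - (lam l)%:M) ^+ d * E l <> 0] >].
have P0 : exists d, P d.
  exists 0%N; apply/asboolP; exists l0; split=> //.
  by rewrite expr0 mul1r; apply/eqP; exact: E0.
have PK d : P d -> (d <= K)%N.
  move=> /asboolP[l [ls _ H]]; rewrite leqNgt; apply/negP => Kd; apply: H.
  by rewrite -(subnK (ltnW Kd)) exprD -mulrA EK // mulr0.
case: (ex_maxnP P0 PK) => d /asboolP[l [ls lr Xd]] maxd.
exists r, d; split=> //.
- rewrite lt0r (normc_ge0 (lam l0)) andbT; apply: contra (lam0 l0 l0s) => /eqP.
  by move/ComplexField.Normc.eq0_normc => ->.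
- move=> l' l's l'r; apply: contrapT => H.
  suff /maxd : P d.+1 by rewrite ltnn.
  by apply/asboolP; exists l'.
- by exists l.
Qed.

Lemma nonzero_column (Y : 'M[C]_N.+1) : Y <> 0 -> exists j, Y *m delta_mx j 0 != 0 :> 'cV_N.+1.
Proof.
move=> Y0; apply: contrapT => nj; apply: Y0; apply/matrixP => i j.
have : Y *m delta_mx j 0 = 0 :> 'cV_N.+1.
  by apply/eqP; apply: contrapT => /negP H; apply: nj; exists j.
by rewrite -colE => /matrixP/(_ i 0); rewrite !mxE.
Qed.

(** Take a vector in the image of [E l] for an [l] dominant for [X]. Since [l] is not of extreme
    modulus for [X'], each condition for [X'] contains some [E k] with [k != l], which kills it. *)
Lemma dominant_component_vector X X' s lam lam' E K r r' d d' :
  spectral X s lam E K -> dominant X s lam E r d ->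
  (forall l, l \in s -> normc (lam l) = r -> normc (lam' l) <> r') ->
  exists w : 'cV[C]_N.+1,
    (exists l, [/\ l \in s, normc (lam l) = r & ((X - (lam l)%:M) ^+ d * E l) *m w <> 0]) /\
    (forall l, l \in s -> normc (lam' l) = r' ->
       ((X' - (lam' l)%:M) ^+ d' * E l) *m w = 0).
Proof.
move=> sp [_ _ _ [l [ls lr Xd]]] rr'; have [_ _ _ _ EE] := sp.
have [j Xj] := nonzero_column Xd.
exists (E l *m delta_mx j 0); split.
  exists l; split=> //; rewrite mulmxA mulmxE -mulrA (spectral_idem sp ls); exact/eqP.
move=> k ks kr'; rewrite mulmxA mulmxE -mulrA EE ?mulr0 ?mul0mx //.
by apply/eqP => kl; apply: (rr' l ls lr); rewrite -kl.
Qed.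

(** An eigenvalue of largest modulus for both [M] and its inverse has both the largest and the
    smallest modulus, which makes all moduli equal. *)
Lemma dominant_norm_bounds M M' s E r r' d d' l1 l2 :
  dominant M s id E r d -> dominant M' s (fun l => l^-1) E r' d' ->
  (forall l, l \in s -> l != 0) -> l1 \in s -> l2 \in s -> normc l1 != normc l2 ->
  forall l, l \in s -> normc l = r -> normc l^-1 <> r'.
Proof.
move=> [_ maxr _ _] [_ maxr' _ _] s0 l1s l2s l12 l ls lr lr'.
have pos k : k \in s -> 0 < normc k.
  move=> ks; rewrite lt0r normc_ge0 andbT; apply: contra (s0 k ks) => /eqP.
  by move/ComplexField.Normc.eq0_normc => ->.
suff eql k : k \in s -> normc k = r by move: l12; rewrite !eql ?eqxx.
move=> ks; apply/eqP; rewrite eq_le maxr //= -lr.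
have := maxr' k ks; rewrite -lr' !ComplexField.Normc.normcV.
by rewrite lef_pV2 ?posrE ?pos.
Qed.

(** Inversion preserves unit moduli, and by [inverse_shift_eq0] it preserves the nilpotency orders,
    so the same [r] and [d] serve the inverse. *)
Lemma dominant_inverse M M' s E r d : M * M' = 1 -> M' * M = 1 ->
  (forall l, l \in s -> l != 0) -> (forall l, l \in s -> normc l = 1) ->
  dominant M s id E r d -> r = 1 /\ dominant M' s (fun l => l^-1) E r d.
Proof.
move=> MM' M'M s0 u1 [r0 maxr top [l [ls lr Md]]].
have r1 : r = 1 by rewrite -lr; exact: u1.
have v1 k : k \in s -> normc k^-1 = 1.
  by move=> ks; rewrite ComplexField.Normc.normcV u1 // invr1.
rewrite r1 in lr top *; split=> //; split=> //.
- by move=> k ks; rewrite v1.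
- move=> k ks _; apply/(inverse_shift_eq0 d.+1 (E k) MM' M'M (s0 k ks)).
  by apply: top => //; exact: u1.
- exists l; split; [exact: ls|exact: v1|].
  by move/(inverse_shift_eq0 d (E l) MM' M'M (s0 l ls)).
Qed.

End DominantData.

Section Classification.
Variables (R : realType) (n : nat).
Local Notation C := R[i].
Local Notation H := (quat R).
Local Notation vec := ('cV[H]_n.+1).
Local Notation normc := (@ComplexField.Normc.normc R).
Local Notation cmat := ('M[C]_((n + n.+1).+1)).

Lemma q2c_neq0 (x : vec) : x != 0 -> q2c x != 0.
Proof. by rewrite q2c_eq0. Qed.

Lemma c2q_neq0 (w : 'cV[C]_(n.+1 + n.+1)) : w != 0 -> c2q w != 0.
Proof. by rewrite c2q_eq0. Qed.

Lemma qmodM (p q : H) : qmod (p * q) = qmod p * qmod q.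
Proof. by rewrite /qmod qnorm2M sqrtrM // qnorm2_ge0. Qed.

Lemma qmod_quatC (c : C) : qmod (quatC c) = normc c.
Proof. by case: c => a b; rewrite /qmod /qnorm2 /= !expr0n /= !addr0. Qed.

Lemma qmod_similar (l m : H) : similar_quat l m -> qmod m = qmod l.
Proof.
case=> u u0 ->; rewrite !qmodM mulrAC -qmodM mulVr ?unitqE //.
by rewrite /qmod /qnorm2 /= expr1n expr0n /= !addr0 sqrtr1 mul1r.
Qed.

Lemma unit_eigenclassesP (g : PSL R n) :
  unit_eigenclasses g <-> forall l, PSL_eigenvalue g l -> qmod l = 1.
Proof.
split=> ug l lg; first by have [m /qmod_similar <-] := ug l lg.
exists l; last exact: ug.
by exists 1; rewrite ?oner_eq0 // invr1 mul1r mulr1.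
Qed.

Lemma PSL_eigenvalue_modulus (A : SL R n) l : PSL_eigenvalue (\pi_(PSL R n) A) l ->
  exists2 l', right_eigenvalue (val A) l' & qmod l' = qmod l.
Proof.
case=> B BA [v v0 Bv]; exists (if B == A then l else - l); last first.
  by case: ifP => // _; rewrite /qmod qnorm2N.
exists v => //; case: eqP => [<- //|BnA].
move/PSL_piP: BA => [//|BE]; move: Bv; rewrite BE /= mulNmx => Bv.
have -> : val A *m v = - rscale v l by rewrite -Bv opprK.
by apply/matrixP => i j; rewrite ord1 mxE !rscaleE mulrN.
Qed.

(* [l] is a root of the real polynomial X^2 - 2 Re(l) X + |l|^2, whose complex
   roots both have modulus |l|. *)
Lemma right_eigenvalue_complex (A : 'M[H]_n.+1) l : right_eigenvalue A l ->
  exists m (w : 'cV[C]_((n + n.+1).+1)),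
    [/\ w != 0, (Phi A : cmat) *m w = m *: w & normc m = qmod l].
Proof.
case=> v v0 Av.
pose t := Num.sqrt (qi l ^+ 2 + qj l ^+ 2 + qk l ^+ 2).
have tt : t ^+ 2 = qi l ^+ 2 + qj l ^+ 2 + qk l ^+ 2.
  by rewrite sqr_sqrtr // !addr_ge0 ?sqr_ge0.
pose m1 : C := qre l +i* t; pose m2 : C := qre l +i* (- t).
have nm1 : normc m1 = qmod l by rewrite /= /qmod /qnorm2 tt !addrA.
have nm2 : normc m2 = qmod l by rewrite /= /qmod /qnorm2 sqrrN tt !addrA.
pose M : cmat := Phi A; pose w0 : 'cV[C]_((n + n.+1).+1) := q2c v.
have w00 : w0 != 0 by exact: q2c_neq0.
(* [m1 + m2] and [m1 * m2] are real, so [l * (l - m1) = (l - m1) * m2]: [u] is an eigenvector for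
   [m2] unless it is 0, in which case [v] is one for [m1]. *)
pose u : vec := rscale v (l - quatC m1).
have Ar a : A *m rscale v a = rscale v (l * a).
  by rewrite -rscaleA -Av /rscale mulmxA.
have [u0|u0] := eqVneq u 0; last first.
  exists m2, (q2c u); split=> //; first exact: q2c_neq0.
  rewrite -[LHS]/(Phi A *m q2c u) -[RHS]/(m2 *: q2c u) -q2c_mul -q2c_scale rscaleA Ar.
  congr (q2c (rscale v _)); apply: quatP => /=; move: tt; rewrite !expr2 => tt; lra.
exists m1, w0; split=> //.
rewrite -[LHS]/(Phi A *m q2c v) -[RHS]/(m1 *: q2c v) -q2c_mul -q2c_scale Av.
suff -> : rscale v l = rscale v (quatC m1) by [].
apply/eqP; rewrite -subr_eq0; apply/eqP; rewrite -[RHS]u0 /u /rscale raddfB.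
by rewrite mulmxBr.
Qed.

Lemma complex_right_eigenvalue (A : 'M[H]_n.+1) (m : C) (w : 'cV[C]_((n + n.+1).+1)) :
  w != 0 -> (Phi A : cmat) *m w = m *: w -> right_eigenvalue A (quatC m).
Proof.
move=> w0 Mw; exists (@c2q R n.+1 w); first exact: c2q_neq0.
by rewrite -c2q_scale -c2q_mul; congr (c2q _).
Qed.

Section Lift.
Variable A : SL R n.
Let M : cmat := Phi (val A).
Let M' : cmat := Phi (val (A^-1)%g).

Lemma Phi_SL_mulrV : M * M' = 1.
Proof.
have AA' : val A *m val (A^-1)%g = 1%:M by exact: mulmxVH (SL_det_neq0 A).
have : Phi (val A) *m Phi (val (A^-1)%g) = 1%:M by rewrite -PhiM AA' Phi1.
exact.
Qed.

Lemma Phi_SL_mulVr : M' * M = 1.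
Proof.
have A'A : val (A^-1)%g *m val A = 1%:M by exact: mulVmxH (SL_det_neq0 A).
have : Phi (val (A^-1)%g) *m Phi (val A) = 1%:M by rewrite -PhiM A'A Phi1.
exact.
Qed.

Lemma spectral_SL : exists s E K, [/\ spectral M s id E K,
  spectral M' s (fun l => l^-1) E K,
  (forall l, l \in s -> E l != 0 /\
     exists2 w : 'cV[C]_((n + n.+1).+1), w != 0 & M *m w = l *: w),
  (forall l, l \in s -> l != 0) /\ s != [::]
  & (forall l, l \in s -> normc l = 1) \/
    exists l1 l2, [/\ l1 \in s, l2 \in s & normc l1 != normc l2] ].
Proof.
have [rt [s [E [K [sp detM rs eig]]]]] := spectral_exists M.
have detM1 : \det M = 1 by have := SL_det A.
have n1 : \prod_(l <- rt) normc l = 1.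
  rewrite -(big_morph normc (@ComplexField.Normc.normcM R) (ComplexField.Normc.normc1 R)).
  by rewrite -detM detM1 ComplexField.Normc.normc1.
have s0 l : l \in s -> l != 0.
  move=> ls; apply/eqP => l0; have := n1; rewrite (big_rem l) /=; last by rewrite rs.
  by rewrite l0 ComplexField.Normc.normc0 mul0r => /eqP; rewrite eq_sym oner_eq0.
exists s, E, K; split.
- exact: sp.
- exact: spectral_inverse Phi_SL_mulrV Phi_SL_mulVr s0 sp.
- move=> l ls; have [w w0 Mw] := eig l ls; split; last by exists w.
  have [_ Ew] := spectral_eigenvector sp w0 Mw.
  by apply: contraNneq w0 => E0; rewrite -Ew E0 mul0mx.
- split; first exact: s0.
  case: sp => _ sE _ _ _; apply/eqP => snil; move: sE.
  by rewrite snil big_nil => /eqP; rewrite eq_sym oner_eq0.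
(* If all moduli were equal, the determinant 1 would make a positive power of their common value
   equal to 1, hence the value itself. *)
have [all1|] := pselect (forall l, l \in s -> normc l = 1); first by left.
move=> nall1; right; apply: contrapT => same; apply: nall1 => l ls.
have eql l' : l' \in rt -> normc l' = normc l.
  rewrite rs => l's; apply/eqP; apply: contrapT => /negP ll'.
  by apply: same; exists l', l.
move: n1; rewrite (eq_big_seq (fun=> normc l)) // big_const_seq count_predT.
have : (0 < size rt)%N by move: ls; rewrite -rs; case: (rt).
case: (size rt) => // k _; rewrite iter_mulr_1 => /eqP.
by rewrite pexpr_eq1 // ?normc_ge0 // => /eqP.
Qed.


Let B (b : bool) : SL R n := if b then A else (A^-1)%g.
Let lam (b : bool) (l : C) : C := if b then l else l^-1.
Let S := ~` equicontinuity_set (cyclic_subgroup (\pi_(PSL R n) A)).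

Lemma unit_modulus_spectrum s E K : spectral M s id E K ->
  (forall l, l \in s -> exists2 w : 'cV[C]_((n + n.+1).+1), w != 0 & M *m w = l *: w) ->
  (forall l, PSL_eigenvalue (\pi_(PSL R n) A) l -> qmod l = 1) <->
  (forall l, l \in s -> normc l = 1).
Proof.
move=> sp eig; split=> u1 l.
  move=> /eig[w w0 Mw]; rewrite -qmod_quatC; apply: u1; exists A; first by [].
  exact: complex_right_eigenvalue w0 Mw.
move=> /PSL_eigenvalue_modulus[l' /right_eigenvalue_complex[m [w [w0 Mw <-]]] <-] //.
by have [ms _] := spectral_eigenvector sp w0 Mw; exact: u1.
Qed.

Lemma proj_subspace_proj_set (V : set vec) v :
  right_subspace V -> V v -> v != 0 -> proj_subspace (proj_set V).
Proof.
move=> sV Vv v0; have [[|k] [Q bQ]] := right_subspace_basis sV.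
  have [_ /(_ v)[/(_ Vv)[c vE] _]] := bQ.
  by move: v0; rewrite vE [c]flatmx0 mulmx0 eqxx.
by exists k, V; split=> //; exists Q.
Qed.

Lemma proper_proj_set (V : set vec) v : right_subspace V -> ~ V v -> proj_set V <> setT.
Proof.
move=> sV nV VT.
have v0 : v != 0 by apply/eqP => v0; apply: nV; rewrite v0; case: sV.
apply: nV; apply/(proj_setP (nonzero_vec v0) sV).
by rewrite VT.
Qed.

Section Data.
Variables (s : seq C) (E : C -> cmat) (K : nat) (r : bool -> R) (d : bool -> nat).
Hypothesis sp : forall b, spectral (Phi (val (B b))) s (lam b) E K.
Hypothesis dom : forall b, dominant (Phi (val (B b))) s (lam b) E (r b) (d b).
Let slow b := slow_vectors (val (B b)) s (lam b) E (r b) (d b).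

Let slow_sub b : right_subspace (slow b).
Proof. exact: (slow_right_subspace sp dom). Qed.

Lemma two_subspaces : (forall b l, l \in s -> normc (lam b l) = r b ->
    normc (lam (~~ b) l) <> r (~~ b)) -> union_of_two_proper_subspaces S.
Proof.
move=> rr'.
have sep b : exists v, [/\ v != 0, slow (~~ b) v & ~ slow b v].
  have [w [[l [ls lr Xw]] Xw']] := dominant_component_vector
    (Phi (val (B (~~ b))) : cmat) (d (~~ b)) (sp b) (dom b) (rr' b).
  have nsl : ~ slow b (@c2q R n.+1 w).
    by move=> /(_ l ls lr); rewrite c2qK.
  exists (@c2q R n.+1 w); split=> //.
    by apply/eqP => w0; apply: nsl; rewrite w0; case: (slow_sub b).
  by move=> k ks kr; rewrite c2qK; exact: Xw'.
have [v1 [v10 v1f v1t]] := sep true; have [v2 [v20 v2t v2f]] := sep false.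
have ntf : ~ proj_set (slow true) `<=` proj_set (slow false).
  move=> sub; apply: v2f; apply/(proj_setP (nonzero_vec v20) (slow_sub false)).
  by apply: sub; apply/proj_setP.
have nft : ~ proj_set (slow false) `<=` proj_set (slow true).
  move=> sub; apply: v1t; apply/(proj_setP (nonzero_vec v10) (slow_sub true)).
  by apply: sub; apply/proj_setP.
exists (proj_set (slow true)), (proj_set (slow false)); split.
- split; first exact: proj_subspace_proj_set (slow_sub true) v2t v20.
  exact: proper_proj_set (slow_sub true) v1t.
- split; first exact: proj_subspace_proj_set (slow_sub false) v1f v10.
  exact: proper_proj_set (slow_sub false) v2f.
- by move=> E12; apply: ntf; rewrite E12.
- by split.
- exact: (equicontinuity_complement sp dom).
Qed.

End Data.

End Lift.
End Classification.

(** * Unit moduli: bounded powers and diagonalizability *)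

Section EllipticParabolic.
Variables (R : realType) (n : nat).
Local Notation C := R[i].
Local Notation H := (quat R).
Local Notation vec := ('cV[H]_n.+1).
Local Notation normc := (@ComplexField.Normc.normc R).
Local Notation cmat := ('M[C]_((n + n.+1).+1)).

Lemma qn_qmod (q : H) : qn q <= 2 * qmod q.
Proof.
case: q => a b c d; rewrite /qn mulr_natl mulr2n /qmod /qnorm2.
have := sqr_ge0 a; have := sqr_ge0 b; have := sqr_ge0 c; have := sqr_ge0 d => /=.
move: (a ^+ 2) (b ^+ 2) (c ^+ 2) (d ^+ 2) => x y z w w0 z0 y0 x0.
by apply: lerD; apply: ler_wsqrtr; lra.
Qed.

Lemma qmodX (q : H) m : qmod (q ^+ m) = qmod q ^+ m.
Proof.
elim: m => [|m IH]; last by rewrite !exprS qmodM IH.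
by rewrite !expr0 /qmod /qnorm2 /= expr1n expr0n /= !addr0 sqrtr1.
Qed.

Lemma diagonalizable_bounded_powers (A P D : 'M[H]_n.+1) : detH P != 0 ->
  is_diag_mx D -> A = P *m D *m invmxH P ->
  (forall l, right_eigenvalue A l -> qmod l = 1) ->
  exists B, forall m, mxn qn (A ^+ m) <= B.
Proof.
move=> dP /is_diag_mxP diagD AE u1.
have nQ := qn_ring_norm R.
have AP : A *m P = P *m D by rewrite AE -mulmxA mulVmxH // mulmx1.
have PDcol j : P *m D *m delta_mx j 0 = rscale (P *m delta_mx j 0) (D j j) :> vec.
  rewrite /rscale -!mulmxA; congr (_ *m _); rewrite -colE.
  apply/matrixP => i k; rewrite ord1 -/(rscale _ _) rscaleE !mxE eqxx andbT.
  by have [->|ij] := eqVneq i j; rewrite ?mul1r // mul0r diagD.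
have D1 j : qmod (D j j) = 1.
  apply: u1; exists (P *m delta_mx j 0); last by rewrite mulmxA AP PDcol.
  apply/eqP => Pj0; have := congr1 (mulmx (invmxH P)) Pj0.
  rewrite mulmxA mulVmxH // mul1mx mulmx0 => /matrixP/(_ j 0)/eqP.
  by rewrite !mxE !eqxx oner_eq0.
pose Dm m : 'M[H]_n.+1 := \matrix_(i, j) if i == j then D i i ^+ m else 0.
have AmP m : A ^+ m *m P = P *m Dm m.
  elim: m => [|m IH].
    rewrite expr0 mul1mx (_ : Dm 0%N = 1%:M) ?mulmx1 //.
    by apply/matrixP => i j; rewrite !mxE; case: eqP.
  rewrite exprS -mulmxE -mulmxA IH mulmxA AP -mulmxA; congr (_ *m _).
  apply/matrixP => i j; rewrite mxE (bigD1 i) //= big1 => [|k ki].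
    by rewrite addr0 !mxE; case: eqP; rewrite ?exprS ?mulr0.
  by rewrite diagD ?mul0r // eq_sym.
(* The diagonal entries of [Dm m] have modulus 1, so 2 bounds each entry by [qn_qmod]. *)
exists (mxn qn P * (\sum_(i < n.+1) \sum_(j < n.+1) 2) * mxn qn (invmxH P)) => m.
rewrite -[A ^+ m]mulmx1 -(mulmxVH dP) mulmxA AmP.
apply: le_trans (mxnM nQ _ _) _; apply: ler_wpM2r; first exact: (mxn_ge0 nQ).
apply: le_trans (mxnM nQ _ _) _; apply: ler_wpM2l; first exact: (mxn_ge0 nQ).
apply: ler_sum => i _; apply: ler_sum => j _; rewrite mxE.
case: eqP => _; first by apply: le_trans (qn_qmod _) _; rewrite qmodX D1 expr1n mulr1.
have [_ q0 _ _ _] := nQ; by rewrite (proj2 (q0 0)).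
Qed.

Lemma mxn_realscale (t : R) (A : 'M[H]_n.+1) : mxn qn (realscale t A) = `|t| * mxn qn A.
Proof.
apply: (mulfI (_ : (2 : R) != 0)); first by rewrite pnatr_eq0.
by rewrite -mxn_Phi Phi_realscale mxn_scale normc_real mxn_Phi; ring.
Qed.

(** For positive [d] the divisor ['C(m, d)] tends to infinity, so the normalized bounded powers tend
    to 0, whereas their limit points are nonzero. *)
Lemma bounded_powers_exponent (A : 'M[H]_n.+1) s lam (E : C -> cmat) K d B :
  spectral (Phi A : cmat) s lam E K -> dominant (Phi A : cmat) s lam E 1 d ->
  (forall m, mxn qn (A ^+ m) <= B) -> d = 0%N.
Proof.
move=> sp dom AB; have nQ := qn_ring_norm R.
case: d dom => // d dom.
have [f [T [fh fT kerT]]] := normalized_subsequence sp dom (@cvg_id _ \oo).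
have N0 : mx_lim qn \oo (normalized A 1 d.+1) 0.
  apply: (@mx_lim0P _ _ _ nQ _ _ _ _ _ _
    (* The numerator 1 is written ['C(m, 0)] so that [bin_ratio_cvg0] applies. *)
    (fun m => 'C(m, 0)%:R / 'C(m, d.+1)%:R * B)).
    near=> m; rewrite mxn_realscale /growth expr1n mul1r bin0 mul1r.
    rewrite ger0_norm ?invr_ge0 ?ler0n //; apply: ler_wpM2l => //.
  by rewrite -(mul0r B); apply: cvgM; [exact: bin_ratio_cvg0|exact: cvg_cst].
have T0 : T = 0.
  apply: (mx_lim_unique nQ fT).
  exact: (mx_lim_comp (homo_cvg_oo fh) N0).
have [v] := slow_vectors_proper dom.
by case; apply/kerT; rewrite T0 mul0mx.
Unshelve. all: by end_near. Qed.

(** For [d = 0] and a single modulus, being slow means that every component [E l *m q2c v] vanishes,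
    and these add up to [q2c v]. *)
Lemma slow_vectors_exponent0 (A : 'M[H]_n.+1) s lam (E : C -> cmat) K r v :
  spectral (Phi A : cmat) s lam E K -> (forall l, l \in s -> normc (lam l) = r) ->
  slow_vectors A s lam E r 0 v -> v = 0.
Proof.
case=> us sE _ _ _ lr sv; apply/eqP; rewrite -q2c_eq0; apply/eqP.
have : q2c v = \sum_(l <- s) E l *m q2c v.
  by rewrite -mulmx_suml sE; apply/esym; exact: mul1mx.
rewrite big1_seq // => l /andP[_ ls].
by have := sv l ls (lr l ls); rewrite expr0 mul1r.
Qed.

Lemma exponent0_diagonalizable (A : 'M[H]_n.+1) s (E : C -> cmat) K :
  spectral (Phi A : cmat) s id E K ->
  (forall l, l \in s -> ((Phi A : cmat) - l%:M) * E l = 0) ->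
  exists P D : 'M[H]_n.+1, [/\ detH P != 0, is_diag_mx D & A = P *m D *m invmxH P].
Proof.
case=> us sE _ _ _ ME; apply: eigenvectors_diagonalize => v.
exists [seq @c2q R n.+1 (E l *m q2c v) | l <- s]; split.
  rewrite big_map -(big_morph (@c2q R n.+1) (@c2qD R n.+1) (@c2q0 R n.+1)).
  rewrite -mulmx_suml sE -[LHS]q2cK; congr (c2q _).
  by apply/esym; exact: mul1mx.
move=> x /mapP[l ls ->]; exists (quatC l).
have MEl : (Phi A : cmat) *m (E l *m q2c v) = l *: (E l *m q2c v).
  apply/eqP; rewrite -subr_eq0 -mul_scalar_mx -mulmxBl mulmxA.
  by rewrite [_ *m E l]ME // mul0mx.
by rewrite -c2q_scale -c2q_mul; congr (c2q _).
Qed.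

(** A nonzero column of [X ^+ d * E l] is slow: another [X ^+ d] kills it because [d + d >= d.+1],
    and the projectors of other eigenvalues kill it by orthogonality. *)
Lemma slow_vectors_nonzero (A : 'M[H]_n.+1) s lam (E : C -> cmat) K r d :
  spectral (Phi A : cmat) s lam E K -> dominant (Phi A : cmat) s lam E r d ->
  (0 < d)%N -> exists2 v, v != 0 & slow_vectors A s lam E r d v.
Proof.
move=> sp [_ _ top [l [ls lr Xd]]] d0; have [_ _ EM _ EE] := sp.
have [j Xj] := nonzero_column Xd.
set X := (Phi A : cmat) - (lam l)%:M in Xd Xj.
exists (@c2q R n.+1 (X ^+ d * E l *m delta_mx j 0)); first exact: c2q_neq0.
move=> k ks kr; rewrite c2qK mulmxA mulmxE.
have XE : X ^+ d * E l = E l * X ^+ d.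
  apply/commr_sym/commrX; apply/commr_sym; apply: commr_sym; apply: commrB.
    exact/commr_sym/EM.
  exact: scalar_mxC.
have [kl|kl] := eqVneq k l; last first.
  by rewrite XE -mulrA [E k * (_ * _)]mulrA EE // mul0r mulr0 mul0mx.
rewrite kl -/X -mulrA [E l * _]mulrA -XE -[_ * E l * E l]mulrA (spectral_idem sp ls).
rewrite mulrA -exprD -(subnK (_ : d.+1 <= d + d)%N); last by rewrite -addn1 leq_add2l.
by rewrite exprD -mulrA top // mulr0 mul0mx.
Qed.

End EllipticParabolic.

(** * The possible shapes of the complement *)

Section Trichotomy.
Variables (R : realType) (n : nat).
Local Notation C := R[i].
Local Notation H := (quat R).
Local Notation vec := ('cV[H]_n.+1).
Local Notation PP := (projspace R n).
Local Notation normc := (@ComplexField.Normc.normc R).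
Local Notation cmat := ('M[C]_((n + n.+1).+1)).

Lemma proj_subspace_nonempty (L : set PP) : proj_subspace L -> L !=set0.
Proof.
case=> k [V [_ [Q [freeQ QV]] ->]].
have Q0 : Q *m delta_mx 0 0 != 0 :> vec.
  apply/eqP => /freeQ /matrixP/(_ 0 0)/eqP.
  by rewrite !mxE !eqxx oner_eq0.
exists (projpt Q0); exists (nonzero_vec Q0) => //.
by apply/QV; exists (delta_mx 0 0).
Qed.

Lemma union_of_two_nonempty (S : set PP) : union_of_two_proper_subspaces S -> S !=set0.
Proof. by case=> L1 [L2 [[/proj_subspace_nonempty[p L1p] _] _ _ _ ->]]; exists p; left. Qed.

(** Incomparability gives [a] in [V1] only and [b] in [V2] only; [a + b] would lie in the union, but
    subtracting [a] or [b] shows that it is in neither. *)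
Lemma union_of_two_not_subspace (S : set PP) :
  union_of_two_proper_subspaces S -> ~ proj_subspace S.
Proof.
case=> L1 [L2 [[[k1 [V1 [sV1 _ L1E]]] _] [[k2 [V2 [sV2 _ L2E]]] _] _ [L12 L21] SE]].
case=> k [V [sV _ SV]].
rewrite -/(proj_set V1) in L1E; rewrite -/(proj_set V2) in L2E; rewrite -/(proj_set V) in SV.
have V1V (z : nzvec R n) : V1 (val z) -> V (val z).
  by move=> V1z; apply/proj_setP => //; rewrite -SV SE L1E; left; exists z.
have V2V (z : nzvec R n) : V2 (val z) -> V (val z).
  by move=> V2z; apply/proj_setP => //; rewrite -SV SE L2E; right; exists z.
have [a V1a nV2a] : exists2 a : nzvec R n, V1 (val a) & ~ V2 (val a).
  apply: contrapT => na; apply: L12; rewrite L1E L2E => _ [a V1a <-].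
  by exists a => //; apply: contrapT => nV2a; apply: na; exists a.
have [b V2b nV1b] : exists2 b : nzvec R n, V2 (val b) & ~ V1 (val b).
  apply: contrapT => nb; apply: L21; rewrite L1E L2E => _ [b V2b <-].
  by exists b => //; apply: contrapT => nV1b; apply: nb; exists b.
have minus (W : set vec) u v : right_subspace W -> W (u + v) -> W u -> W v.
  move=> [_ WD WZ] Wuv Wu; have -> : v = (u + v) + rscale u (- 1).
    apply/matrixP => i j; rewrite ord1 mxE [in RHS]mxE rscaleE mulrN mulr1.
    by rewrite addrAC subrr add0r.
  by apply: WD => //; exact: WZ.
have ab0 : val a + val b != 0.
  apply/eqP => ab0; apply: nV1b; apply: (minus _ _ _ sV1 _ V1a).
  by rewrite ab0; case: sV1.
have : S (projpt ab0).
  rewrite SV; apply/(proj_setP (nonzero_vec ab0) sV) => /=.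
  by case: (sV) => _ VD _; apply: VD; [exact: V1V|exact: V2V].
rewrite SE L1E L2E => -[/(proj_setP (nonzero_vec ab0) sV1)|
    /(proj_setP (nonzero_vec ab0) sV2)] /= Wab.
  by apply: nV1b; exact: (minus _ _ _ sV1 Wab V1a).
by apply: nV2a; rewrite addrC in Wab; exact: (minus _ _ _ sV2 Wab V2b).
Qed.

Section Lift.
Variable A : SL R n.
Let M : cmat := Phi (val A).
Let M' : cmat := Phi (val (A^-1)%g).
Let S := ~` equicontinuity_set (cyclic_subgroup (\pi_(PSL R n) A)).

Definition unit_moduli := forall l, PSL_eigenvalue (\pi_(PSL R n) A) l -> qmod l = 1.

Lemma nonunit_complement : ~ unit_moduli -> union_of_two_proper_subspaces S.
Proof.
move=> nu; have [s [E [K [sp sp' eig [s0 snil] u1]]]] := spectral_SL A.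
case: u1 => [u1|[l1 [l2 [l1s l2s l12]]]].
  case: nu; exact: (proj2 (unit_modulus_spectrum sp (fun l ls => (eig l ls).2)) u1).
have E0 l : l \in s -> E l != 0 by move=> ls; exact: (eig l ls).1.
have [r1 [d1 dom1]] := dominant_exists sp snil E0 s0.
have s0' l : l \in s -> l^-1 != 0 by move=> ls; rewrite invr_eq0 s0.
have [r2 [d2 dom2]] := dominant_exists sp' snil E0 s0'.
have bounds := dominant_norm_bounds dom1 dom2 s0 l1s l2s l12.
pose B (b : bool) : SL R n := if b then A else (A^-1)%g.
pose lam (b : bool) (l : C) := if b then l else l^-1.
pose r (b : bool) := if b then r1 else r2; pose d (b : bool) := if b then d1 else d2.
have sp_b b : spectral (Phi (val (B b)) : cmat) s (lam b) E K.
  by case: b; [exact: sp|exact: sp'].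
have dom_b b : dominant (Phi (val (B b)) : cmat) s (lam b) E (r b) (d b).
  by case: b; [exact: dom1|exact: dom2].
apply: (two_subspaces sp_b dom_b); case=> l ls lr; first exact: bounds ls lr.
by move=> lr1; exact: bounds ls lr1 lr.
Qed.

Section Unit.
Hypothesis unitA : unit_moduli.

(** By [inverse_shift_eq0] the slow vectors of [A] and of its inverse satisfy equivalent equations,
    so the two projective sets of [equicontinuity_complement] merge into one. *)
Lemma unit_data : exists s E K d, [/\ spectral M s id E K,
  forall l, l \in s -> normc l = 1,
  dominant M s id E 1 d
  & S = proj_set (slow_vectors (val A) s id E 1 d)].
Proof.
have [s [E [K [sp sp' eig [s0 snil] _]]]] := spectral_SL A.
have u1 : forall l, l \in s -> normc l = 1.
  exact: (proj1 (unit_modulus_spectrum sp (fun l ls => (eig l ls).2)) unitA).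
have E0 l : l \in s -> E l != 0 by move=> ls; exact: (eig l ls).1.
have [r [d dom]] := dominant_exists sp snil E0 s0.
have [r1 dom'] := dominant_inverse (Phi_SL_mulrV A) (Phi_SL_mulVr A) s0 u1 dom.
rewrite r1 in dom dom'.
exists s, E, K, d; split; [exact: sp|exact: u1|exact: dom|].
pose B (b : bool) : SL R n := if b then A else (A^-1)%g.
pose lam (b : bool) (l : C) := if b then l else l^-1.
have sp_b b : spectral (Phi (val (B b)) : cmat) s (lam b) E K.
  by case: b; [exact: sp|exact: sp'].
have dom_b b : dominant (Phi (val (B b)) : cmat) s (lam b) E 1 d.
  by case: b; [exact: dom|exact: dom'].
rewrite /S (equicontinuity_complement sp_b dom_b).
suff -> : slow_vectors (val (A^-1)%g) s (lam false) E 1 d =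
    slow_vectors (val A) s (lam true) E 1 d by rewrite setUid.
have v1 l : l \in s -> normc l^-1 = 1.
  by move=> ls; rewrite ComplexField.Normc.normcV u1 // invr1.
have assoc (X : cmat) l (w : 'cV[C]_((n + n.+1).+1)) : (X * E l) *m w = X *m (E l *m w).
  by rewrite mulmxA.
have eqv l (w : 'cV[C]_((n + n.+1).+1)) : l \in s ->
    ((M' - (l^-1)%:M) ^+ d * E l) *m w = 0 <-> ((M - l%:M) ^+ d * E l) *m w = 0.
  move=> ls; set X' := (M' - (l^-1)%:M) ^+ d; set X := (M - l%:M) ^+ d.
  have eqX : X' *m (E l *m w) = 0 <-> X *m (E l *m w) = 0.
    exact: inverse_shift_eq0 (Phi_SL_mulrV A) (Phi_SL_mulVr A) (s0 l ls).
  split=> h; apply: (etrans (assoc _ l w)).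
    exact: (proj1 eqX (etrans (esym (assoc X' l w)) h)).
  exact: (proj2 eqX (etrans (esym (assoc X l w)) h)).
apply/seteqP; split=> v slv l ls lr.
  exact: (proj1 (eqv l (q2c v) ls) (slv l ls (v1 l ls))).
exact: (proj2 (eqv l (q2c v) ls) (slv l ls (u1 l ls))).
Qed.

Lemma elliptic_complement (P D : 'M[H]_n.+1) : detH P != 0 -> is_diag_mx D ->
  val A = P *m D *m invmxH P -> S = set0.
Proof.
move=> dP diagD AE; have [s [E [K [d [sp u1 dom SE]]]]] := unit_data.
have [B AB] : exists B, forall m, mxn qn (val A ^+ m) <= B.
  apply: diagonalizable_bounded_powers dP diagD AE _ => l lA.
  by apply: unitA; exists A.
have d0 := bounded_powers_exponent sp dom AB.
rewrite SE; apply/seteqP; split=> // _ [z slz <-].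
have slz0 : slow_vectors (val A) s id E 1 0 (val z).
  by move: slz; rewrite d0; exact.
by have := nzvec_neq0 z; rewrite (slow_vectors_exponent0 sp u1 slz0) eqxx.
Qed.

Lemma parabolic_complement : ~ semisimple (\pi_(PSL R n) A) -> proj_subspace S.
Proof.
move=> nss; have [s [E [K [d [sp u1 dom SE]]]]] := unit_data.
have [d0|d0] := posnP d.
  case: nss; exists A; first by [].
  apply: (exponent0_diagonalizable sp) => l ls.
  by have [_ _ top _] := dom; have := top l ls (u1 l ls); rewrite d0 expr1.
have [v v0 slv] := slow_vectors_nonzero sp dom d0.
rewrite SE; apply: proj_subspace_proj_set slv v0.
have [f [T [_ _ kerT]]] := normalized_subsequence sp dom (@cvg_id _ \oo).
have -> : slow_vectors (val A) s id E 1 d = [set v : vec | T *m v = 0].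
  by apply/seteqP; split=> w /kerT.
exact: kernel_right_subspace.
Qed.

End Unit.
End Lift.
End Trichotomy.

Theorem theorem1p4 (R : realType) (n : nat) (gamma : PSL R n) :
  [/\ elliptic gamma <-> equicontinuity_set (cyclic_subgroup gamma) = setT,
      parabolic gamma <->
        (exists L : set (projspace R n),
           proj_subspace L /\ ~` equicontinuity_set (cyclic_subgroup gamma) = L),
      loxodromic gamma <->
        semisimple gamma /\
        union_of_two_proper_subspaces (~` equicontinuity_set (cyclic_subgroup gamma))
    & loxoparabolic gamma <->
        ~ semisimple gamma /\
        union_of_two_proper_subspaces (~` equicontinuity_set (cyclic_subgroup gamma))].
Proof.
set S := ~` _; pose unit_mod := forall l, PSL_eigenvalue gamma l -> qmod l = 1.
have uE : unit_eigenclasses gamma <-> unit_mod by exact: unit_eigenclassesP.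
have [A gammaE] : exists A, \pi_(PSL R n) A = gamma by exists (repr gamma); exact: reprK.
have ell : semisimple gamma -> unit_mod -> S = set0.
  move=> [A' A'E [P [D [dP diagD A'D]]]] u.
  rewrite /S -A'E; apply: elliptic_complement dP diagD A'D.
  by rewrite /unit_moduli A'E.
have par : ~ semisimple gamma -> unit_mod -> proj_subspace S.
  by rewrite /S /unit_mod -gammaE => nss u; exact: parabolic_complement.
have lox : ~ unit_mod -> union_of_two_proper_subspaces S.
  by rewrite /S /unit_mod -gammaE; exact: nonunit_complement.
have S0 : equicontinuity_set (cyclic_subgroup gamma) = setT <-> S = set0.
  by split=> [eT|S0]; [rewrite /S eT setCT|rewrite -[LHS]setCK -/S S0 setC0].
(* With unit moduli, [S] would be empty or a subspace according to semisimplicity, and a union of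
   two incomparable subspaces is neither. *)
have union_unit : union_of_two_proper_subspaces S -> ~ unit_mod.
  move=> US u; have [ss|nss] := pselect (semisimple gamma).
    by have := union_of_two_nonempty US; rewrite ell // => -[].
  exact: union_of_two_not_subspace US (par nss u).
have nonunitE : ~ unit_mod <-> exists2 l, PSL_eigenvalue gamma l & qmod l <> 1.
  split=> [nu|[l lg l1] u]; last by apply: l1; exact: u.
  apply: contrapT => nl; apply: nu => l lg; apply: contrapT => l1.
  by apply: nl; exists l.
split.
- split=> [[ss /uE u]|/S0 SE]; first by apply/S0; exact: ell.
  have [u|/lox/union_of_two_nonempty] := pselect unit_mod; last by rewrite SE => -[].
  split; last exact/uE.
  apply: contrapT => nss; have := proj_subspace_nonempty (par nss u).
  by rewrite SE => -[].
- split=> [[nss u]|[L [pL SL]]]; first by exists S; split=> //; exact: par.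
  rewrite -SL in pL; have [u|nu] := pselect unit_mod; last first.
    by have := union_of_two_not_subspace (lox nu) pL.
  split=> // ss; have := proj_subspace_nonempty pL; rewrite ell // => -[].
  by [].
- split=> [[ss nu]|[ss US]]; split=> //.
    by apply: lox => u; apply: nu; exact/uE.
  by move=> /uE; exact: union_unit.
- split=> [[nss /nonunitE nu]|[nss US]]; split=> //; first exact: lox.
  by apply/nonunitE; exact: union_unit.
Qed.
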